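(* Let $$S(t,\lambda,\varepsilon)=\tau[\log((x_0+i\sigma_t-\lambda)^*(x_0+i\sigma_t-\lambda)+\varepsilon)],\qquad \lambda\in\mathbb{C},\ \varepsilon>0,$$ and write $\lambda=a+ib$ with $a,b\in\mathbb{R}$. Then the function $S$ satisfies the PDE $$\frac{\partial S}{\partial t}=\frac14\left(\left(\frac{\partial S}{\partial a}\right)^2-\left(\frac{\partial S}{\partial b}\right)^2\right)+\varepsilon\left(\frac{\partial S}{\partial\varepsilon}\right)^2$$ subject to the initial condition $$S(0,\lambda,\varepsilon)=\tau[\log((x_0-\lambda)^*(x_0-\lambda)+\varepsilon)].$$
   Context: $(\mathcal{A},\tau)$ is a tracial von Neumann algebra (finite von Neumann algebra with a faithful normal tracial state $\tau$); $\sigma_t\in\mathcal{A}$, $t\ge0$, is a free semicircular Brownian motion (with $\sigma_0=0$); $x_0\in\mathcal{A}$ is a bounded Hermitian (self-adjoint) element freely independent of each $\sigma_t$, $t>0$. Standing assumption of the paper: the law of $x_0$ is not supported at a single point. *)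

(* Defs.v *)
From HB Require Import structures.
From mathcomp Require Import all_boot all_order all_algebra.
From mathcomp Require Import complex.
From mathcomp Require Import all_classical all_reals all_analysis.

Set Implicit Arguments.
Unset Strict Implicit.
Unset Printing Implicit Defensive.

Import Order.TTheory GRing.Theory Num.Theory.
Import numFieldNormedType.Exports.

Local Open Scope classical_set_scope.
Local Open Scope ring_scope.
Local Open Scope complex_scope.

Section Operators.
Context {R : realType} {H : completeNormedModType R[i]}.

Definition bounded_operator (T : H -> H) : Prop := linear T /\ continuous T.

(* Elements of the commutant are bounded operators by definition. *)
Definition commutant (S : set (H -> H)) : set (H -> H) :=
  [set T | bounded_operator T /\ forall s, S s -> T \o s = s \o T].

End Operators.

(* A von Neumann algebra acting on a complex Hilbert space [hilb].  Its elements
   are presented as a complex algebra [vna_alg] together with a faithful unital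
   *-representation whose range is equal to its own bicommutant.  The inner
   product is linear in its first argument. *)
Record vonNeumannAlgebra (R : realType) := VonNeumannAlgebra {
  hilb : completeNormedModType R[i] ;
  inner : {dot hilb for Num.conj} ;
  normE : forall h : hilb, `|h| ^+ 2 = inner h h ;
  vna_alg :> algType R[i] ;
  star : vna_alg -> vna_alg ;
  rep : vna_alg -> hilb -> hilb ;
  rep_inj : injective rep ;
  rep_linear : forall (c : R[i]) (x y : vna_alg) (h : hilb),
    rep (c *: x + y) h = c *: rep x h + rep y h ;
  rep1 : forall h : hilb, rep 1 h = h ;
  repM : forall (x y : vna_alg) (h : hilb), rep (x * y) h = rep x (rep y h) ;
  rep_star : forall (x : vna_alg) (h k : hilb),
    inner (rep x h) k = inner h (rep (star x) k) ;
  rep_bicommutant : range rep = commutant (commutant (range rep))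
}.

Arguments star {R v} x.
Arguments rep {R v} x h.

Section VonNeumannTheory.
Context {R : realType} {A : vonNeumannAlgebra R}.
Implicit Types x y z : A.

Definition selfadjoint : set A := [set x | star x = x].

Definition op_le x y : Prop := exists z, y - x = star z * z.

Definition op_directed (D : set A) : Prop :=
  forall y z, D y -> D z -> exists w, [/\ D w, op_le y w & op_le z w].

Definition op_lub (D : set A) x : Prop :=
  [/\ selfadjoint x, forall y, D y -> op_le y x &
      forall z, selfadjoint z -> (forall y, D y -> op_le y z) -> op_le x z].

(* [r] bounds the operator norm of [x]. *)
Definition opnorm_le x (r : R) : Prop :=
  forall h : hilb A, `|rep x h| <= r%:C * `|h|.

Definition opnorm_cvg (u : nat -> A) x : Prop :=
  forall e : R, 0 < e -> \forall n \near \oo, opnorm_le (u n - x) e.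

Definition spectrum x : set R[i] :=
  [set z | ~ exists y, (x - z%:A) * y = 1 /\ y * (x - z%:A) = 1].

(* Continuous functional calculus of a self-adjoint [x] (whose spectrum is
   real): [y = f(x)] is the norm limit of [p_n(x)], for real polynomials [p_n]
   converging to [f] uniformly on the spectrum of [x]. *)
Definition is_functional_calculus (f : R -> R) x y : Prop :=
  exists p : nat -> {poly R},
    (forall e : R, 0 < e -> \forall n \near \oo, forall r : R,
       spectrum x r%:C -> `|(p n).[r] - f r| <= e) /\
    opnorm_cvg (fun n => horner_alg x (map_poly (real_complex R) (p n))) y.

(* Junk value 0 when there is no such [y]. *)
Definition functional_calculus (f : R -> R) x : A :=
  xget 0 [set y | is_functional_calculus f x y].

Definition op_log x : A := functional_calculus (@ln R) x.

Definition star_subalgebra (B : set A) : Prop :=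
  [/\ B 1, forall (c : R[i]) y z, B y -> B z -> B (c *: y + z),
      forall y z, B y -> B z -> B (y * z) & forall y, B y -> B (star y)].

Definition gen_star_subalgebra x : set A :=
  [set y | forall B, star_subalgebra B -> B x -> B y].

End VonNeumannTheory.

Record tracialVNA (R : realType) := TracialVNA {
  tvna_alg :> vonNeumannAlgebra R ;
  tau : {scalar tvna_alg} ;
  tau1 : tau 1 = 1 ;
  tau_ge0 : forall x : tvna_alg, 0 <= tau (star x * x) ;
  tau_faithful : forall x : tvna_alg, tau (star x * x) = 0 -> x = 0 ;
  tau_tracial : forall x y : tvna_alg, tau (x * y) = tau (y * x) ;
  (* normality: tau (sup D) = sup (tau D) *)
  tau_normal : forall (D : set tvna_alg) (x : tvna_alg),
    D !=set0 -> D `<=` selfadjoint -> op_directed D -> op_lub D x ->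
    forall r : R[i], (forall y, D y -> tau y <= r) -> tau x <= r
}.

Arguments tau {R t}.

Section FreeProbability.
Context {R : realType} {A : tracialVNA R}.

(* The law of a bounded self-adjoint [x]: the compactly supported probability
   measure on the line with the same moments as [x]. *)
Definition has_law (x : A) (mu : probability (measurableTypeR R) R) : Prop :=
  [/\ selfadjoint x,
      exists K : R, mu [set r : R | K < `|r|] = 0%E &
      forall n : nat, tau (x ^+ n) = (\int[mu]_r (r ^+ n))%:C].

Definition law_supported_at_point (x : A) : Prop :=
  exists mu, has_law x mu /\ exists c : R, mu [set c] = 1%E.

(* [Num.sqrt] vanishes on negative reals, so this is 0 off
   [- 2 sqrt v, 2 sqrt v]. *)
Definition semicircle_pdf (v r : R) : R :=
  Num.sqrt (4 * v - r ^+ 2) / (2 * pi * v).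

Definition semicircular (v : R) (x : A) : Prop :=
  exists2 mu, has_law x mu &
    forall E : set (measurableTypeR R), measurable E ->
      mu E = (\int[lebesgue_measure]_(r in E) (semicircle_pdf v r)%:E)%E.

Definition free_subalgebras (I : eqType) (B : I -> set A) : Prop :=
  forall s : seq (I * A), (0 < size s)%N ->
    sorted (fun u w => u.1 != w.1) s ->
    (forall u, u \in s -> B u.1 u.2 /\ tau u.2 = 0) ->
    tau (\prod_(u <- s) u.2) = 0.

Definition free_family (I : eqType) (x : I -> A) : Prop :=
  free_subalgebras (fun i => gen_star_subalgebra (x i)).

Definition freely_independent (x y : A) : Prop :=
  free_family (fun b : bool => if b then x else y).

(* Only the restriction of [sigma] to nonnegative times matters. *)
Definition free_semicircular_BM (sigma : R -> A) : Prop :=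
  [/\ sigma 0 = 0,
      forall s t : R, 0 <= s -> s < t -> semicircular (t - s) (sigma t - sigma s) &
      forall (n : nat) (t : nat -> R), 0 <= t 0%N ->
        {homo t : i j / (i < j)%N >-> i < j} ->
        free_family (fun i : 'I_n => sigma (t i.+1) - sigma (t i))].

Definition abs_sq (x : A) : A := star x * x.

(* The trace of the self-adjoint logarithm is a real number, whence [Re]. *)
Definition S_fun (x0 : A) (sigma : R -> A) (t : R) (lambda : R[i]) (eps : R) : R :=
  complex.Re (tau (op_log
    (abs_sq (x0 + (0 +i* 1) *: sigma t - lambda%:A) + (eps%:C)%:A))).

End FreeProbability.

(* [l] is the derivative at [t] of a function on [0, +oo[: the usual derivative
   for [0 < t], the right derivative for [t = 0]. *)
Definition is_derive_nonneg {R : realType} (f : R -> R) (t l : R) : Prop :=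
  h^-1 * (f (t + h) - f t) @[h --> within [set h | 0 <= t + h] 0^'] --> l.

(* Main.v *)
From HB Require Import structures.
Require Import Defs.
From mathcomp Require Import all_boot all_order all_algebra.
From mathcomp Require Import complex ring lra.
From mathcomp Require Import all_classical all_reals all_analysis.
From mathcomp Require Import measurable_realfun.

(** Write [y = x0 + i sigma_t - lambda], [X = y^* y + eps] and [G = X^-1]. With [c] large,
    [X = c (1 - Z)] and [|Z| < 1], so that [tau (log X) = ln c - \sum_k tau (Z^k) / k] and the
    derivative of [tau (log X)] along a path is [tau (G X')]; this gives the partial
    derivatives in [a], [b] and [eps] as [- 2 Re p], [2 Im p] and [g], where
    [p = tau (G y^* )] and [g = tau G].

    For the time derivative, freeness and the semicircle law yield the Schwinger-Dyson
    equation [tau (s w) = v (tau (x) tau) (D w)], with [D] the free difference quotient in [s].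
    It determines the joint moments of [x0] and [sigma_t], which are therefore those of
    [x0] and [sqrt t sigma_1]: [S(t)] is [Phi(sqrt t)] for the function [Phi(r)] built on
    [x0 + i r sigma_1]. Passing from polynomials to resolvents, the same equation turns
    [Phi'(r) = tau (G X')] into [2 r (eps g^2 + Re (p^2))], which is the equation for
    [t > 0]; the factor [r] and the Lipschitz continuity of the bracket give the right
    derivative at [t = 0]. *)

Set Implicit Arguments.
Unset Strict Implicit.
Unset Printing Implicit Defensive.

Import Order.TTheory GRing.Theory Num.Theory.
Import numFieldNormedType.Exports.

Local Open Scope classical_set_scope.
Local Open Scope ring_scope.
Local Open Scope complex_scope.

(** * A decision procedure for identities in noncommutative rings *)

(** An increment of [sigma] over a time [h] has norm of order [sqrt h], so [sigma t] is not
    differentiable in norm; and [x0] is free from each [sigma t] taken alone, which gives no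
    freeness between an increment and the pair of [x0] and [sigma t]. The joint law at a fixed time
    is what remains: replacing [sigma t] by [sqrt t *: sigma 1] keeps it and makes the path affine
    in [r = sqrt t], where calculus in norm applies. The logarithm is a chosen limit of polynomials,
    so identifying it with the series requires uniqueness of that limit, obtained by bounding a
    polynomial in a self-adjoint element by its supremum on the spectrum. For the Schwinger-Dyson
    equation, polynomials in [s] are expanded on rescaled Chebyshev polynomials: these have trace
    zero, so that alternating words in them and in centered elements fall directly under freeness,
    and multiplication by [s] acts on them by a three-term recursion. *)

Inductive ncexpr :=
  | NCvar of nat | NC0 | NC1 | NCadd of ncexpr & ncexpr | NCopp of ncexpr
  | NCmul of ncexpr & ncexpr.

(* The words occurring with a positive sign, then those with a negative one. *)
Fixpoint nc_words (e : ncexpr) : seq (seq nat) * seq (seq nat) :=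
  match e with
  | NCvar n => ([:: [:: n]], [::])
  | NC0 => ([::], [::])
  | NC1 => ([:: [::]], [::])
  | NCadd e1 e2 => ((nc_words e1).1 ++ (nc_words e2).1,
                    (nc_words e1).2 ++ (nc_words e2).2)
  | NCopp e1 => ((nc_words e1).2, (nc_words e1).1)
  | NCmul e1 e2 =>
      let (p1, n1) := nc_words e1 in let (p2, n2) := nc_words e2 in
      ([seq u ++ v | u <- p1, v <- p2] ++ [seq u ++ v | u <- n1, v <- n2],
       [seq u ++ v | u <- p1, v <- n2] ++ [seq u ++ v | u <- n1, v <- p2])
  end.

Section NCRing.
Context {R : pzRingType} (env : seq R).

Fixpoint nc_eval (e : ncexpr) : R :=
  match e with
  | NCvar n => nth 0 env n
  | NC0 => 0
  | NC1 => 1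
  | NCadd e1 e2 => nc_eval e1 + nc_eval e2
  | NCopp e1 => - nc_eval e1
  | NCmul e1 e2 => nc_eval e1 * nc_eval e2
  end.

Definition nc_word (w : seq nat) : R := \prod_(i <- w) nth 0 env i.

Lemma nc_sum_mul (s t : seq (seq nat)) :
  \sum_(w <- [seq u ++ v | u <- s, v <- t]) nc_word w =
  (\sum_(u <- s) nc_word u) * (\sum_(v <- t) nc_word v).
Proof.
rewrite big_allpairs_dep big_distrl; apply: eq_bigr => u _.
by rewrite big_distrr; apply: eq_bigr => v _; rewrite /nc_word big_cat.
Qed.

Lemma nc_evalE e : nc_eval e =
  \sum_(w <- (nc_words e).1) nc_word w - \sum_(w <- (nc_words e).2) nc_word w.
Proof.
elim: e => [n||| e1 IH1 e2 IH2|e1 IH1|e1 IH1 e2 IH2] /=.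
- by rewrite /nc_word !big_seq1 big_nil subr0.
- by rewrite !big_nil subr0.
- by rewrite big_seq1 /nc_word !big_nil subr0.
- by rewrite IH1 IH2 !big_cat opprD addrACA.
- by rewrite IH1 opprB.
- rewrite IH1 IH2; case: (nc_words e1) (nc_words e2) => p1 n1 [p2 n2] /=.
  by rewrite !big_cat /= !nc_sum_mul mulrBl !mulrBr opprB opprD addrACA.
Qed.

(** Moving the negative words to the other side leaves two multisets of words to compare, with no
    cancellation to perform; this is equality in the free ring on the atoms. *)
Lemma nc_eval_eq e1 e2 :
  perm_eq ((nc_words e1).1 ++ (nc_words e2).2)
          ((nc_words e2).1 ++ (nc_words e1).2) ->
  nc_eval e1 = nc_eval e2.
Proof.
move=> e12; rewrite !nc_evalE; apply/eqP.
by rewrite subr_eq addrAC eq_sym subr_eq -!big_cat /= (perm_big _ e12).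
Qed.

End NCRing.

(* Scalings are compared up to conversion, since the same scaling may be
   displayed over different canonical module structures. *)
Ltac nc_same x y :=
  match x with
  | y => idtac
  | (?a *: ?u)%R => match y with (?b *: ?v)%R => unify a b; unify u v end
  end.

Ltac nc_index x env :=
  match env with
  | ?y :: _ => let _ := match goal with _ => nc_same x y end in constr:(0%N)
  | _ :: ?env' => let n := nc_index x env' in constr:(n.+1)
  end.

Ltac nc_atoms env e :=
  match e with
  | (?a + ?b)%R => let env1 := nc_atoms env a in nc_atoms env1 b
  | (?a * ?b)%R => let env1 := nc_atoms env a in nc_atoms env1 b
  | (- ?a)%R => nc_atoms env a
  | 0%R => env
  | 1%R => env
  | _ => match env with
         | _ => let n := nc_index e env in env
         | _ => constr:(e :: env)
         end
  end.

Ltac nc_reify env e :=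
  match e with
  | (?a + ?b)%R => let a' := nc_reify env a in let b' := nc_reify env b in
                   constr:(NCadd a' b')
  | (?a * ?b)%R => let a' := nc_reify env a in let b' := nc_reify env b in
                   constr:(NCmul a' b')
  | (- ?a)%R => let a' := nc_reify env a in constr:(NCopp a')
  | 0%R => constr:(NC0)
  | 1%R => constr:(NC1)
  | _ => let n := nc_index e env in constr:(NCvar n)
  end.

Ltac ncring :=
  match goal with
  | |- @eq ?T ?l ?r =>
    let env0 := nc_atoms (@nil T) l in
    let env := nc_atoms env0 r in
    let l' := nc_reify env l in
    let r' := nc_reify env r in
    apply: (@nc_eval_eq _ env l' r'); vm_compute; reflexivity
  end.


(** * The operator norm *)

Section RealNorm.
Context {R : realType} {H : normedModType R[i]}.
Implicit Types h k : H.

(** The norm of a module over [R[i]] is itself valued in [R[i]]; its real part gives access to real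
    inequalities. *)
Definition rnorm h : R := complex.Re `|h|.

Lemma rnormE h : `|h| = (rnorm h)%:C.
Proof. by rewrite /rnorm RRe_real // normr_real. Qed.

Lemma rnorm_ge0 h : 0 <= rnorm h.
Proof. by rewrite -ler0c -rnormE. Qed.

Lemma rnormZ (c : R[i]) h : rnorm (c *: h) = complex.Re `|c| * rnorm h.
Proof.
apply: complexI; rewrite -rnormE normrZ rnormE rmorphM /=.
by rewrite RRe_real // normr_real.
Qed.

Lemma rnormD h k : rnorm (h + k) <= rnorm h + rnorm k.
Proof. by rewrite -lecR rmorphD /= -!rnormE ler_normD. Qed.

Lemma rnormN h : rnorm (- h) = rnorm h.
Proof. by rewrite /rnorm normrN. Qed.

Lemma rnorm0 : rnorm (0 : H) = 0.
Proof. by rewrite /rnorm normr0. Qed.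

Lemma rnorm_eq0 h : rnorm h = 0 -> h = 0.
Proof. by move=> h0; apply/normr0_eq0; rewrite rnormE h0. Qed.

Lemma rnorm_gt0 h : h != 0 -> 0 < rnorm h.
Proof.
move=> h0; rewrite lt_neqAle rnorm_ge0 andbT eq_sym.
by apply: contra_neq h0; exact: rnorm_eq0.
Qed.

End RealNorm.

Section OperatorNorm.
Context {R : realType} {A : vonNeumannAlgebra R}.
Implicit Types x y z : A.
Implicit Types h k : hilb A.

Lemma rep_bounded x : bounded_operator (rep x).
Proof.
have : range (@rep _ A) (rep x) by exists x.
by rewrite rep_bicommutant => -[].
Qed.

Lemma opnormP x (r : R) :
  opnorm_le x r <-> forall h, rnorm (rep x h) <= r * rnorm h.
Proof. by split=> + h => /(_ h); rewrite !rnormE -rmorphM /= lecR. Qed.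


Lemma rep_is_linear x : linear (rep x).
Proof. by case: (rep_bounded x). Qed.

Lemma repD x h k : rep x (h + k) = rep x h + rep x k.
Proof. by have := rep_is_linear x 1 h k; rewrite !scale1r. Qed.

Lemma rep0r x : rep x 0 = 0.
Proof. by apply: (addIr (rep x 0)); rewrite -repD !add0r. Qed.

Lemma repZr x c h : rep x (c *: h) = c *: rep x h.
Proof. by have := rep_is_linear x c h 0; rewrite rep0r !addr0. Qed.

Lemma rep_lD x y h : rep (x + y) h = rep x h + rep y h.
Proof. by have := rep_linear 1 x y h; rewrite !scale1r. Qed.

Lemma rep_l0 h : rep (0 : A) h = 0.
Proof. by apply: (addIr (rep (0 : A) h)); rewrite -rep_lD !add0r. Qed.

Lemma rep_lZ c x h : rep (c *: x) h = c *: rep x h.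
Proof. by have := rep_linear c x 0 h; rewrite rep_l0 !addr0. Qed.

Lemma rep_lN x h : rep (- x) h = - rep x h.
Proof. by rewrite -scaleN1r rep_lZ scaleN1r. Qed.

Lemma rep_lB x y h : rep (x - y) h = rep x h - rep y h.
Proof. by rewrite rep_lD rep_lN. Qed.

Lemma rep_ext x y : (forall h, rep x h = rep y h) -> x = y.
Proof. by move=> xy; apply: rep_inj; apply/funext. Qed.

Lemma bounded_ex (T : hilb A -> hilb A) : bounded_operator T ->
  exists2 r : R, 0 <= r & forall h, rnorm (T h) <= r * rnorm h.
Proof.
move=> [lin cont].
pose f : {linear hilb A -> hilb A} :=
  HB.pack T (GRing.isLinear.Build _ _ _ _ T lin).
have fc : {for 0, continuous f} by exact: cont.
have /linear_boundedP/pinfty_ex_gt0[M M0 Mr] := continuous_linear_bounded (0 : hilb A) fc.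
have MR : M = (complex.Re M)%:C by rewrite RRe_real // gtr0_real.
rewrite MR ltcR in M0; exists (complex.Re M); first exact: ltW.
move=> h; have := Mr h; rewrite {1}MR !rnormE.
by rewrite -rmorphM /= lecR.
Qed.

Definition opnorm x : R := inf [set r : R | 0 <= r /\ opnorm_le x r].

Lemma opnorm_has_inf x : has_inf [set r : R | 0 <= r /\ opnorm_le x r].
Proof.
split; last by exists 0 => r [].
by have [r r0 rx] := bounded_ex (rep_bounded x); exists r; split=> //; apply/opnormP.
Qed.

Lemma opnorm_ge0 x : 0 <= opnorm x.
Proof.
by have [ne _] := opnorm_has_inf x; apply: lb_le_inf => // r [].
Qed.

Lemma opnorm_ler x (r : R) : 0 <= r ->
  (forall h, rnorm (rep x h) <= r * rnorm h) -> opnorm x <= r.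
Proof.
move=> r0 xr; apply: ge_inf; first by case: (opnorm_has_inf x).
by split=> //; apply/opnormP.
Qed.

Lemma ler_opnorm x h : rnorm (rep x h) <= opnorm x * rnorm h.
Proof.
have [->|h0] := eqVneq h 0; first by rewrite rep0r rnorm0 mulr0.
have hp := rnorm_gt0 h0.
rewrite -ler_pdivrMr //; apply: lb_le_inf; first by case: (opnorm_has_inf x).
by move=> r [_ /opnormP/(_ h)]; rewrite ler_pdivrMr.
Qed.

Lemma opnorm_leP x (r : R) : opnorm x <= r -> opnorm_le x r.
Proof.
move=> xr; apply/opnormP => h; apply: le_trans (ler_opnorm x h) _.
by rewrite ler_wpM2r // rnorm_ge0.
Qed.

Lemma opnorm_le_opnorm x (r : R) : 0 <= r -> opnorm_le x r -> opnorm x <= r.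
Proof. by move=> r0 /opnormP; exact: opnorm_ler. Qed.

Lemma opnormD x y : opnorm (x + y) <= opnorm x + opnorm y.
Proof.
apply: opnorm_ler; first by rewrite addr_ge0 ?opnorm_ge0.
move=> h; rewrite rep_lD mulrDl; apply: le_trans (rnormD _ _) _.
by rewrite lerD ?ler_opnorm.
Qed.

Lemma opnormM x y : opnorm (x * y) <= opnorm x * opnorm y.
Proof.
apply: opnorm_ler; first by rewrite mulr_ge0 ?opnorm_ge0.
move=> h; rewrite repM -mulrA; apply: le_trans (ler_opnorm _ _) _.
by rewrite ler_wpM2l ?opnorm_ge0 ?ler_opnorm.
Qed.

Lemma opnormZ_le c x : opnorm (c *: x) <= complex.Re `|c| * opnorm x.
Proof.
have c0 : 0 <= complex.Re `|c| by rewrite -ler0c RRe_real ?normr_real.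
apply: opnorm_ler; first by rewrite mulr_ge0 ?opnorm_ge0.
by move=> h; rewrite rep_lZ rnormZ -mulrA ler_wpM2l ?ler_opnorm.
Qed.

Lemma opnormZr_le (c : R) x : opnorm (c%:C *: x) <= `|c| * opnorm x.
Proof. by apply: le_trans (opnormZ_le _ _) _; rewrite normc_def /= expr0n addr0 sqrtr_sqr. Qed.

Lemma opnormN x : opnorm (- x) = opnorm x.
Proof.
rewrite /opnorm; congr inf; apply/seteqP; split=> r [r0 /opnormP xr]; split=> //;
  by apply/opnormP => h; have := xr h; rewrite rep_lN rnormN.
Qed.

Lemma opnormB x y : opnorm (x - y) <= opnorm x + opnorm y.
Proof. by apply: le_trans (opnormD _ _) _; rewrite opnormN. Qed.

Lemma opnorm_distC x y : opnorm (x - y) = opnorm (y - x).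
Proof. by rewrite -opnormN opprB. Qed.

Lemma opnorm0 : opnorm 0 = 0.
Proof.
apply/eqP; rewrite eq_le opnorm_ge0 andbT; apply: opnorm_ler => // h.
by rewrite rep_l0 rnorm0 mul0r.
Qed.

Lemma opnorm1_le : opnorm 1 <= 1.
Proof. by apply: opnorm_ler => // h; rewrite rep1 mul1r. Qed.

Lemma opnorm_eq0 x : opnorm x = 0 -> x = 0.
Proof.
move=> x0; apply: rep_ext => h; rewrite rep_l0; apply: rnorm_eq0.
apply/eqP; rewrite eq_le rnorm_ge0 andbT.
by have := ler_opnorm x h; rewrite x0 mul0r.
Qed.

Lemma opnormX x n : opnorm (x ^+ n) <= opnorm x ^+ n.
Proof.
elim: n => [|n IH]; first by rewrite !expr0 opnorm1_le.
rewrite !exprS; apply: le_trans (opnormM _ _) _.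
by rewrite ler_wpM2l ?opnorm_ge0.
Qed.

Lemma opnorm_sum (I : Type) (r : seq I) (P : pred I) (F : I -> A) :
  opnorm (\sum_(i <- r | P i) F i) <= \sum_(i <- r | P i) opnorm (F i).
Proof.
elim/big_rec2: _ => [|i u v _ uv]; first by rewrite opnorm0.
by apply: le_trans (opnormD _ _) _; rewrite lerD2l.
Qed.


Local Notation ip := (@inner R A).

Definition rinner h k : R := complex.Re (ip h k).

Lemma rinner_rnorm h : rinner h h = rnorm h ^+ 2.
Proof. by rewrite /rinner -normE rnormE -rmorphXn. Qed.

Lemma inner_conj h k : ip h k = (ip k h)^*%C.
Proof.
have := hermC ip h k; rewrite expr0 mul1r => ->.
reflexivity.
Qed.

Lemma innerDl h k l : ip (h + k) l = ip h l + ip k l.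
Proof. exact: (linearDl ip). Qed.

Lemma innerDr h k l : ip l (h + k) = ip l h + ip l k.
Proof. exact: (linearDr ip). Qed.

Lemma innerNr h k : ip h (- k) = - ip h k.
Proof. exact: (linearNr ip). Qed.

Lemma innerZl c h k : ip (c *: h) k = c * ip h k.
Proof. exact: (linearZl_LR ip). Qed.

Lemma rinnerC h k : rinner h k = rinner k h.
Proof. by rewrite /rinner inner_conj; case: (ip k h). Qed.

Lemma rinnerDl h k l : rinner (h + k) l = rinner h l + rinner k l.
Proof. by rewrite /rinner innerDl raddfD. Qed.

Lemma rinnerDr h k l : rinner l (h + k) = rinner l h + rinner l k.
Proof. by rewrite rinnerC rinnerDl !(rinnerC l). Qed.

Lemma rinnerZl (c : R) h k : rinner (c%:C *: h) k = c * rinner h k.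
Proof.
by rewrite /rinner innerZl; case: (ip h k) => a b /=; rewrite mul0r subr0.
Qed.

Lemma rinnerZr (c : R) h k : rinner h (c%:C *: k) = c * rinner h k.
Proof. by rewrite rinnerC rinnerZl rinnerC. Qed.

Lemma rinnerNl h k : rinner (- h) k = - rinner h k.
Proof. by rewrite -scaleN1r -(rmorphN1 (real_complex R)) rinnerZl mulN1r. Qed.

Lemma rinnerNr h k : rinner h (- k) = - rinner h k.
Proof. by rewrite rinnerC rinnerNl rinnerC. Qed.

Lemma rinner0l h : rinner 0 h = 0.
Proof. by apply: (addIr (rinner 0 h)); rewrite -rinnerDl !add0r. Qed.

Definition rinnerE := (rinnerDl, rinnerDr, rinnerZl, rinnerZr, rinnerNl, rinnerNr).

Lemma inner_ext h k : (forall l, ip l h = ip l k) -> h = k.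
Proof.
move=> hk; apply/eqP; rewrite -subr_eq0; apply/eqP/rnorm_eq0/eqP.
by rewrite -(sqrf_eq0) -rinner_rnorm /rinner innerDr innerNr hk subrr.
Qed.

(** Cauchy-Schwarz, from the square norm of [rnorm k *: h - rnorm h *: k]. *)
Lemma rinner_le h k : rinner h k <= rnorm h * rnorm k.
Proof.
have [->|h0] := eqVneq h 0.
  by rewrite rinner0l rnorm0 mul0r.
have [->|k0] := eqVneq k 0.
  by rewrite rinnerC rinner0l rnorm0 mulr0.
have := sqr_ge0 (rnorm ((rnorm k)%:C *: h - (rnorm h)%:C *: k)).
rewrite -rinner_rnorm !rinnerE !rinner_rnorm (rinnerC k h).
have := rnorm_gt0 h0; have := rnorm_gt0 k0.
set a := rnorm h; set b := rnorm k; set c := rinner h k => b0 a0 H.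
have : 0 <= 2 * (a * b) * (a * b - c).
  by apply: le_trans H _; rewrite le_eqVlt; apply/orP; left; apply/eqP; ring.
by rewrite pmulr_rge0 ?subr_ge0 // !mulr_gt0.
Qed.

Lemma rinner_star x h k : rinner (rep x h) k = rinner h (rep (star x) k).
Proof. by rewrite /rinner rep_star. Qed.

Lemma star_ext x y : (forall h k, ip (rep x h) k = ip (rep y h) k) -> x = y.
Proof.
move=> xy; apply: rep_ext => h; apply: inner_ext => l.
by rewrite inner_conj xy -inner_conj.
Qed.

Lemma inner_starl x h k : ip (rep (star x) h) k = ip h (rep x k).
Proof. by rewrite inner_conj -rep_star -inner_conj. Qed.

Lemma starK x : star (star x) = x.
Proof. by apply: star_ext => h k; rewrite inner_starl -rep_star. Qed.

Lemma starD x y : star (x + y) = star x + star y.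
Proof.
apply: star_ext => h k.
by rewrite rep_lD innerDl !inner_starl rep_lD innerDr.
Qed.

Lemma starZ c x : star (c *: x) = c^*%C *: star x.
Proof.
apply: star_ext => h k.
rewrite rep_lZ innerZl !inner_starl rep_lZ inner_conj innerZl.
by rewrite rmorphM /= -inner_conj.
Qed.

Lemma starM x y : star (x * y) = star y * star x.
Proof. by apply: star_ext => h k; rewrite !repM !inner_starl !repM. Qed.

Lemma star1 : star (1 : A) = 1.
Proof. by apply: star_ext => h k; rewrite inner_starl !rep1. Qed.

Lemma star0 : star (0 : A) = 0.
Proof. by apply: (addIr (star 0)); rewrite -starD !add0r. Qed.

Lemma starN x : star (- x) = - star x.
Proof. by apply: (addIr (star x)); rewrite -starD !addNr star0. Qed.

Lemma starB x y : star (x - y) = star x - star y.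
Proof. by rewrite starD starN. Qed.

Lemma starZr (c : R) x : star (c%:C *: x) = c%:C *: star x.
Proof. by rewrite starZ conjc_real. Qed.

Lemma opnorm_star_le x : opnorm (star x) <= opnorm x.
Proof.
apply: opnorm_ler; first exact: opnorm_ge0.
move=> h; set k := rep (star x) h.
have [->|k0] := eqVneq k 0; first by rewrite rnorm0 mulr_ge0 ?opnorm_ge0 ?rnorm_ge0.
have kp := rnorm_gt0 k0.
rewrite -(ler_pM2r kp) -expr2 -rinner_rnorm {2}/k -rinner_star.
apply: le_trans (rinner_le _ _) _.
by rewrite mulrAC ler_wpM2r ?rnorm_ge0 ?ler_opnorm.
Qed.

Lemma opnorm_star x : opnorm (star x) = opnorm x.
Proof.
apply/eqP; rewrite eq_le opnorm_star_le /=.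
by rewrite -{1}(starK x) opnorm_star_le.
Qed.

End OperatorNorm.

(** * Norm completeness of the algebra *)

Section Completeness.
Context {R : realType}.

Lemma cvg0_le (e : R^nat) (x C : R) :
  e n @[n --> \oo] --> 0 -> (forall n, x <= e n * C) -> x <= 0.
Proof.
move=> e0 xe.
have eC : e n * C @[n --> \oo] --> 0 * C by apply: cvgMl.
rewrite mul0r in eC; rewrite -(cvg_lim _ eC) //.
by apply: limr_ge; [apply/cvg_ex; exists 0|near=> n; exact: xe].
Unshelve. all: by end_near. Qed.

Lemma hilbert_cauchy {H : completeNormedModType R[i]} (v : nat -> H) (d : R^nat) :
  d n @[n --> \oo] --> 0 ->
  (forall m n, (m <= n)%N -> rnorm (v n - v m) <= d m) ->
  exists l, forall m, rnorm (v m - l) <= d m.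
Proof.
move=> d0 vd.
have : cauchy (v @ \oo).
  apply: cauchy_exP => e e0.
  have eR : e = (complex.Re e)%:C by rewrite RRe_real // gtr0_real.
  have e0' : 0 < complex.Re e by rewrite -ltcR -eR.
  have /cvgrPdist_lt/(_ _ e0') [N _ dN] := d0.
  have := dN N (leqnn N) => /=; rewrite sub0r normrN => dNe.
  exists (v N); exists N => // n /= Nn.
  rewrite -ball_normE /= -opprB normrN rnormE eR ltcR.
  by apply: le_lt_trans (vd _ _ Nn) _; apply: le_lt_trans dNe; exact: ler_norm.
move=> /cauchy_cvgP /cvg_ex [l vl]; exists l => m.
apply/ler_addgt0Pr => e e0.
have ec : 0 < e%:C by rewrite ltcR.
have /cvgrPdist_lt/(_ _ ec) [N _ lN] := vl.
have := lN (maxn N m) (leq_maxl _ _) => /=; rewrite rnormE ltcR => le.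
have := vd m (maxn N m) (leq_maxr _ _) => vm.
have -> : v m - l = - (v (maxn N m) - v m) - (l - v (maxn N m)).
  by rewrite opprB opprB addrA subrK.
by apply: le_trans (rnormD _ _) _; rewrite !rnormN lerD // ltW.
Qed.

Context {A : vonNeumannAlgebra R}.

(* The strong limit commutes with the commutant, hence lies in the algebra. *)
Lemma opnorm_complete (u : nat -> A) (e : R^nat) :
  e n @[n --> \oo] --> 0 ->
  (forall m n, (m <= n)%N -> opnorm (u n - u m) <= e m) ->
  exists x, forall m, opnorm (u m - x) <= e m.
Proof.
move=> e0 ue.
have eK (h : hilb A) : e n * rnorm h @[n --> \oo] --> 0.
  by rewrite -(mul0r (rnorm h)); apply: cvgMl.
have /choice[T TP] : forall h : hilb A, exists l,
    forall m, rnorm (rep (u m) h - l) <= e m * rnorm h.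
  move=> h; apply: hilbert_cauchy (eK h) _ => m n mn.
  rewrite -rep_lB; apply: le_trans (ler_opnorm _ _) _.
  by rewrite ler_wpM2r ?rnorm_ge0 ?ue.
have e_ge0 m : 0 <= e m by apply: le_trans (ue m m (leqnn m)); exact: opnorm_ge0.
have uniq (l l' : hilb A) C : (forall m, rnorm (l - l') <= e m * C) -> l = l'.
  move=> /(cvg0_le e0) ll; apply/eqP; rewrite -subr_eq0; apply/eqP/rnorm_eq0.
  by apply/eqP; rewrite eq_le ll rnorm_ge0.
have Tlin : linear T.
  move=> c h k; apply: (uniq _ _ (rnorm (c *: h + k) + complex.Re `|c| * rnorm h + rnorm k)) => m.
  have -> : T (c *: h + k) - (c *: T h + T k) =
    - (rep (u m) (c *: h + k) - T (c *: h + k)) +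
    (c *: (rep (u m) h - T h) + (rep (u m) k - T k)).
    rewrite repD repZr scalerBr !opprB !opprD !addrA.
    by rewrite [RHS](AC (7) (1*(2*4)*(3*6)*5*7)) /= !addNr !addr0.
  apply: le_trans (rnormD _ _) _; rewrite rnormN !mulrDr -addrA lerD ?TP //.
  apply: le_trans (rnormD _ _) _; rewrite rnormZ lerD ?TP // mulrCA ler_wpM2l ?TP //.
  by rewrite -ler0c RRe_real ?normr_real.
have Tbd h : rnorm (T h) <= (opnorm (u 0%N) + e 0%N) * rnorm h.
  have -> : T h = rep (u 0%N) h - (rep (u 0%N) h - T h) by rewrite subKr.
  apply: le_trans (rnormD _ _) _; rewrite rnormN mulrDl lerD ?TP //.
  exact: ler_opnorm.
have Tcont : continuous T.
  pose f : {linear hilb A -> hilb A} :=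
    HB.pack T (GRing.isLinear.Build _ _ _ _ T Tlin).
  apply: (bounded_linear_continuous (f := f)); apply/linear_boundedP.
  near=> r => h.
  have rr : r = (complex.Re r)%:C.
    by rewrite RRe_real //; near: r; exact: nbhs_pinfty_real.
  rewrite /f /= rr !rnormE -rmorphM lecR; apply: le_trans (Tbd h) _.
  rewrite ler_wpM2r ?rnorm_ge0 // -lecR -rr; near: r.
  by apply: nbhs_pinfty_ge; rewrite complex_real.
have : commutant (commutant (range (@rep R A))) T.
  split=> // s [[slin scont] sc]; apply/funext => h /=.
  have [r r0 sr] := bounded_ex (conj slin scont).
  apply: (uniq _ _ (rnorm (s h) + r * rnorm h)) => m.
  have su : rep (u m) (s h) = s (rep (u m) h).
    have := sc (rep (u m)); move=> /(_ (imageP _ I)) /(congr1 (fun f => f h)) /= ->.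
    by [].
  have sB h1 h2 : s (h1 - h2) = s h1 - s h2.
    by have := slin (-1) h2 h1; rewrite !scaleN1r ![- _ + _]addrC.
  have -> : T (s h) - s (T h) =
      - (rep (u m) (s h) - T (s h)) + s (rep (u m) h - T h).
    by rewrite sB -su opprB addrA subrK.
  apply: le_trans (rnormD _ _) _; rewrite rnormN mulrDr lerD ?TP //.
  by apply: le_trans (sr _) _; rewrite mulrCA ler_wpM2l ?TP.
rewrite -rep_bicommutant => -[x _ xT]; exists x => m.
by apply: opnorm_ler (e_ge0 m) _ => h; rewrite rep_lB xT TP.
Unshelve. all: by end_near. Qed.

End Completeness.

(** * Neumann series, square roots and resolvents *)

Section RealGeometric.
Context {R : realType}.

Lemma geometric_sum_le (rho : R) m n : 0 <= rho -> rho < 1 ->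
  \sum_(m <= k < n) rho ^+ k <= rho ^+ m / (1 - rho).
Proof.
move=> r0 r1; have r1' : 0 < 1 - rho by rewrite subr_gt0.
have [nm|mn] := leqP n m.
  by rewrite big_geq // divr_ge0 ?exprn_ge0 // ltW.
have -> : \sum_(m <= k < n) rho ^+ k = (rho ^+ m - rho ^+ n) / (1 - rho).
  elim: n mn => // n IH; rewrite ltnS leq_eqVlt => /predU1P[->|mn].
    by rewrite big_nat1 exprS; field; rewrite gt_eqF.
  by rewrite big_nat_recr ?IH //= 1?ltnW // exprS; field; rewrite gt_eqF.
by rewrite ler_wpM2r ?invr_ge0 ?(ltW r1') // gerBl exprn_ge0.
Qed.

Lemma cvg_geometric0 (rho C : R) : 0 <= rho -> rho < 1 ->
  rho ^+ n * C @[n --> \oo] --> 0.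
Proof.
move=> r0 r1; rewrite -(mul0r C); apply: cvgMl.
by apply: cvg_expr; rewrite ger0_norm.
Qed.

End RealGeometric.

Section Resolvent.
Context {R : realType} {A : vonNeumannAlgebra R}.
Implicit Types x y z a : A.

Lemma opnorm_cvg_geometric (u : nat -> A) (rho : R) : 0 <= rho -> rho < 1 ->
  (forall n, opnorm (u n.+1 - u n) <= rho ^+ n) ->
  exists x, forall m, opnorm (u m - x) <= rho ^+ m / (1 - rho).
Proof.
move=> r0 r1 ur; apply: opnorm_complete.
  exact: cvg_geometric0.
move=> m n mn; apply: le_trans (geometric_sum_le m n r0 r1).
rewrite -telescope_sumr //; apply: le_trans (opnorm_sum _ _ _) _.
by apply: ler_sum => i _; exact: ur.
Qed.

(** Reduces identities between norm limits to geometric error estimates on their approximants. *)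
Lemma opnorm_small_eq (x y : A) (rho C : R) : 0 <= rho -> rho < 1 ->
  (forall n, opnorm (x - y) <= rho ^+ n * C) -> x = y.
Proof.
move=> r0 r1 xy; apply/eqP; rewrite -subr_eq0; apply/eqP/opnorm_eq0/eqP.
rewrite eq_le opnorm_ge0 andbT.
apply: (@cvg0_le _ (fun n => rho ^+ n) _ C) => //.
by have := cvg_geometric0 1 r0 r1; under eq_fun do rewrite mulr1.
Qed.

Lemma neumann z (rho : R) : 0 <= rho -> rho < 1 -> opnorm z <= rho ->
  exists g, [/\ (1 - z) * g = 1, g * (1 - z) = 1 &
    forall n, opnorm (\sum_(k < n) z ^+ k - g) <= rho ^+ n / (1 - rho)].
Proof.
move=> r0 r1 zr.
have zX n : opnorm (z ^+ n) <= rho ^+ n.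
  by apply: le_trans (opnormX _ _) _; rewrite lerXn2r ?nnegrE ?opnorm_ge0.
have [|g gP] := @opnorm_cvg_geometric (fun n => \sum_(k < n) z ^+ k) rho r0 r1.
  by move=> n; rewrite big_ord_recr /= addrAC subrr add0r.
have geo n : (\sum_(k < n) z ^+ k) * (1 - z) = 1 - z ^+ n.
  elim: n => [|n IH]; first by rewrite big_ord0 mul0r expr0 subrr.
  by rewrite big_ord_recr mulrDl IH mulrBr mulr1 exprSr addrA subrK.
have geo' n : (1 - z) * (\sum_(k < n) z ^+ k) = 1 - z ^+ n.
  elim: n => [|n IH]; first by rewrite big_ord0 mulr0 expr0 subrr.
  by rewrite big_ord_recr mulrDr IH mulrBl mul1r exprS addrA subrK.
exists g; split=> //; apply: (@opnorm_small_eq _ _ rho (opnorm (1 - z) / (1 - rho) + 1)) => // n.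
- set s := \sum_(k < n) z ^+ k in gP *.
  have -> : (1 - z) * g - 1 = (1 - z) * s - 1 - (1 - z) * (s - g) by ncring.
  have -> : (1 - z) * s - 1 = - z ^+ n by rewrite geo'; ncring.
  rewrite [_ ^+ n * _]mulrDr mulr1 [X in _ <= X]addrC.
  apply: le_trans (opnormD _ _) _; rewrite !opnormN lerD //.
  by apply: le_trans (opnormM _ _) _; rewrite mulrCA ler_wpM2l ?opnorm_ge0 ?gP.
- set s := \sum_(k < n) z ^+ k in gP *.
  have -> : g * (1 - z) - 1 = s * (1 - z) - 1 - (s - g) * (1 - z) by ncring.
  have -> : s * (1 - z) - 1 = - z ^+ n by rewrite geo; ncring.
  rewrite [_ ^+ n * _]mulrDr mulr1 [X in _ <= X]addrC.
  apply: le_trans (opnormD _ _) _; rewrite !opnormN lerD //.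
  by apply: le_trans (opnormM _ _) _; rewrite mulrC mulrCA ler_wpM2l ?opnorm_ge0 ?gP.
Qed.

(* The contraction [z |-> (a + z^2)/2] has a fixed point [z], and then
   [(1 - z)^2 = 1 - a]. *)
Lemma sqrt_one_sub a (rho : R) : rho < 1 -> opnorm a <= rho -> star a = a ->
  exists z, 1 - a = star z * z.
Proof.
move=> r1 ar sa; have r0 : 0 <= rho by apply: le_trans ar; exact: opnorm_ge0.
pose h : R := 2^-1.
have h0 : 0 <= h by rewrite invr_ge0.
pose u := fix u n : A := if n is n'.+1 then h%:C *: (a + u n' * u n') else 0.
have uS n : u n.+1 = h%:C *: (a + u n * u n) by [].
have us n : star (u n) = u n.
  by elim: n => [|n IH]; rewrite ?star0 // uS starZr starD starM IH sa.
have ub n : opnorm (u n) <= rho.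
  elim: n => [|n IH]; first by rewrite opnorm0.
  rewrite uS; apply: le_trans (opnormZr_le _ _) _; rewrite ger0_norm //.
  have : opnorm (a + u n * u n) <= rho + rho * rho.
    apply: le_trans (opnormD _ _) _; rewrite lerD //.
    by apply: le_trans (opnormM _ _) _; rewrite ler_pM ?opnorm_ge0.
  have : rho * rho <= rho * 1 by rewrite ler_wpM2l // ltW.
  rewrite /h; lra.
have uC n : opnorm (u n.+1 - u n) <= rho ^+ n.
  elim: n => [|n IH].
    have -> : u 1%N = h%:C *: a by rewrite uS /= mul0r addr0.
    rewrite subr0 expr0; apply: le_trans (opnormZr_le _ _) _.
    rewrite ger0_norm //; have := opnorm_ge0 a; rewrite /h; lra.
  rewrite uS [u n.+1 in X in _ - X]uS -scalerBr.
  (* This difference of squares has norm at most [2 rho] times that of [u n.+1 - u n]; the factor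
     [h = 1/2] leaves the ratio [rho]. *)
  have -> : a + u n.+1 * u n.+1 - (a + u n * u n) =
      u n.+1 * (u n.+1 - u n) + (u n.+1 - u n) * u n by ncring.
  apply: le_trans (opnormZr_le _ _) _; rewrite ger0_norm //.
  have B (x y : A) : opnorm x <= rho -> opnorm (y * x) <= rho * opnorm y /\
      opnorm (x * y) <= rho * opnorm y.
    move=> xr; split; apply: le_trans (opnormM _ _) _; rewrite 1?[opnorm y * _]mulrC.
      by rewrite ler_wpM2r ?opnorm_ge0.
    by rewrite ler_wpM2r ?opnorm_ge0.
  have [_ B1] := B _ (u n.+1 - u n) (ub n.+1).
  have [B2 _] := B _ (u n.+1 - u n) (ub n).
  have := ler_wpM2l r0 IH; rewrite -exprS => B3.
  have := opnormD (u n.+1 * (u n.+1 - u n)) ((u n.+1 - u n) * u n).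
  by rewrite /h; lra.
have [z zP] := opnorm_cvg_geometric r0 r1 uC.
have sz : star z = z.
  apply: (opnorm_small_eq (C := 2 / (1 - rho)) r0 r1) => n.
  have -> : star z - z = (u n - z) - star (u n - z).
    by rewrite starB us; ncring.
  apply: le_trans (opnormB _ _) _; rewrite opnorm_star.
  by have := zP n; rewrite mulrCA; set t := _ / _; lra.
exists (1 - z); rewrite starB star1 sz.
suff : z + z = a + z * z.
  move=> zz; have -> : (1 - z) * (1 - z) = 1 - (z + z) + z * z by ncring.
  by rewrite zz; ncring.
apply: (opnorm_small_eq (C := (2 * rho + 2 + opnorm z + rho) / (1 - rho)) r0 r1) => n.
have u2 : u n.+1 + u n.+1 = a + u n * u n.
  rewrite uS -scalerDl -rmorphD /h /=.
  by have -> : 2^-1 + 2^-1 = 1 :> R; [lra | rewrite scale1r].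
have -> : z + z - (a + z * z) = (u n.+1 + u n.+1) - (a + z * z) - (u n.+1 - z)
   - (u n.+1 - z) by ncring.
have -> : u n.+1 + u n.+1 - (a + z * z) = u n * (u n - z) + (u n - z) * z.
  by rewrite u2; ncring.
have e0 : 0 <= rho ^+ n / (1 - rho) by rewrite divr_ge0 ?exprn_ge0 // subr_ge0 ltW.
have e1 : rho ^+ n.+1 / (1 - rho) <= rho ^+ n / (1 - rho).
  by rewrite ler_wpM2r ?invr_ge0 ?subr_ge0 ?(ltW r1) // exprS ler_piMl ?exprn_ge0 // ltW.
have b1 : opnorm (u n * (u n - z)) <= rho * (rho ^+ n / (1 - rho)).
  by apply: le_trans (opnormM _ _) _; rewrite ler_pM ?opnorm_ge0.
have b2 : opnorm ((u n - z) * z) <= rho ^+ n / (1 - rho) * opnorm z.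
  by apply: le_trans (opnormM _ _) _; rewrite ler_wpM2r ?opnorm_ge0.
have b3 := zP n.+1.
have b4 := opnormB (u n * (u n - z) + (u n - z) * z - (u n.+1 - z)) (u n.+1 - z).
have b5 := opnormB (u n * (u n - z) + (u n - z) * z) (u n.+1 - z).
have b6 := opnormD (u n * (u n - z)) ((u n - z) * z).
rewrite mulrCA; move: e0 e1 b1 b2 b3 b4 b5 b6; set e := rho ^+ n / (1 - rho).
move=> e0 e1 b1 b2 b3 b4 b5 b6.
have re : 0 <= rho * e by rewrite mulr_ge0.
have ze : 0 <= opnorm z * e by rewrite mulr_ge0 ?opnorm_ge0.
by nra.
Qed.

End Resolvent.

(** * Resolvents of shifted squares *)

Section ShiftedSquare.
Context {R : realType} {A : vonNeumannAlgebra R}.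
Implicit Types x y z g : A.

Lemma alg_mull (c : R[i]) x : c%:A * x = c *: x.
Proof. by rewrite -scalerAl mul1r. Qed.

Lemma alg_mulr (c : R[i]) x : x * c%:A = c *: x.
Proof. by rewrite -scalerAr mulr1. Qed.

Lemma rep_alg (c : R[i]) (h : hilb A) : rep (c%:A : A) h = c *: h.
Proof. by rewrite rep_lZ rep1. Qed.

Definition shifted_sq y (e : R) : A := star y * y + (e%:C)%:A.

Lemma shifted_sqE y e : shifted_sq y e = star y * y + e%:C *: 1.
Proof. by []. Qed.

Lemma star_shifted_sq y e : star (shifted_sq y e) = shifted_sq y e.
Proof. by rewrite /shifted_sq starD starM starK starZr star1. Qed.

Lemma rinner_shifted_sq y e (h : hilb A) :
  rinner (rep (shifted_sq y e) h) h = rnorm (rep y h) ^+ 2 + e * rnorm h ^+ 2.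
Proof.
rewrite rep_lD rep_alg repM !rinnerE rinner_star starK !rinner_rnorm.
by [].
Qed.

Definition contraction x (c : R) : A := 1 - (c^-1)%:C *: x.

Lemma contractionK x (c : R) : c != 0 -> c%:C *: (1 - contraction x c) = x.
Proof.
move=> c0; rewrite /contraction opprB addrC subrK scalerA -rmorphM /=.
by rewrite divff // scale1r.
Qed.

(** With [X = shifted_sq y e], one has [|X h|^2 <= c <X h, h>], hence [|h - X h / c|^2 <= |h|^2 - <X
    h, h> / c <= (1 - e / c) |h|^2]. The square root is the price of an estimate that uses no
    spectral theory. *)
Lemma opnorm_contraction y (e c : R) : 0 < e -> opnorm y ^+ 2 + e <= c ->
  opnorm (contraction (shifted_sq y e) c) <= Num.sqrt (1 - e / c).
Proof.
move=> e0 yc; have N0 := opnorm_ge0 y; set N := opnorm y in yc N0.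
have c0 : 0 < c by apply: lt_le_trans yc; rewrite ltr_wpDl ?sqr_ge0.
have ec : 0 <= 1 - e / c.
  by rewrite subr_ge0 ler_pdivrMr // mul1r; apply: le_trans yc; rewrite lerDr sqr_ge0.
apply: opnorm_ler (sqrtr_ge0 _) _ => h.
rewrite -ler_sqr ?nnegrE ?mulr_ge0 ?rnorm_ge0 ?sqrtr_ge0 // exprMn sqr_sqrtr //.
rewrite -rinner_rnorm rep_lB rep1 rep_lZ !rinnerE !rinner_rnorm.
rewrite (rinnerC h) rinner_shifted_sq.
set Y := rnorm (rep y h); set n := rnorm h.
have YN : Y ^+ 2 <= N ^+ 2 * n ^+ 2.
  by rewrite -exprMn ler_sqr ?nnegrE ?mulr_ge0 ?rnorm_ge0 ?opnorm_ge0 ?ler_opnorm.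
have XX : rnorm (rep (shifted_sq y e) h) ^+ 2 <= c * (Y ^+ 2 + e * n ^+ 2).
  rewrite -rinner_rnorm rep_lD rep_alg !rinnerE (rinnerC h) !rinner_rnorm repM.
  rewrite rinner_star starK rinner_rnorm -/Y -/n.
  have : rnorm (rep (star y) (rep y h)) ^+ 2 <= N ^+ 2 * Y ^+ 2.
    rewrite -exprMn ler_sqr ?nnegrE ?mulr_ge0 ?rnorm_ge0 ?opnorm_ge0 //.
    by rewrite /N -opnorm_star ler_opnorm.
  have : e * Y ^+ 2 <= e * (N ^+ 2 * n ^+ 2) by rewrite ler_wpM2l // ltW.
  have : (N ^+ 2 + e) * (Y ^+ 2 + e * n ^+ 2) <= c * (Y ^+ 2 + e * n ^+ 2).
    by rewrite ler_wpM2r // addr_ge0 ?sqr_ge0 // mulr_ge0 ?sqr_ge0 // ltW.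
  nra.
have ci : 0 < c^-1 by rewrite invr_gt0.
have cic : c^-1 * c = 1 by rewrite mulVf // gt_eqF.
have : c^-1 * (c^-1 * rnorm (rep (shifted_sq y e) h) ^+ 2) <= c^-1 * (Y ^+ 2 + e * n ^+ 2).
  rewrite ler_wpM2l ?(ltW ci) //; apply: le_trans (_ : c^-1 * (c * (Y ^+ 2 + e * n ^+ 2)) <= _).
    by rewrite ler_wpM2l // ltW.
  by rewrite mulrA cic mul1r.
have : 0 <= c^-1 * Y ^+ 2 by rewrite mulr_ge0 ?sqr_ge0 // ltW.
rewrite mulrDr; set u := c^-1 * Y ^+ 2; set X2 := rnorm (rep (shifted_sq y e) h) ^+ 2.
have -> : c^-1 * (e * n ^+ 2) = e / c * n ^+ 2 by ring.
rewrite /=; nra.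
Qed.

Definition resolvent y (e : R) : A :=
  xget 0 [set g | shifted_sq y e * g = 1 /\ g * shifted_sq y e = 1].

Lemma sqrt_contraction_lt1 (e c : R) : 0 < e -> 0 < c -> Num.sqrt (1 - e / c) < 1.
Proof.
move=> e0 c0; rewrite -[ltRHS]sqrtr1 ltr_sqrt ?ltr01 //.
by rewrite gtrBl divr_gt0.
Qed.

Lemma shifted_sq_inv y (e c : R) : 0 < e -> opnorm y ^+ 2 + e <= c ->
  exists g, [/\ shifted_sq y e * g = 1, g * shifted_sq y e = 1 &
   forall n, opnorm ((c^-1)%:C *: \sum_(k < n) contraction (shifted_sq y e) c ^+ k - g)
     <= Num.sqrt (1 - e / c) ^+ n * (c^-1 / (1 - Num.sqrt (1 - e / c)))].
Proof.
move=> e0 yc.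
have c0 : 0 < c by apply: lt_le_trans yc; rewrite ltr_wpDl ?sqr_ge0.
have c0' : c != 0 by rewrite gt_eqF.
have [g [g1 g2 g3]] := neumann (sqrtr_ge0 _) (sqrt_contraction_lt1 e0 c0)
  (opnorm_contraction e0 yc).
have cc : (c%:C * (c^-1)%:C = 1 :> R[i]) by rewrite -rmorphM /= divff.
exists ((c^-1)%:C *: g); split.
- rewrite -{1}(contractionK (shifted_sq y e) c0') -scalerAl -scalerAr g1.
  by rewrite scalerA cc scale1r.
- rewrite -{1}(contractionK (shifted_sq y e) c0') -scalerAl -scalerAr g2.
  by rewrite scalerA mulrC cc scale1r.
- move=> n; rewrite -scalerBr; apply: le_trans (opnormZr_le _ _) _.
  by rewrite ger0_norm ?invr_ge0 ?(ltW c0) // mulrCA ler_wpM2l ?invr_ge0 ?(ltW c0).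
Qed.

Lemma inv_unique x g g' : g * x = 1 -> x * g' = 1 -> g = g'.
Proof. by move=> gx xg'; rewrite -[g]mulr1 -xg' mulrA gx mul1r. Qed.

Section PositiveShift.
Variables (y : A) (e : R).
Hypothesis e0 : 0 < e.

Lemma resolventP : shifted_sq y e * resolvent y e = 1 /\ resolvent y e * shifted_sq y e = 1.
Proof.
have [g [g1 g2 _]] := shifted_sq_inv e0 (lexx (opnorm y ^+ 2 + e)).
by rewrite /resolvent; case: xgetP => [_ -> //|/(_ g)[]].
Qed.

Lemma mul_shifted_resolvent : shifted_sq y e * resolvent y e = 1.
Proof. by case: resolventP. Qed.

Lemma mul_resolvent_shifted : resolvent y e * shifted_sq y e = 1.
Proof. by case: resolventP. Qed.

Lemma star_resolvent : star (resolvent y e) = resolvent y e.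
Proof.
apply: (@inv_unique (shifted_sq y e)); last exact: mul_shifted_resolvent.
by rewrite -[X in _ * X]star_shifted_sq -starM mul_shifted_resolvent star1.
Qed.

(** Coercivity: [<X k, k> >= e |k|^2] for [X = shifted_sq y e]. *)
Lemma opnorm_resolvent : opnorm (resolvent y e) <= e^-1.
Proof.
apply: opnorm_ler; first by rewrite invr_ge0 ltW.
move=> h; set k := rep (resolvent y e) h.
have hk : h = rep (shifted_sq y e) k by rewrite /k -repM mul_shifted_resolvent rep1.
have [->|k0] := eqVneq k 0; first by rewrite rnorm0 mulr_ge0 ?rnorm_ge0 // invr_ge0 ltW.
rewrite mulrC ler_pdivlMr // -(ler_pM2r (rnorm_gt0 k0)).
apply: le_trans (rinner_le h k); rewrite hk rinner_shifted_sq.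
by rewrite mulrAC -expr2 mulrC lerDr sqr_ge0.
Qed.

Lemma resolvent_partial_sums (c : R) n : opnorm y ^+ 2 + e <= c ->
  opnorm ((c^-1)%:C *: \sum_(k < n) contraction (shifted_sq y e) c ^+ k - resolvent y e)
     <= Num.sqrt (1 - e / c) ^+ n * (c^-1 / (1 - Num.sqrt (1 - e / c))).
Proof.
move=> yc; have [g [g1 g2]] := shifted_sq_inv e0 yc.
by rewrite (inv_unique g2 mul_shifted_resolvent); exact.
Qed.

End PositiveShift.

End ShiftedSquare.

(** * Positivity of the trace and its bound by the operator norm *)

Section Trace.
Context {R : realType} {A : tracialVNA R}.
Implicit Types x y z : A.

Local Notation Re := (@complex.Re R).
Local Notation Im := (@complex.Im R).

Lemma tauD x y : tau (x + y) = tau x + tau y. Proof. exact: raddfD. Qed.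
Lemma tauB x y : tau (x - y) = tau x - tau y. Proof. exact: raddfB. Qed.
Lemma tauN x : tau (- x) = - tau x. Proof. exact: raddfN. Qed.
Lemma tau0 : tau (0 : A) = 0. Proof. exact: raddf0. Qed.
Lemma tauZ c x : tau (c *: x) = c * tau x. Proof. exact: linearZ. Qed.

(** By positivity the trace of [star (1 + c x) * (1 + c x)] is real for every [c]; [c = 1] compares
    the imaginary parts and [c = i] the real parts. *)
Lemma tau_star x : tau (star x) = (tau x)^*%C.
Proof.
have H (c : R[i]) : Im (c * tau x + c^*%C * tau (star x)) = 0.
  have := ger0_Im (tau_ge0 (1 + c *: x)).
  rewrite starD star1 starZ mulrDl !mulrDr !mul1r mulr1.
  rewrite -scalerAl -scalerAr !tauD !tauZ tau1.
  have : Im (c^*%C * (c * tau (star x * x))) = 0.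
    rewrite mulrA; apply: ger0_Im; rewrite mulr_ge0 ?tau_ge0 //.
    by rewrite mulrC mulcJ_ge0.
  case: (c * tau x) => a b; case: (c^*%C * tau (star x)) => a' b'.
  by case: (_ * _) => a'' b'' /=; lra.
have := H 1; have := H 'i%C.
case: (tau x) => a b; case: (tau (star x)) => a' b' /= h1 h2.
apply/eqP; rewrite eq_complex /=; apply/andP; split; apply/eqP.
  by move: h1; rewrite /=; lra.
by move: h2; rewrite /=; lra.
Qed.

Lemma normc_ge0 (z : R[i]) : 0 <= Normc.normc z.
Proof. by case: z => a b; exact: sqrtr_ge0. Qed.

Lemma tau_real x : star x = x -> tau x = (Re (tau x))%:C.
Proof.
move=> sx; have := tau_star x; rewrite sx.
case: (tau x) => a b /eqP; rewrite eq_complex /= => /andP[_ /eqP bb].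
by congr Complex; lra.
Qed.

(** For [r] above the norm of [x], [1 - x / r] has the form [star z * z] by [sqrt_one_sub], so its
    trace is nonnegative; then [r] decreases to the norm. *)
Lemma Re_tau_sa_le x : star x = x -> Re (tau x) <= opnorm x.
Proof.
move=> sx; apply/ler_addgt0Pr => e e0.
set r := opnorm x + e; have r0 : 0 < r by rewrite ltr_wpDl ?opnorm_ge0.
have xr : opnorm ((r^-1)%:C *: x) <= opnorm x / r.
  by apply: le_trans (opnormZr_le _ _) _; rewrite ger0_norm ?invr_ge0 ?(ltW r0) // mulrC.
have r1 : opnorm x / r < 1 by rewrite ltr_pdivrMr // mul1r ltrDl.
have [|z zP] := sqrt_one_sub r1 xr; first by rewrite starZr sx.
have := tau_ge0 z; rewrite -zP tauB tau1 tauZ tau_real // lecE => /andP[_] /=.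
by rewrite mul0r subr0 subr_ge0 mulrC ler_pdivrMr // mul1r.
Qed.

Lemma Re_tau_le x : `|Re (tau x)| <= opnorm x.
Proof.
have H y : Re (tau y) <= opnorm y.
  have sy : star (y + star y) = y + star y by rewrite starD starK addrC.
  have := Re_tau_sa_le sy; have := opnormD y (star y); rewrite opnorm_star tauD tau_star.
  by case: (tau y) => a b /=; lra.
by rewrite ler_norml H lerNl andbT -raddfN -tauN -[X in _ <= X]opnormN H.
Qed.

(** The real and imaginary parts are bounded separately. The constant 2 is not sharp, which is
    harmless in convergence estimates. *)
Lemma normc_tau_le x : Normc.normc (tau x) <= 2 * opnorm x.
Proof.
have : `|Im (tau x)| <= opnorm x.
  have := Re_tau_le ('i%C *: x); rewrite tauZ.
  have : opnorm ('i%C *: x) <= opnorm x.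
    apply: le_trans (opnormZ_le _ _) _.
    by rewrite normc_def /= expr0n expr1n add0r sqrtr1 mul1r.
  by case: (tau x) => a b /=; rewrite mul0r mul1r sub0r normrN => h1 h2; apply: le_trans h2 h1.
have := Re_tau_le x; case: (tau x) => a b /= h1 h2.
have o0 := opnorm_ge0 x.
have : a ^+ 2 <= opnorm x ^+ 2 by rewrite -real_normK ?num_real // ler_sqr ?nnegrE.
have : b ^+ 2 <= opnorm x ^+ 2 by rewrite -real_normK ?num_real // ler_sqr ?nnegrE.
move=> hb ha; rewrite -[leRHS]ger0_norm ?mulr_ge0 // -sqrtr_sqr ler_sqrt ?sqr_ge0 //.
nra.
Qed.

End Trace.

(** * Spectra and the functional calculus of the logarithm *)

Section LogTaylor.
Context {R : realType}.
Implicit Types w rho : R.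

Lemma is_derive_dist_le (f df : R -> R) (a b M : R) :
  (forall x, `|x - a| <= `|b - a| -> is_derive x 1 f (df x)) ->
  (forall x, `|x - a| <= `|b - a| -> `|df x| <= M) ->
  `|f b - f a| <= M * `|b - a|.
Proof.
have H (u v : R) : u <= v -> (forall x, u <= x <= v -> is_derive x 1 f (df x)) ->
    (forall x, u <= x <= v -> `|df x| <= M) -> `|f v - f u| <= M * `|v - u|.
  move=> uv fd fM.
  have fd' x : x \in `]u, v[%R -> is_derive x 1 f (df x).
    by rewrite in_itv /= => /andP[ux xv]; apply: fd; rewrite !ltW.
  have [|c cuv ->] := MVT_segment uv fd'.
    apply: derivable_within_continuous => x; rewrite in_itv /= => xuv.
    by have := fd x xuv => -[].
  by rewrite normrM ler_wpM2r // fM //; move: cuv; rewrite in_itv.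
move=> fd fM; have [ab|/ltW ba] := leP a b.
  apply: H => // x /andP[ax xb]; [apply: fd|apply: fM];
  by rewrite !ger0_norm ?subr_ge0 // lerD2r.
rewrite distrC [`|b - a|]distrC; apply: H => // x /andP[bx xa]; [apply: fd|apply: fM];
by rewrite !ler0_norm ?subr_le0 // lerN2 lerD2r.
Qed.

(** Truncation of the series of [- ln (1 - X)]; the term of index 0 vanishes because [0^-1 = 0]. *)
Definition log_poly n : {poly R} := \sum_(k < n) k%:R^-1 *: 'X^k.

Lemma deriv_log_poly n : (log_poly n.+1)^`() = \sum_(k < n) 'X^k.
Proof.
rewrite /log_poly linear_sum /= big_ord_recl /= expr0 derivZ derivC scaler0 add0r.
apply: eq_bigr => k _; rewrite derivZ derivXn -['X^_ *+ _]scaler_nat scalerA.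
by rewrite mulVf ?scale1r // pnatr_eq0.
Qed.

(** The remainder vanishes at 0 and has derivative [- x^n / (1 - x)], bounded by [rho^n / (1 - rho)]
    on the segment from 0 to [w], whose length is at most [rho]. *)
Lemma ln_log_poly_le n w rho : rho < 1 -> `|w| <= rho ->
  `|ln (1 - w) + (log_poly n.+1).[w]| <= rho ^+ n.+1 / (1 - rho).
Proof.
move=> r1 wr; have r0 : 0 <= rho by apply: le_trans wr.
have r1' : 0 < 1 - rho by rewrite subr_gt0.
pose D x : R := ln (1 - x) + (log_poly n.+1).[x].
pose D' (x : R) : R := - x ^+ n / (1 - x).
have x1 (x : R) : `|x| <= rho -> 1 - rho <= 1 - x.
  by move=> xr; rewrite lerD2l lerN2; apply: le_trans xr; exact: ler_norm.
have dD (x : R) : `|x| <= rho -> is_derive x 1 D (D' x).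
  move=> /x1/(lt_le_trans r1') x0.
  have d2 : is_derive x 1 (fun x : R => 1 - x) (0 - 1) by exact: is_deriveB.
  have d1 : is_derive x 1 (fun x : R => ln (1 - x)) ((1 - x)^-1 * (0 - 1)).
    by apply: (@is_derive1_comp _ (@ln R)) d2; exact: is_derive1_ln.
  apply: (is_derive_eq (is_deriveD d1 (is_derive_poly (log_poly n.+1) x))).
  rewrite deriv_log_poly horner_sum /D' sub0r mulrN1.
  under eq_bigr do rewrite hornerXn.
  have -> : \sum_(i < n) x ^+ i = (1 - x ^+ n) / (1 - x).
    elim: n {D D'} => [|n IH]; first by rewrite big_ord0 expr0 subrr mul0r.
    by rewrite big_ord_recr /= IH exprSr; field; rewrite gt_eqF.
  by field; rewrite gt_eqF.
have := @is_derive_dist_le D D' 0 w (rho ^+ n / (1 - rho)).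
rewrite !subr0.
have -> : D 0 = 0.
  rewrite /D subr0 ln1 add0r /log_poly horner_sum big1 // => k _.
  by rewrite hornerZ hornerXn; case: (k : nat) => [|m]; rewrite ?invr0 ?mul0r // expr0n mulr0.
rewrite subr0 => H; apply: le_trans (H _ _) _.
- by move=> x; rewrite subr0 => xw; apply: dD; apply: le_trans xw wr.
- move=> x; rewrite subr0 => /le_trans/(_ wr) xr; have x2 := x1 _ xr.
  rewrite /D' normrM normrN normrX; apply: ler_pM => //.
    by rewrite lerXn2r ?nnegrE.
  have x0 := lt_le_trans r1' x2.
  by rewrite gtr0_norm ?invr_gt0 // lef_pV2.
- rewrite exprSr mulrAC ler_wpM2r ?invr_ge0 ?(ltW r1') //.
  by rewrite ler_wpM2l // exprn_ge0.
Qed.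

End LogTaylor.

Section Spectrum.
Context {R : realType} {A : vonNeumannAlgebra R}.
Implicit Types x y z g : A.

Definition invertible x : Prop := exists g, x * g = 1 /\ g * x = 1.

Lemma invertible_lr x g g' : g * x = 1 -> x * g' = 1 -> invertible x.
Proof.
by move=> gx xg'; exists g'; split=> //; rewrite -(inv_unique gx xg').
Qed.

Lemma invertibleM x y : invertible x -> invertible y -> invertible (x * y).
Proof.
move=> [g [xg gx]] [g' [yg g'y]]; exists (g' * g); split.
  by rewrite mulrA -[x * y * g']mulrA yg mulr1.
by rewrite mulrA -[g' * g * x]mulrA gx mulr1.
Qed.

Lemma invertibleZ c x : c != 0 -> invertible x -> invertible (c *: x).
Proof.
move=> c0 [g [xg gx]]; exists (c^-1 *: g).
by rewrite -!scalerAl -!scalerAr !scalerA xg gx mulfV ?mulVf // scale1r.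
Qed.

(** Otherwise, with [w = 1 - r / c] and [z = contraction x c], the Neumann series inverts
    [1 - z / w], hence also [x - r = c w (1 - z / w)]. *)
Lemma spectrum_contraction x (c rho r : R) : 0 < c -> rho < 1 ->
  opnorm (contraction x c) <= rho -> spectrum x r%:C -> `|1 - r / c| <= rho.
Proof.
move=> c0 r1 xr; rewrite leNgt => sp; apply/negP => lt; apply: sp.
change (invertible (x - (r%:C)%:A)).
have r0 : 0 <= rho by apply: le_trans xr; exact: opnorm_ge0.
set w := 1 - r / c in lt.
have w0 : w != 0 by rewrite -normr_gt0; apply: le_lt_trans lt.
have cN : c != 0 by rewrite gt_eqF.
have zb : opnorm ((w^-1)%:C *: contraction x c) <= rho / `|w|.
  apply: le_trans (opnormZr_le _ _) _.
  by rewrite normfV mulrC ler_wpM2r ?invr_ge0.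
have [] := neumann _ _ zb.
- by rewrite divr_ge0.
- by rewrite ltr_pdivrMr ?normr_gt0 // mul1r.
move=> g [g1 g2 _].
have -> : x - (r%:C)%:A = (c * w)%:C *: (1 - (w^-1)%:C *: contraction x c).
  rewrite scalerBr scalerA -rmorphM /= mulfK // -{1}(contractionK x cN).
  rewrite [c%:C *: _]scalerBr [LHS]addrAC; congr (_ - _).
  rewrite -scalerBl -rmorphB; congr (_%:C *: _).
  by rewrite /w; field.
apply: invertibleZ; first by rewrite fmorph_eq0 mulf_neq0.
by exists g.
Qed.

(** For [z = a + i b] with [b != 0] and [y = x - a], the product of [y - i b] and [y + i b] in
    either order is [y^2 + b^2], a shifted square, hence invertible. *)
Lemma spectrum_selfadjoint x (z : R[i]) : selfadjoint x -> spectrum x z ->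
  z = (complex.Re z)%:C.
Proof.
move=> sx; case: z => a b sp; have [->//|b0] := eqVneq b 0; case: sp.
change (invertible (x - (a +i* b)%:A)).
pose y := x - (a%:C)%:A.
have b2 : 0 < b ^+ 2 by rewrite exprn_even_gt0.
have sy : star y = y by rewrite starB sx starZr star1.
have xz : x - (a +i* b)%:A = y - (0 +i* b)%:A.
  by rewrite /y -addrA -opprD -scalerDl; congr (_ - _ *: _); rewrite /= /GRing.add /= addr0 add0r.
clearbody y.
have ff : (0 +i* b : R[i]) * (0 +i* b) = - (b ^+ 2)%:C.
  by apply/eqP; rewrite eq_complex /= !mul0r !mulr0 addr0 sub0r expr2 oppr0 !eqxx.
have e1 : (y - (0 +i* b)%:A) * (y + (0 +i* b)%:A) = shifted_sq y (b ^+ 2).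
  rewrite mulrBl !mulrDr !alg_mull !alg_mulr scalerA ff scaleNr shifted_sqE sy.
  by ncring.
have e2 : (y + (0 +i* b)%:A) * (y - (0 +i* b)%:A) = shifted_sq y (b ^+ 2).
  rewrite mulrDl !mulrBr !alg_mull !alg_mulr scalerA ff scaleNr shifted_sqE sy.
  by ncring.
rewrite xz; apply: (@invertible_lr _ (resolvent y (b ^+ 2) * (y + (0 +i* b)%:A))
  ((y + (0 +i* b)%:A) * resolvent y (b ^+ 2))).
  by rewrite -mulrA e2 mul_resolvent_shifted.
by rewrite mulrA e1 mul_shifted_resolvent.
Qed.

(** The half of the spectral mapping theorem given by factoring [Q]: a product of invertible factors
    [x - z] is invertible. *)
Lemma horner_alg_noninvertible x (Q : {poly R[i]}) : Q != 0 ->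
  ~ invertible (horner_alg x Q) -> exists2 z, root Q z & spectrum x z.
Proof.
move=> Q0 ninv; apply: contrapT => nsp; apply: ninv.
have [rs Qrs] := closed_field_poly_normal Q.
have lc0 : lead_coef Q != 0 by rewrite lead_coef_eq0.
have rsP (w : R[i]) : w \in rs -> invertible (x - w%:A).
  move=> wrs; apply: contrapT => ninv; apply: nsp; exists w => //.
  by rewrite Qrs rootZ // root_prod_XsubC.
rewrite Qrs linearZ /= alg_mull; apply: (invertibleZ lc0).
elim: rs rsP {Qrs} => [|z rs IH] rsP.
  by rewrite big_nil rmorph1; exists 1; rewrite mulr1.
rewrite big_cons rmorphM; apply: invertibleM.
  rewrite rmorphB /= horner_algX horner_algC; apply: rsP; exact: mem_head.
by apply: IH => u urs; apply: rsP; rewrite inE urs orbT.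
Qed.

(** An inverse [g] of [m^2 - x^2], with [m] the norm of [x], would give
    [|h|^2 <= K (m^2 |h|^2 - |x h|^2)], so that [x] would have norm strictly below [m]. This is how
    the norm of a self-adjoint element is seen on its spectrum. *)
Lemma opnorm_sqr_sub_noninvertible x : selfadjoint x -> x <> 0 ->
  ~ invertible (((opnorm x) ^+ 2)%:C%:A - x * x).
Proof.
move=> sx x0 [g [xg gx]]; set m := opnorm x.
have m0 : 0 < m.
  by rewrite lt_neqAle opnorm_ge0 andbT eq_sym; apply/eqP => /opnorm_eq0.
have g0 : 0 < opnorm g.
  rewrite lt_neqAle opnorm_ge0 andbT eq_sym; apply/eqP => /opnorm_eq0 g0.
  by move: xg; rewrite g0 mulr0 => /eqP; rewrite eq_sym oner_eq0.
set K := opnorm g ^+ 2 * m ^+ 2.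
have K0 : 0 < K by rewrite mulr_gt0 ?exprn_gt0.
have H (h : hilb A) : rnorm (rep x h) ^+ 2 <= (m ^+ 2 - K^-1) * rnorm h ^+ 2.
  have h1 : rnorm h ^+ 2 <= K * (m ^+ 2 * rnorm h ^+ 2 - rnorm (rep x h) ^+ 2).
    set k := rep ((m ^+ 2)%:C%:A - x * x) h.
    have hk : h = rep g k by rewrite /k -repM gx rep1.
    have : rnorm h ^+ 2 <= opnorm g ^+ 2 * rnorm k ^+ 2.
      rewrite -exprMn ler_sqr ?nnegrE ?mulr_ge0 ?rnorm_ge0 ?opnorm_ge0 //.
      by rewrite {1}hk ler_opnorm.
    move/le_trans; apply; rewrite /K -mulrA ler_wpM2l ?sqr_ge0 //.
    rewrite -[rnorm k ^+ 2]rinner_rnorm /k rep_lB rep_alg repM !rinnerE.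
    have xC u v : rinner (rep x u) v = rinner u (rep x v).
      by rewrite rinner_star (sx : star x = x).
    have E1 : rinner (rep x (rep x h)) h = rnorm (rep x h) ^+ 2.
      by rewrite xC rinner_rnorm.
    rewrite (rinnerC h (rep x _)) !E1 !rinner_rnorm.
    have : rnorm (rep x (rep x h)) ^+ 2 <= m ^+ 2 * rnorm (rep x h) ^+ 2.
      by rewrite -exprMn ler_sqr ?nnegrE ?mulr_ge0 ?rnorm_ge0 ?opnorm_ge0 // ler_opnorm.
    lra.
  have Ki : 0 < K^-1 by rewrite invr_gt0.
  have := ler_wpM2l (ltW Ki) h1; rewrite (mulKf (lt0r_neq0 K0)); lra.
have [h h0] : exists h : hilb A, h != 0.
  apply: contrapT => nh; apply: x0; apply: rep_ext => h; rewrite rep_l0.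
  by have [->|/eqP h0] := pselect (h = 0); [rewrite rep0r|case: nh; exists h].
have mK : 0 <= m ^+ 2 - K^-1.
  have := le_trans (sqr_ge0 _) (H h).
  by rewrite pmulr_lge0 // exprn_gt0 // rnorm_gt0.
have : m <= Num.sqrt (m ^+ 2 - K^-1).
  apply: opnorm_ler (sqrtr_ge0 _) _ => k.
  rewrite -ler_sqr ?nnegrE ?mulr_ge0 ?rnorm_ge0 ?sqrtr_ge0 //.
  by rewrite exprMn sqr_sqrtr.
rewrite -ler_sqr ?nnegrE ?sqrtr_ge0 ?(ltW m0) // sqr_sqrtr //.
by apply/negP; rewrite -ltNge gtrBl invr_gt0.
Qed.

Definition rhorner x (p : {poly R}) : A := horner_alg x (map_poly (real_complex R) p).

Lemma star_rhorner x p : selfadjoint x -> star (rhorner x p) = rhorner x p.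
Proof.
move=> sx; rewrite /rhorner; elim/poly_ind: p => [|p c IH].
  by rewrite !rmorph0 star0.
rewrite rmorphD rmorphM /= map_polyX map_polyC /= rmorphD rmorphM /= horner_algX horner_algC.
rewrite starD starM IH (sx : star x = x) starZr star1; congr (_ + _).
have xc q : x * horner_alg x q = horner_alg x q * x.
  by rewrite -{1 4}(horner_algX x) -!rmorphM mulrC.
exact: xc.
Qed.

Lemma spectrum_selfadjoint_neq0 x : selfadjoint x -> exists r : R, spectrum x r%:C.
Proof.
move=> sx; have [->|/eqP x0] := eqVneq x 0.
  exists 0 => -[y [+ _]]; rewrite rmorph0 scale0r subrr mul0r => /eqP.
  by rewrite eq_sym oner_eq0.
have := opnorm_sqr_sub_noninvertible sx x0; set m2 := _ ^+ 2.
have -> : m2%:C%:A - x * x = horner_alg x (m2%:C%:P - 'X * 'X).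
  by rewrite rmorphB /= (rmorphM (horner_alg x)) /= horner_algX horner_algC.
move=> /horner_alg_noninvertible[|z _ sz]; last first.
  by exists (complex.Re z); rewrite -(spectrum_selfadjoint sx sz).
rewrite subr_eq0; apply/eqP => /(congr1 (fun q : {poly R[i]} => size q)).
by rewrite -expr2 size_polyXn size_polyC; case: (_ != 0).
Qed.

(** With [m] the norm of [p(x)], the non-invertible element [m^2 - p(x)^2] is a polynomial in [x],
    so [m^2 - p^2] vanishes at a point of the spectrum, where [|p| = m]. This yields the uniqueness
    of the functional calculus. *)
Lemma opnorm_rhorner_le x p (d : R) : selfadjoint x -> 0 <= d ->
  (forall r, spectrum x r%:C -> `|p.[r]| <= d) -> opnorm (rhorner x p) <= d.
Proof.
move=> sx d0 pd; rewrite leNgt; apply/negP => dm.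
have T0 : rhorner x p <> 0 by move=> T0; move: dm; rewrite T0 opnorm0 ltNge d0.
have := opnorm_sqr_sub_noninvertible (star_rhorner p sx) T0; set m := opnorm _ in dm *.
set P := map_poly (real_complex R) p.
have -> : (m ^+ 2)%:C%:A - rhorner x p * rhorner x p = horner_alg x ((m ^+ 2)%:C%:P - P * P).
  by rewrite rmorphB /= (rmorphM (horner_alg x)) /= horner_algC.
have contra (r : R) : spectrum x r%:C -> p.[r] ^+ 2 = m ^+ 2 -> False.
  move=> /pd pr pm; move: dm; rewrite ltNge => /negP; apply.
  by rewrite -(ger0_norm (opnorm_ge0 _ : 0 <= m)) -sqrtr_sqr -pm sqrtr_sqr.
(* If [m^2 - P^2] is the zero polynomial, every point of the spectrum serves, and there is one. *)
have [Q0 _|Q0 /(horner_alg_noninvertible Q0)[z]] := eqVneq ((m ^+ 2)%:C%:P - P * P) 0.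
  have [r rsp] := spectrum_selfadjoint_neq0 sx; apply: (contra r rsp).
  have /eqP := congr1 (fun q : {poly R[i]} => q.[r%:C]) Q0.
  rewrite horner0 hornerD hornerN hornerM hornerC /P horner_map subr_eq0 -rmorphM.
  by move=> /eqP/complexI pm; rewrite expr2 -pm.
move=> rz sz; have zr := spectrum_selfadjoint sx sz; rewrite zr in rz sz.
apply: (contra _ sz); move: rz; rewrite /root hornerD hornerN hornerM hornerC /P.
by rewrite horner_map subr_eq0 -rmorphM => /eqP/complexI pm; rewrite expr2 -pm.
Qed.

End Spectrum.

(** * The logarithm as a geometric limit of polynomials *)

Section OpLog.
Context {R : realType} {A : vonNeumannAlgebra R}.
Implicit Types x y z g : A.

Lemma rhorner_is_linear x (c : R) (p q : {poly R}) :
  rhorner x (c *: p + q) = c%:C *: rhorner x p + rhorner x q.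
Proof.
rewrite /rhorner rmorphD /= map_polyZ rmorphD /= linearZ /= alg_mull.
by [].
Qed.

Lemma rhorner0 x : rhorner x 0 = 0.
Proof. by rewrite /rhorner !rmorph0. Qed.

Lemma rhorner1 x : rhorner x 1 = 1.
Proof. by rewrite /rhorner !rmorph1. Qed.

Lemma rhornerX x : rhorner x 'X = x.
Proof. by rewrite /rhorner map_polyX horner_algX. Qed.

Lemma rhornerD x p q : rhorner x (p + q) = rhorner x p + rhorner x q.
Proof. by have := rhorner_is_linear x 1 p q; rewrite !scale1r. Qed.

Lemma rhornerZ x (c : R) p : rhorner x (c *: p) = c%:C *: rhorner x p.
Proof. by have := rhorner_is_linear x c p 0; rewrite rhorner0 !addr0. Qed.

Lemma rhornerB x p q : rhorner x (p - q) = rhorner x p - rhorner x q.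
Proof. by apply: (addIr (rhorner x q)); rewrite -rhornerD !subrK. Qed.

Lemma rhornerXn x p n : rhorner x (p ^+ n) = rhorner x p ^+ n.
Proof. by rewrite /rhorner !rmorphXn. Qed.

Lemma rhorner_sum x n (F : 'I_n -> {poly R}) :
  rhorner x (\sum_(k < n) F k) = \sum_(k < n) rhorner x (F k).
Proof. exact: (big_morph _ (rhornerD x) (rhorner0 x)). Qed.

Definition log_approx (c : R) n : {poly R} :=
  (ln c)%:P - \sum_(k < n) k%:R^-1 *: (1 - c^-1 *: 'X) ^+ k.

Lemma rhorner_log_approx x c n : rhorner x (log_approx c n) =
  (ln c)%:C *: 1 - \sum_(k < n) (k%:R^-1)%:C *: contraction x c ^+ k.
Proof.
rewrite /log_approx rhornerB rhorner_sum -[_%:P]mulr1 mul_polyC rhornerZ rhorner1.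
congr (_ - _); apply: eq_bigr => k _.
by rewrite rhornerZ rhornerXn rhornerB rhorner1 rhornerZ rhornerX.
Qed.

Lemma horner_log_approx c n r :
  (log_approx c n).[r] = ln c - (log_poly n).[1 - r / c].
Proof.
rewrite /log_approx /log_poly hornerD hornerN hornerC !horner_sum; congr (_ - _).
apply: eq_bigr => k _; rewrite !hornerZ hornerXn horner_exp.
by rewrite hornerD hornerN hornerC hornerZ hornerX [c^-1 * _]mulrC.
Qed.

Section Approximation.
Variables (x : A) (c rho : R).
Hypotheses (sx : selfadjoint x) (c0 : 0 < c) (r1 : rho < 1).
Hypothesis xr : opnorm (contraction x c) <= rho.

Let r0 : 0 <= rho. Proof. by apply: le_trans xr; exact: opnorm_ge0. Qed.

Lemma log_approx_spectrum n (r : R) : spectrum x r%:C ->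
  `|(log_approx c n.+1).[r] - ln r| <= rho ^+ n.+1 / (1 - rho).
Proof.
move=> sr; have w := spectrum_contraction c0 r1 xr sr.
have wp : 0 < r / c.
  have : 1 - r / c <= rho by apply: le_trans w; exact: ler_norm.
  by move: r1; lra.
have rp : 0 < r by move: wp; rewrite pmulr_lgt0 // invr_gt0.
have -> : ln r = ln c + ln (1 - (1 - r / c)).
  by rewrite subKr -lnM ?posrE // mulrCA divff ?mulr1 // gt_eqF.
rewrite horner_log_approx opprD addrACA subrr add0r -opprD normrN addrC.
exact: ln_log_poly_le.
Qed.

Lemma op_log_approx n :
  opnorm (rhorner x (log_approx c n) - op_log x) <= rho ^+ n / (1 - rho).
Proof.
have r1' : 0 < 1 - rho by rewrite subr_gt0.
have stepP m : opnorm (rhorner x (log_approx c m.+1) - rhorner x (log_approx c m)) <= rho ^+ m.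
  rewrite !rhorner_log_approx big_ord_recr /=.
  have telescope (a S t : A) : a - (S + t) - (a - S) = - t by ncring.
  rewrite telescope opnormN.
  apply: le_trans (opnormZr_le _ _) _.
  have : opnorm (contraction x c ^+ m) <= rho ^+ m.
    by apply: le_trans (opnormX _ _) _; rewrite lerXn2r ?nnegrE ?opnorm_ge0.
  move=> zm; apply: le_trans zm; rewrite ger0_norm ?invr_ge0 // ler_piMl ?opnorm_ge0 //.
  by case: m => [|m]; rewrite ?invr0 // invf_le1 ?ltr0n // ler1n.
have [L LP] := opnorm_cvg_geometric r0 r1 stepP.
have rc : rho ^+ k / (1 - rho) @[k --> \oo] --> 0 by exact: cvg_geometric0.
have near_le (e : R) : 0 < e -> \forall k \near \oo, rho ^+ k / (1 - rho) <= e.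
  move=> e0; have /cvgrPdist_le/(_ e e0) := rc.
  apply: filterS => k; rewrite sub0r normrN; apply: le_trans; exact: ler_norm.
have unif (e : R) : 0 < e -> \forall k \near \oo, forall r : R,
    spectrum x r%:C -> `|(log_approx c k).[r] - ln r| <= e.
  move=> e0; have [N _ HN] := near_le e e0; exists N.+1 => // k /= Nk r sr.
  case: k Nk => // k Nk; apply: le_trans (log_approx_spectrum k sr) _.
  by apply: HN => /=; exact: ltnW.
have LF : is_functional_calculus (@ln R) x L.
  exists (log_approx c); split=> // e e0.
  near=> k; apply: opnorm_leP; apply: le_trans (LP k) _.
  by near: k; exact: near_le.
suff -> : op_log x = L by [].
(* The choice made by [xget] comes with its own polynomials [q]; as [q k] and [log_approx c k] are
   both close to [ln] on the spectrum, their values at [x] are close in norm, and so are the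
   limits. *)
rewrite /op_log /functional_calculus; case: xgetP => [y _ [q [qu qy]]|]; last first.
  by move=> /(_ L).
apply/eqP; rewrite -subr_eq0; apply/eqP/opnorm_eq0/eqP.
rewrite eq_le opnorm_ge0 andbT; apply/ler_addgt0Pr => e e0; rewrite add0r.
(* Four errors: each polynomial against [ln] on the spectrum, and each value at [x] against its
   limit. *)
have e4 : 0 < e / 4 by rewrite divr_gt0.
suff [k [k1 k2 k3 k4]] : exists k, [/\ forall r : R, spectrum x r%:C -> `|(q k).[r] - ln r| <= e / 4,
    opnorm_le (rhorner x (q k) - y) (e / 4),
    forall r : R, spectrum x r%:C -> `|(log_approx c k).[r] - ln r| <= e / 4 &
    rho ^+ k / (1 - rho) <= e / 4].
  have k2' := opnorm_le_opnorm (ltW e4) k2.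
  have k5 : opnorm (rhorner x (q k - log_approx c k)) <= e / 4 + e / 4.
    apply: opnorm_rhorner_le => //; first by rewrite addr_ge0 // ltW.
    move=> r sr; rewrite hornerD hornerN.
    have -> : (q k).[r] - (log_approx c k).[r] =
      ((q k).[r] - ln r) - ((log_approx c k).[r] - ln r) by ring.
    by apply: le_trans (ler_normB _ _) _; rewrite lerD ?k1 ?k3.
  have -> : y - L = rhorner x (q k - log_approx c k) - (rhorner x (q k) - y) +
     (rhorner x (log_approx c k) - L) by rewrite rhornerB; ncring.
  have := LP k.
  have := opnormD (rhorner x (q k - log_approx c k) - (rhorner x (q k) - y)) (rhorner x (log_approx c k) - L).
  have := opnormB (rhorner x (q k - log_approx c k)) (rhorner x (q k) - y).
  by move: k4 k5 k2'; lra.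
have [N1 _ H1] := qu _ e4; have [N2 _ H2] := qy _ e4.
have [N3 _ H3] := unif _ e4; have [N4 _ H4] := near_le _ e4.
exists (N1 + N2 + N3 + N4)%N; split.
- by apply: H1 => /=; rewrite -!addnA leq_addr.
- by apply: H2 => /=; rewrite -!addnA addnCA leq_addr.
- by apply: H3 => /=; rewrite -addnA addnCA leq_addr.
- by apply: H4 => /=; rewrite leq_addl.
Unshelve. all: by end_near. Qed.

Lemma star_op_log : star (op_log x) = op_log x.
Proof.
apply: (@opnorm_small_eq _ _ _ _ rho (2 / (1 - rho))) => // n.
set u := rhorner x (log_approx c n).
have -> : star (op_log x) - op_log x = (u - op_log x) - star (u - op_log x).
  by rewrite starB star_rhorner // -/u; ncring.
apply: le_trans (opnormB _ _) _; rewrite opnorm_star.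
by have := op_log_approx n; rewrite -/u mulrCA; set t := _ / _; lra.
Qed.

End Approximation.
End OpLog.

(** * The derivative of the trace of the logarithm *)

Section LogDerivative.
Context {R : realType} {A : tracialVNA R}.
Implicit Types x y z D E : A.

Definition rtau x : R := complex.Re (tau x).

Lemma rtauD x y : rtau (x + y) = rtau x + rtau y.
Proof. by rewrite /rtau tauD raddfD. Qed.

Lemma rtau0 : rtau 0 = 0.
Proof. by rewrite /rtau tau0. Qed.

Lemma rtauN x : rtau (- x) = - rtau x.
Proof. by rewrite /rtau tauN raddfN. Qed.

Lemma rtauB x y : rtau (x - y) = rtau x - rtau y.
Proof. by rewrite rtauD rtauN. Qed.

Lemma rtauZ (c : R) x : rtau (c%:C *: x) = c * rtau x.
Proof. by rewrite /rtau tauZ; case: (tau x) => a b /=; rewrite mul0r subr0. Qed.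

Lemma rtauC x y : rtau (x * y) = rtau (y * x).
Proof. by rewrite /rtau tau_tracial. Qed.

Lemma rtau_sum n (F : 'I_n -> A) : rtau (\sum_(k < n) F k) = \sum_(k < n) rtau (F k).
Proof. exact: (big_morph _ rtauD rtau0). Qed.

Lemma rtau_le x : `|rtau x| <= opnorm x.
Proof. exact: Re_tau_le. Qed.

Lemma rtau1 : rtau 1 = 1.
Proof. by rewrite /rtau tau1. Qed.

(** For [mu = nu] the equality case of the recursion is solved by [B (nu^k - rho^k) / (nu - rho)]. A
    ratio above [rho] thus replaces bounds of the form [k rho^k]. *)
Lemma geometric_recursion (a : R^nat) (B rho mu nu : R) : 0 <= rho -> 0 <= mu -> 0 <= B ->
  mu <= nu -> rho < nu -> a 0%N = 0 -> (forall k, a k.+1 <= a k * rho + B * mu ^+ k) ->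
  forall k, a k <= B / (nu - rho) * nu ^+ k.
Proof.
move=> r0 m0 B0 mn rn a0 aS; have nr : 0 < nu - rho by rewrite subr_gt0.
elim=> [|k IH]; first by rewrite a0 expr0 mulr1 divr_ge0 // ltW.
apply: le_trans (aS k) _.
have h1 := ler_wpM2r r0 IH.
have h2 : B * mu ^+ k <= B * nu ^+ k.
  by rewrite ler_wpM2l // lerXn2r ?nnegrE ?(le_trans m0).
apply: le_trans (lerD h1 h2) _; rewrite le_eqVlt; apply/orP; left; apply/eqP.
by rewrite exprS; field; rewrite gt_eqF.
Qed.

Section PowerExpansion.
Variables (rho : R) (z E : A).
Hypotheses (r1 : rho < 1) (zr : opnorm z <= rho) (zEr : opnorm (z + E) <= rho).

Let r0 : 0 <= rho. Proof. by apply: le_trans zr; exact: opnorm_ge0. Qed.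
Let mu := (1 + rho) / 2.
Let nu := (1 + mu) / 2.

Let opnormX_le x k : opnorm x <= rho -> opnorm (x ^+ k) <= rho ^+ k.
Proof.
by move=> xr; apply: le_trans (opnormX _ _) _; rewrite lerXn2r ?nnegrE ?opnorm_ge0.
Qed.

Lemma power_diff_le k :
  opnorm ((z + E) ^+ k - z ^+ k) <= opnorm E / (mu - rho) * mu ^+ k.
Proof.
pose a k := opnorm ((z + E) ^+ k - z ^+ k).
rewrite -[opnorm _]/(a k); apply: (@geometric_recursion a (opnorm E) rho rho mu) => //.
- exact: opnorm_ge0.
- by rewrite /mu; move: r1; lra.
- by rewrite /mu; move: r1; lra.
- by rewrite /a !expr0 subrr opnorm0.
- move=> j; rewrite /a !exprSr.
  have -> : (z + E) ^+ j * (z + E) - z ^+ j * z =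
     ((z + E) ^+ j - z ^+ j) * z + (z + E) ^+ j * E by ncring.
  apply: le_trans (opnormD _ _) _; apply: lerD.
    by apply: le_trans (opnormM _ _) _; rewrite ler_wpM2l ?opnorm_ge0.
  rewrite mulrC; apply: le_trans (opnormM _ _) _.
  by rewrite ler_wpM2r ?opnorm_ge0 ?opnormX_le.
Qed.

(** The first-order part of [(z + E)^k] in [E], that is, the sum of the [z^j E z^(k-1-j)]; under the
    trace all its terms agree. *)
Fixpoint power_deriv k : A :=
  if k is k'.+1 then power_deriv k' * z + z ^+ k' * E else 0.

Lemma rtau_power_deriv k : rtau (power_deriv k.+1) = k.+1%:R * rtau (z ^+ k * E).
Proof.
(* The extra factor [z ^+ j] absorbs the right factor [z] produced by the recursion. *)
suff H j : rtau (power_deriv k.+1 * z ^+ j) = k.+1%:R * rtau (z ^+ (k + j) * E).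
  by have := H 0%N; rewrite expr0 mulr1 addn0.
elim: k j => [|k IH] j.
  by rewrite /= mul0r add0r expr0 mul1r mul1r rtauC.
have -> : power_deriv k.+2 = power_deriv k.+1 * z + z ^+ k.+1 * E by [].
rewrite mulrDl -!mulrA -exprS rtauD IH.
have -> : rtau (z ^+ k.+1 * (E * z ^+ j)) = rtau (z ^+ (k.+1 + j) * E).
  by rewrite mulrA rtauC mulrA -exprD addnC.
by rewrite addnS -addSn [in RHS]mulrS mulrDl mul1r addrC.
Qed.

Lemma power_remainder_le k :
  opnorm ((z + E) ^+ k - z ^+ k - power_deriv k) <=
  opnorm E ^+ 2 / (mu - rho) / (nu - rho) * nu ^+ k.
Proof.
pose a k := opnorm ((z + E) ^+ k - z ^+ k - power_deriv k).
have mr : 0 < mu - rho by rewrite /mu; move: r1; lra.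
rewrite -[opnorm _]/(a k).
apply: (@geometric_recursion a (opnorm E ^+ 2 / (mu - rho)) rho mu nu) => //.
- by rewrite /mu; move: r0; lra.
- by rewrite divr_ge0 ?sqr_ge0 // ltW.
- by rewrite /nu /mu; move: r1; lra.
- by rewrite /nu /mu; move: r1; lra.
- by rewrite /a !expr0 subrr subr0 opnorm0.
- move=> j; rewrite /a !exprSr /=.
  have -> : (z + E) ^+ j * (z + E) - z ^+ j * z - (power_deriv j * z + z ^+ j * E) =
     ((z + E) ^+ j - z ^+ j - power_deriv j) * z + ((z + E) ^+ j - z ^+ j) * E by ncring.
  apply: le_trans (opnormD _ _) _; apply: lerD.
    by apply: le_trans (opnormM _ _) _; rewrite ler_wpM2l ?opnorm_ge0.
  apply: le_trans (opnormM _ _) _.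
  have := ler_wpM2r (opnorm_ge0 E) (power_diff_le j); move/le_trans; apply.
  by rewrite le_eqVlt; apply/orP; left; apply/eqP; ring.
Qed.

(* The two intermediate ratios [rho < mu < nu < 1] absorb the factors [k] and
   [k^2] of the first and second order differences of [z ^+ k]. *)
Definition log_modulus (r : R) : R :=
  let mu := (1 + r) / 2 in let nu := (1 + mu) / 2 in
  ((mu - r) * (nu - r) * (1 - nu))^-1.

Lemma log_sum_remainder_le n :
  `|\sum_(k < n.+1) k%:R^-1 * rtau ((z + E) ^+ k) - \sum_(k < n.+1) k%:R^-1 * rtau (z ^+ k)
    - rtau (\sum_(k < n) z ^+ k * E)| <= log_modulus rho * opnorm E ^+ 2.
Proof.
have mr : 0 < mu - rho by rewrite /mu; move: r1; lra.
have nr : 0 < nu - rho by rewrite /nu /mu; move: r1; lra.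
have n1 : nu < 1 by rewrite /nu /mu; move: r1; lra.
have n0 : 0 <= nu by rewrite /nu /mu; move: r0; lra.
have -> : rtau (\sum_(k < n) z ^+ k * E) = \sum_(k < n.+1) k%:R^-1 * rtau (power_deriv k).
  rewrite big_ord_recl /= rtau0 mulr0 add0r rtau_sum; apply: eq_bigr => k _.
  by rewrite rtau_power_deriv mulrA mulVf ?mul1r // pnatr_eq0.
rewrite -!sumrB.
set K := opnorm E ^+ 2 / (mu - rho) / (nu - rho).
have K0 : 0 <= K by rewrite !divr_ge0 ?sqr_ge0 // ltW.
apply: (@le_trans _ _ (\sum_(0 <= k < n.+1) K * nu ^+ k)).
  rewrite big_mkord; apply: le_trans (ler_norm_sum _ _ _) _; apply: ler_sum => k _.
  rewrite -!mulrBr -!rtauB normrM.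
  have h := le_trans (rtau_le _) (power_remainder_le k).
  have : `|(k : nat)%:R^-1 : R| <= 1.
    rewrite ger0_norm ?invr_ge0 //; case: (k : nat) => [|m]; rewrite ?invr0 //.
    by rewrite invf_le1 ?ltr0n // ler1n.
  move=> h1; have := ler_pM (normr_ge0 _) (normr_ge0 _) h1 h.
  by rewrite mul1r.
rewrite -mulr_sumr; apply: le_trans (ler_wpM2l K0 (geometric_sum_le 0 n.+1 n0 n1)) _.
rewrite expr0 div1r /K /log_modulus -/mu -/nu le_eqVlt; apply/orP; left; apply/eqP.
have : 1 - nu != 0 by rewrite gt_eqF // subr_gt0.
by move=> n2; field; rewrite n2 !gt_eqF.
Qed.

End PowerExpansion.

Lemma rtau_op_log_approx x (c rho : R) n : selfadjoint x -> 0 < c -> rho < 1 ->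
  opnorm (contraction x c) <= rho ->
  `|ln c - \sum_(k < n) k%:R^-1 * rtau (contraction x c ^+ k) - rtau (op_log x)|
    <= rho ^+ n / (1 - rho).
Proof.
move=> sx c0 r1 xr; apply: le_trans (op_log_approx sx c0 r1 xr n).
apply: le_trans (rtau_le _); rewrite rtauB rhorner_log_approx rtauB rtauZ rtau1 mulr1.
by rewrite rtau_sum; under [X in _ <= `|_ - X - _|]eq_bigr do rewrite rtauZ.
Qed.

Lemma rtau_op_log_eq x y (c rho : R) : selfadjoint x -> selfadjoint y -> 0 < c -> rho < 1 ->
  opnorm (contraction x c) <= rho -> opnorm (contraction y c) <= rho ->
  (forall k, tau (contraction x c ^+ k) = tau (contraction y c ^+ k)) ->
  rtau (op_log x) = rtau (op_log y).
Proof.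
move=> sx sy c0 r1 xr yr xy; apply/eqP; rewrite -subr_eq0 -normr_le0; apply/eqP/eqP.
have r0 : 0 <= rho by apply: le_trans xr; exact: opnorm_ge0.
have rc : rho ^+ n @[n --> \oo] --> 0.
  by have := cvg_geometric0 1 r0 r1; under eq_fun do rewrite mulr1.
apply: (cvg0_le rc (C := 2 / (1 - rho))) => n.
have := rtau_op_log_approx n sx c0 r1 xr; have := rtau_op_log_approx n sy c0 r1 yr.
have -> : \sum_(k < n) k%:R^-1 * rtau (contraction y c ^+ k) =
  \sum_(k < n) k%:R^-1 * rtau (contraction x c ^+ k).
  by apply: eq_bigr => k _; rewrite /rtau xy.
rewrite mulrCA !ler_norml; set t := rho ^+ n / _; lra.
Qed.

(** The contractions differ by [E = - D / c], and the sums of [z^k / c] tend to the resolvent, so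
    the first-order term of the truncated series tends to [tau (G D)]. Common [c] and [rho] for both
    points make the quadratic remainder uniform. *)
Lemma log_frechet (y y1 D : A) (e e1 c rho : R) : 0 < e -> 0 < e1 -> rho < 1 ->
  opnorm y ^+ 2 + e <= c -> opnorm y1 ^+ 2 + e1 <= c ->
  Num.sqrt (1 - e / c) <= rho -> Num.sqrt (1 - e1 / c) <= rho ->
  shifted_sq y1 e1 = shifted_sq y e + D ->
  `|rtau (op_log (shifted_sq y1 e1)) - rtau (op_log (shifted_sq y e)) -
    rtau (resolvent y e * D)| <= log_modulus rho * (c^-1) ^+ 2 * opnorm D ^+ 2.
Proof.
move=> e0 e10 r1 yc y1c rr rr1 DE.
have c0 : 0 < c by apply: lt_le_trans yc; rewrite ltr_wpDl ?sqr_ge0.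
set z := contraction (shifted_sq y e) c; set z1 := contraction (shifted_sq y1 e1) c.
pose E := z1 - z.
have zr : opnorm z <= rho by apply: le_trans rr; exact: opnorm_contraction.
have z1r : opnorm z1 <= rho by apply: le_trans rr1; exact: opnorm_contraction.
have z1E : z1 = z + E by rewrite /E; ncring.
have r0 : 0 <= rho by apply: le_trans zr; exact: opnorm_ge0.
have ED : E = - ((c^-1)%:C *: D).
  by rewrite /E /z /z1 /contraction DE scalerDr; ncring.
have Ele : opnorm E <= c^-1 * opnorm D.
  by rewrite ED opnormN; apply: le_trans (opnormZr_le _ _) _; rewrite ger0_norm // invr_ge0 ltW.
have C0 : 0 <= log_modulus rho.
  by rewrite invr_ge0 !mulr_ge0 //; move: r1; lra.
have E2 : log_modulus rho * opnorm E ^+ 2 <= log_modulus rho * (c^-1) ^+ 2 * opnorm D ^+ 2.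
  rewrite -mulrA -exprMn ler_wpM2l // ler_sqr ?nnegrE ?opnorm_ge0 //.
  by rewrite mulr_ge0 ?opnorm_ge0 // invr_ge0 ltW.
rewrite -subr_le0.
have rc : rho ^+ n @[n --> \oo] --> 0.
  by have := cvg_geometric0 1 r0 r1; under eq_fun do rewrite mulr1.
apply: (cvg0_le rc (C := 2 / (1 - rho) + c^-1 / (1 - Num.sqrt (1 - e / c)) * opnorm D)) => n.
have rn : rho ^+ n.+1 / (1 - rho) <= rho ^+ n / (1 - rho).
  by rewrite ler_wpM2r ?invr_ge0 ?subr_ge0 ?(ltW r1) // exprS ler_piMl ?exprn_ge0 // ltW.
have h1 := le_trans (rtau_op_log_approx n.+1 (star_shifted_sq y e) c0 r1 zr) rn.
have h2 := le_trans (rtau_op_log_approx n.+1 (star_shifted_sq y1 e1) c0 r1 z1r) rn.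
have := log_sum_remainder_le r1 zr _ n; move=> /(_ E); rewrite -z1E => /(_ z1r) h3.
have h4 : `|rtau (\sum_(k < n) z ^+ k * E) + rtau (resolvent y e * D)| <=
    rho ^+ n * (c^-1 / (1 - Num.sqrt (1 - e / c))) * opnorm D.
  rewrite -mulr_suml ED mulrN -scalerAr scalerAl rtauN addrC -rtauB -mulrBl.
  apply: le_trans (rtau_le _) _; apply: le_trans (opnormM _ _) _.
  rewrite ler_wpM2r ?opnorm_ge0 // opnorm_distC.
  apply: le_trans (resolvent_partial_sums e0 n yc) _.
  rewrite ler_wpM2r ?lerXn2r ?nnegrE ?sqrtr_ge0 //.
  by rewrite divr_ge0 ?invr_ge0 ?(ltW c0) // subr_ge0 ltW // sqrt_contraction_lt1.
have -> : rho ^+ n * (2 / (1 - rho) + c^-1 / (1 - Num.sqrt (1 - e / c)) * opnorm D) =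
  2 * (rho ^+ n / (1 - rho)) + rho ^+ n * (c^-1 / (1 - Num.sqrt (1 - e / c))) * opnorm D.
  by rewrite mulrDr mulrCA !mulrA.
move: h1 h2 h3 h4 E2; rewrite -/z -/z1.
move: (rtau (op_log (shifted_sq y1 e1))) (rtau (op_log (shifted_sq y e))) => a1 a.
move: (rtau (_ * D)) (\sum_(k < n.+1) _) (\sum_(k < n.+1) _) (rtau (\sum_(k < n) _)).
move=> b S1 S T; move: (rho ^+ n / _) (rho ^+ n * _ * _) (_ * opnorm E ^+ 2).
move=> t u X h1 h2 h3 h4 E2; rewrite lerBlDr.
by move: h1 h2 h3 h4; rewrite !ler_norml; lra.
Qed.

End LogDerivative.

(** * Derivatives along affine paths *)

Section PathDerivative.
Context {R : realType}.

Lemma is_derive_quadratic (f : R -> R) (u l C d : R) : 0 < d ->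
  (forall h, `|h| <= d -> `|f (u + h) - f u - h * l| <= C * h ^+ 2) ->
  is_derive u 1 f l.
Proof.
move=> d0 fC.
have H : h^-1 *: (f (h *: 1 + u) - f u) @[h --> 0^'] --> l.
  apply/cvgrPdist_le => e e0; near=> h.
  have h0 : h != 0 by near: h; exact: nbhs_dnbhs_neq.
  have hd : `|h| <= d.
    by near: h; apply: dnbhs0_le.
  have he : `|h| <= e / (`|C| + 1).
    by near: h; apply: dnbhs0_le; rewrite divr_gt0 // ltr_wpDl.
  have -> : l - h^-1 *: (f (h *: 1 + u) - f u) = - (h^-1 * (f (u + h) - f u - h * l)).
    rewrite [h *: 1]mulr1 [h + u]addrC -[_ *: _]/(_ * _).
    by field.
  rewrite normrN normrM normfV ler_pdivrMl ?normr_gt0 //.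
  apply: le_trans (fC h hd) _; rewrite -[h ^+ 2]real_normK ?num_real // expr2 mulrA.
  rewrite mulrC ler_wpM2l //.
  have : C * `|h| <= (`|C| + 1) * `|h|.
    by rewrite ler_wpM2r //; apply: le_trans (ler_norm _) _; rewrite lerDl.
  move=> /le_trans; apply.
  by rewrite -ler_pdivlMl ?ltr_wpDl // mulrC.
apply: DeriveDef; first by apply/cvg_ex; exists l.
by apply/cvg_lim.
Unshelve. all: by end_near. Qed.

Context {A : tracialVNA R}.

Lemma shifted_sq_path (y w : A) (e e' h : R) :
  shifted_sq (y + h%:C *: w) (e + h * e') = shifted_sq y e +
  (h%:C *: (star w * y + star y * w + e'%:C *: 1) + (h ^+ 2)%:C *: (star w * w)).
Proof.
rewrite !shifted_sqE starD starZr mulrDl !mulrDr -!scalerAl -!scalerAr !scalerA.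
rewrite !rmorphD !rmorphM /= -expr2 -rmorphXn /= !scalerDl !scalerDr !scalerA.
by ncring.
Qed.

(** Serves for all the derivatives needed: each variable [r], [a], [b] moves [y] along a line, and
    [eps] moves the shift. *)
Lemma is_derive_log_path (f : R -> R) (u : R) (y w : A) (e e' : R) : 0 < e ->
  (forall h, f (u + h) =
     rtau (op_log (shifted_sq (y + h%:C *: w) (e + h * e')))) ->
  is_derive u 1 f
    (rtau (resolvent y e * (star w * y + star y * w + e'%:C *: 1))).
Proof.
move=> e0 fE; set D1 := star w * y + star y * w + e'%:C *: 1.
set D2 := star w * w.
(* Keeps the shift [e + h e'] above [e / 2]; the added 1 covers [e' = 0]. *)
pose d := Num.min 1 (e / 2 / (`|e'| + 1)).
have e'0 : 0 < `|e'| + 1 by rewrite ltr_wpDl.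
have e20 : 0 < e / 2 by rewrite divr_gt0.
have d0 : 0 < d by rewrite lt_min ltr01 divr_gt0.
(* [c] is admissible along the whole path for [|h| <= 1], so one ratio [rho] serves for all [h]. *)
pose N := opnorm y + opnorm w; pose c := N ^+ 2 + e + `|e'|.
have N0 : 0 <= N by rewrite addr_ge0 ?opnorm_ge0.
have c0 : 0 < c by rewrite ltr_wpDr // ltr_wpDl ?sqr_ge0.
pose rho := Num.sqrt (1 - (e / 2) / c).
have r1 : rho < 1 by exact: sqrt_contraction_lt1.
pose K := opnorm D1 + opnorm D2.
apply: (is_derive_quadratic (d := d)
  (C := log_modulus rho * (c^-1) ^+ 2 * K ^+ 2 + `|rtau (resolvent y e * D2)|)) => // h.
rewrite le_min => /andP[h1 hd].
have he' : `|h * e'| <= e / 2.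
  rewrite normrM; apply: le_trans (_ : `|h| * (`|e'| + 1) <= _).
    by rewrite ler_wpM2l // lerDl.
  by rewrite -ler_pdivlMr.
have he1 : `|h * e'| <= `|e'| by rewrite normrM ler_piMl.
have eh : e / 2 <= e + h * e' by move: he'; rewrite ler_norml; lra.
have eh1 : e + h * e' <= e + `|e'| by rewrite lerD2l; apply: le_trans (ler_norm _) he1.
have hw : opnorm (h%:C *: w) <= opnorm w.
  by apply: le_trans (opnormZr_le _ _) _; rewrite ler_piMl ?opnorm_ge0.
have yh : opnorm (y + h%:C *: w) <= N.
  by apply: le_trans (opnormD _ _) _; rewrite lerD2l.
have yN : opnorm y <= N by rewrite lerDl opnorm_ge0.
have sq_le (a b : R) : 0 <= a -> a <= b -> a ^+ 2 <= b ^+ 2.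
  by move=> a0 ab; rewrite ler_sqr ?nnegrE // (le_trans a0).
have rho_le (e1 : R) : e / 2 <= e1 -> Num.sqrt (1 - e1 / c) <= rho.
  by move=> ee1; rewrite ler_wsqrtr // lerD2l lerN2 ler_wpM2r // invr_ge0 ltW.
have fr := @log_frechet R A y (y + h%:C *: w) _ e (e + h * e') c rho e0
  (lt_le_trans e20 eh) r1 _ _ _ _ (shifted_sq_path y w e e' h).
have {fr} := fr _ _ _ _; rewrite -/D1 -/D2 => fr.
have fuh : f (u + h) - f u = rtau (op_log (shifted_sq (y + h%:C *: w) (e + h * e'))) -
    rtau (op_log (shifted_sq y e)).
  by rewrite fE -[u in f u]addr0 fE scale0r mul0r !addr0.
rewrite fuh.
have h2 : (h ^+ 2) = `|h| ^+ 2 by rewrite real_normK ?num_real.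
have Dle : opnorm (h%:C *: D1 + (h ^+ 2)%:C *: D2) <= `|h| * K.
  apply: le_trans (opnormD _ _) _; rewrite mulrDr lerD ?opnormZr_le //.
  apply: le_trans (opnormZr_le _ _) _.
  rewrite ger0_norm ?sqr_ge0 // ler_wpM2r ?opnorm_ge0 // h2 expr2.
  by rewrite ler_piMl.
have M0 : 0 <= log_modulus rho * (c^-1) ^+ 2.
  rewrite mulr_ge0 ?sqr_ge0 // invr_ge0 !mulr_ge0 //; move: r1; lra.
have fr' := le_trans (fr _ _ _ _) (ler_wpM2l M0 (sq_le _ _ (opnorm_ge0 _) Dle)).
have {fr fr'} fr := fr' _ _ _ _.
have GD : rtau (resolvent y e * (h%:C *: D1 + (h ^+ 2)%:C *: D2)) =
    h * rtau (resolvent y e * D1) + h ^+ 2 * rtau (resolvent y e * D2).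
  by rewrite mulrDr -!scalerAr rtauD !rtauZ.
rewrite GD in fr.
have -> : forall a b : R, a - b - h * rtau (resolvent y e * D1) =
   (a - b - (h * rtau (resolvent y e * D1) + h ^+ 2 * rtau (resolvent y e * D2))) +
    h ^+ 2 * rtau (resolvent y e * D2) by move=> *; ring.
apply: le_trans (ler_normD _ _) _; rewrite mulrDl; apply: lerD; last first.
  by rewrite normrM ger0_norm ?sqr_ge0 // mulrC.
apply: le_trans (fr _ _ _ _) _.
- by rewrite /c -addrA lerD ?sq_le ?opnorm_ge0 // lerDl.
- by rewrite /c -addrA lerD ?sq_le ?opnorm_ge0.
- by apply: rho_le; lra.
- exact: rho_le.
- by rewrite exprMn h2 mulrCA mulrC.
Qed.

End PathDerivative.

(** * The Schwinger-Dyson equation for a free semicircular element *)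

Section Chebyshev.
Context {R : realType}.

(* Chebyshev polynomials of the second kind, rescaled so as to be orthogonal
   for the semicircle law of variance [v]. *)
Fixpoint cheb (v : R) (n : nat) : {poly R} :=
  match n with
  | 0 => 1
  | 1 => 'X
  | (m.+1 as n').+1 => 'X * cheb v n' - v *: cheb v m
  end.

Lemma chebSS v n : cheb v n.+2 = 'X * cheb v n.+1 - v *: cheb v n.
Proof. by []. Qed.

End Chebyshev.

Section GenStarSubalgebra.
Context {R : realType} {A : vonNeumannAlgebra R}.
Variable a : A.
Local Notation B := (gen_star_subalgebra a).

Lemma gen_id : B a.
Proof. by move=> C _. Qed.

Lemma gen1 : B 1.
Proof. by move=> C [C1 _ _ _]. Qed.

Lemma gen_lin (c : R[i]) x y : B x -> B y -> B (c *: x + y).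
Proof. by move=> Bx By C CC Ca; case: (CC) => _ + _ _; apply; [exact: Bx|exact: By]. Qed.

Lemma genM x y : B x -> B y -> B (x * y).
Proof. by move=> Bx By C CC Ca; case: (CC) => _ _ + _; apply; [exact: Bx|exact: By]. Qed.

Lemma gen_subZ (c : R[i]) x y : B x -> B y -> B (x - c *: y).
Proof. by move=> Bx By; rewrite -scaleNr addrC; apply: gen_lin. Qed.

End GenStarSubalgebra.

Definition cheb_eval {R : realType} {A : vonNeumannAlgebra R} (v : R) (s : A) (n : nat) : A :=
  rhorner s (cheb v n).

Section SchwingerDyson.
Context {R : realType} {A : tracialVNA R}.
Variables (x0 s : A) (v : R).
Hypothesis free : freely_independent x0 s.

Local Notation C := R[i].
Local Notation B := (gen_star_subalgebra x0).
Local Notation U := (cheb_eval v s).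

(** The semicircle law of [s] enters this section through these equations alone. *)
Hypothesis tauU : forall n, tau (U n.+1) = 0.

Lemma chebA0 : U 0%N = 1. Proof. exact: rhorner1. Qed.

Lemma chebA1 : U 1%N = s. Proof. exact: rhornerX. Qed.

Lemma rhornerM (x : A) p q : rhorner x (p * q) = rhorner x p * rhorner x q.
Proof. by rewrite /rhorner rmorphM /= (rmorphM (horner_alg x)). Qed.

Lemma mul_cheb n : s * U n.+1 = U n.+2 + v%:C *: U n.
Proof. by rewrite /cheb_eval chebSS rhornerB rhornerM rhornerX rhornerZ subrK. Qed.

Lemma cheb_gen n : gen_star_subalgebra s (U n).
Proof.
suff: gen_star_subalgebra s (U n) /\ gen_star_subalgebra s (U n.+1) by case.
elim: n => [|n [IH1 IH2]].
  by rewrite chebA0 chebA1; split; [exact: gen1|exact: gen_id].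
split=> //; rewrite /cheb_eval chebSS rhornerB rhornerM rhornerX rhornerZ.
by apply: gen_subZ => //; apply: genM => //; exact: gen_id.
Qed.

(* A letter [inl b] stands for [b] in the algebra of [x0], and [inr k] for the
   Chebyshev polynomial of degree [k + 1] in [s]. *)
Definition letter := (A + nat)%type.

Definition lval (a : letter) : A := match a with inl b => b | inr k => U k.+1 end.

Definition is_inl (a : letter) : bool := if a is inl _ then true else false.

Definition starts (c : bool) (l : seq letter) : bool :=
  if l is a :: _ then is_inl a == c else false.

(** Letters [inr k] carry no condition, their trace being 0 by [tauU]. *)
Definition centered (a : letter) : Prop :=
  match a with inl b => B b /\ tau b = 0 | inr _ => True end.

(** Reduced words of the free product: the two kinds of letters alternate and all letters have trace
    zero, so freeness applies as it stands. *)
Fixpoint normal (l : seq letter) : Prop :=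
  if l is a :: l' then [/\ centered a, ~~ starts (is_inl a) l' & normal l'] else True.

Definition lev (l : seq letter) : A := \prod_(a <- l) lval a.

Lemma lev_cons a l : lev (a :: l) = lval a * lev l.
Proof. exact: big_cons. Qed.

Lemma lev_cat l m : lev (l ++ m) = lev l * lev m.
Proof. exact: big_cat. Qed.

Lemma lev1 a : lev [:: a] = lval a.
Proof. exact: big_seq1. Qed.

Lemma tau_normal0 l : normal l -> l <> [::] -> tau (lev l) = 0.
Proof.
move=> nl l0; have := free (s := [seq (is_inl a, lval a) | a <- l]).
rewrite size_map big_map; apply=> //.
- by case: l l0 {nl}.
- elim: l nl {l0} => // a [//|b l] IH [_ ab nl] /=.
  by have /= -> := IH nl; rewrite andbT eq_sym.
- elim: l nl {l0} => // a l IH [ca _ nl] u; rewrite inE => /orP[/eqP -> /=|]; last exact: IH.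
  case: a ca => [b /= [Bb tb]|k _ /=]; first by [].
  by split; [exact: cheb_gen|exact: tauU].
Qed.

Lemma normal_catl l m : normal (l ++ m) -> normal l.
Proof.
elim: l => //= a l IH [ca sa nl]; split=> //; last exact: IH.
by case: l sa {IH nl}.
Qed.

Lemma normal_cat_inr l k m j : normal (l ++ inr k :: m) -> normal (l ++ [:: inr j]).
Proof.
elim: l => [//|a l IH] /= [ca sa nl]; split=> //; last exact: IH.
by case: l sa {IH nl}.
Qed.

(* [dU k p z] is [(tau (x) tau)((p (x) 1) D(U k) (1 (x) z))] for the free
   difference quotient [D], since [D(U k)] is the sum of the
   [U j (x) U (k - 1 - j)]. *)
Definition dU k (p z : A) : C := \sum_(j < k) tau (p * U j) * tau (U (k.-1 - j)%N * z).

(** The Leibniz rule read from left to right: [p] accumulates the letters already passed, which stay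
    to the left of the differentiated one. *)
Fixpoint dlev (l : seq letter) (p : A) : C :=
  match l with
  | [::] => 0
  | inl b :: l' => dlev l' (p * b)
  | inr k :: l' => dU k.+1 p (lev l') + dlev l' (p * U k.+1)
  end.

Lemma dU_linear k z (c : C) p q : dU k (c *: p + q) z = c * dU k p z + dU k q z.
Proof.
rewrite /dU big_distrr -big_split; apply: eq_bigr => j _ /=.
by rewrite mulrDl -scalerAl tauD tauZ mulrDl mulrA.
Qed.

Lemma dlev_linear l (c : C) p q : dlev l (c *: p + q) = c * dlev l p + dlev l q.
Proof.
elim: l p q => [|[b|k] l IH] p q /=; first by rewrite mulr0 addr0.
  by rewrite mulrDl -scalerAl IH.
by rewrite dU_linear mulrDl -scalerAl IH mulrDr addrACA.
Qed.

(** The derivation [D] applied to both sides of [s U_(k+1) = U_(k+2) + v U_k]. *)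
Lemma dU_rec k p z :
  tau p * tau (U k.+1 * z) + dU k.+1 (p * s) z = dU k.+2 p z + v%:C * dU k p z.
Proof.
rewrite {1}/dU big_ord_recl /= chebA0 mulr1 subn0.
rewrite [dU k.+2 p z]/dU 2!big_ord_recl /= chebA0 mulr1 subn0 chebA1.
rewrite -!addrA; congr (_ + _).
rewrite /bump /= add1n subn1 /=; congr (_ + _).
rewrite /dU big_distrr -big_split; apply: eq_bigr => j _ /=.
rewrite /bump /= !add1n subSS.
rewrite -[p * s * _]mulrA mul_cheb mulrDr -scalerAr tauD tauZ mulrDl mulrA.
by congr (_ + _); rewrite subnS -!subn1 subnAC.
Qed.

(* Pairs [(w, f)] where [w] is a combination of normal words and
   [f p = (tau (x) tau)((p (x) 1) D w)] is computed formally on these words, [D]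
   being a priori well defined on words only. *)
Inductive nspan : A -> (A -> C) -> Prop :=
  | nspan0 : nspan 0 (fun=> 0)
  | nspanS c l w f : normal l -> nspan w f ->
      nspan (c *: lev l + w) (fun p => c * dlev l p + f p).

Lemma nspan_ext w w' f f' : nspan w f -> w = w' -> f =1 f' -> nspan w' f'.
Proof. by move=> + <- /funext <-. Qed.

Lemma nspan_lin (c : C) w w' f f' : nspan w f -> nspan w' f' ->
  nspan (c *: w + w') (fun p => c * f p + f' p).
Proof.
move=> ns ns'; elim: ns => [|d l z g nl _ IH].
  by apply: (nspan_ext ns') => [|p]; rewrite ?scaler0 ?mulr0 add0r.
apply: (nspan_ext (nspanS (c * d) nl IH)) => [|p].
  by rewrite scalerDr scalerA addrA.
by rewrite mulrDr mulrA addrA.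
Qed.

Lemma nspan_linear w f (c : C) p q : nspan w f -> f (c *: p + q) = c * f p + f q.
Proof.
elim=> [|d l z g _ _ IH]; first by rewrite mulr0 addr0.
by rewrite dlev_linear IH; ring.
Qed.

Lemma nspan_normal l : normal l -> nspan (lev l) (dlev l).
Proof.
move=> nl; apply: (nspan_ext (nspanS 1 nl nspan0)) => [|p].
  by rewrite scale1r addr0.
by rewrite mul1r addr0.
Qed.

(** On a normal word [w], a term of [D w] with left factor other than 1 is killed by its left trace.
    If [w] starts with [U_(k+1)], the surviving term is [1 (x) U_k] times the rest, which matches
    [s U_(k+1) = U_(k+2) + v U_k] since the word starting with [U_(k+2)] is normal. Otherwise [s w]
    is normal and both sides vanish. *)
Lemma nspan_tau w f : nspan w f -> tau (s * w) = v%:C * f 1.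
Proof.
have dU0 pre k l : normal (pre ++ inr k :: l) -> pre <> [::] ->
    forall m z, dU m (lev pre) z = 0.
  move=> np pre0 m z; rewrite /dU big1 // => -[[|j] jm] _ /=.
    by rewrite chebA0 mulr1 tau_normal0 ?mul0r //; exact: normal_catl np.
  have nj := normal_cat_inr j np.
  have -> : lev pre * U j.+1 = lev (pre ++ [:: inr j]).
    by rewrite lev_cat lev1.
  rewrite tau_normal0 ?mul0r //; by case: (pre).
have dlev0 pre l : normal (pre ++ l) -> pre <> [::] -> dlev l (lev pre) = 0.
  elim: l pre => //= a l IH pre np pre0.
  have := IH (pre ++ [:: a]); rewrite -catA /= => /(_ np).
  have pa0 : pre ++ [:: a] <> [::] by case: (pre).
  rewrite lev_cat lev1; move=> /(_ pa0); case: a np {pa0} => [//|k] np /= ->.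
  by rewrite (dU0 _ _ _ np) // addr0.
elim=> [|c l z g nl _ IH]; first by rewrite !mulr0 tau0.
rewrite mulrDr -scalerAr tauD tauZ IH mulrDr mulrCA; congr (_ * _ + _).
case: l nl => [|[b|k] l] nl.
- by rewrite /lev big_nil mulr1 /= mulr0 -chebA1 tauU.
- have ns : normal (inr 0%N :: inl b :: l) by [].
  have -> : s * lev (inl b :: l) = lev (inr 0%N :: inl b :: l).
    by rewrite [in RHS]lev_cons -chebA1.
  rewrite tau_normal0 // /= mul1r.
  by have := dlev0 [:: inl b] l nl; rewrite lev1 /= => ->; rewrite ?mulr0.
- case: (nl) => _ sl nl'.
  have tauUl m : tau (U m.+1 * lev l) = 0.
    have nm : normal (inr m :: l) by [].
    by have := tau_normal0 nm; rewrite lev_cons; apply.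
  rewrite lev_cons mulrA /= mul_cheb mulrDl -scalerAl tauD tauZ tauUl add0r.
  have := dlev0 [:: inr k] l nl; rewrite lev1 /= mul1r => -> //; rewrite addr0.
  congr (_ * _); rewrite /dU big_ord_recl /= mul1r chebA0 tau1 mul1r subn0 big1 ?addr0 // => j _.
  by rewrite mul1r /bump /= add1n tauU mul0r.
Qed.

(* [d p z] plays the role of [(tau (x) tau)((p (x) 1) D w (1 (x) z))]. *)
Definition SDpair (w : A) (d : A -> A -> C) : Prop := forall z f, nspan z f ->
  nspan (w * z) (fun p => d p z + f (p * w)).

Lemma SDpair_tau w d : SDpair w d -> tau (s * w) = v%:C * d 1 1.
Proof.
move=> wd; have := wd _ _ (@nspan_normal [::] I) => /nspan_tau.
by rewrite /lev big_nil mulr1 /= addr0.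
Qed.

Lemma SDpair_ext w w' d d' : SDpair w d -> w = w' -> (forall p z, d p z = d' p z) ->
  SDpair w' d'.
Proof.
move=> wd <- dd z f zf; apply: nspan_ext (wd z f zf) _ _ => // p.
by rewrite dd.
Qed.

Lemma SDpair_lin c w w' d d' : SDpair w d -> SDpair w' d' ->
  SDpair (c *: w + w') (fun p z => c * d p z + d' p z).
Proof.
move=> wd wd' z f zf; apply: nspan_ext (nspan_lin c (wd z f zf) (wd' z f zf)) _ _ => [|p].
  by rewrite mulrDl scalerAl.
have -> : p * (c *: w + w') = c *: (p * w) + p * w' by rewrite mulrDr -scalerAr.
by rewrite (nspan_linear _ _ _ zf); ring.
Qed.

(* The Leibniz rule for [D]. *)
Lemma SDpairM w w' d d' : SDpair w d -> SDpair w' d' ->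
  SDpair (w * w') (fun p z => d p (w' * z) + d' (p * w) z).
Proof.
move=> wd wd' z f zf; apply: nspan_ext (wd _ _ (wd' _ _ zf)) _ _ => [|p].
  exact: mulrA.
by rewrite -addrA mulrA.
Qed.

(** Elements of the algebra of [x0] have zero difference quotient in [s]. Left multiplication by [b]
    stays in the span of normal words: [b] merges with a leading letter from the same algebra, and
    is then split into its centered part and its trace. *)
Lemma SDpair_gen b : B b -> SDpair b (fun _ _ => 0).
Proof.
move=> Bb z f; elim=> [|c l w g nl _ IH].
  by apply: (nspan_ext nspan0) => [|p]; rewrite ?mulr0 ?addr0.
have key b' l' : B b' -> ~~ starts true l' -> normal l' ->
    nspan (b' * lev l') (fun p => dlev l' (p * b')).
  move=> Bb' sl nl'; pose t := tau b'.
  have nb : normal (inl (b' - t *: 1) :: l').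
    by split=> //=; split; [apply: gen_subZ => //; exact: gen1|rewrite tauB tauZ tau1 mulr1 subrr].
  apply: (nspan_ext (nspan_lin t (nspan_normal nl') (nspan_normal nb))) => [|p].
    by rewrite lev_cons /= mulrBl -scalerAl mul1r addrC subrK.
  by rewrite /= -dlev_linear mulrBr -scalerAr mulr1 addrC subrK.
have bl : nspan (b * lev l) (fun p => dlev l (p * b)).
  case: l nl => [|[b'|k] l] nl; [exact: key| |exact: key].
  case: nl => -[/= Bb' _] sl nl.
  apply: (nspan_ext (key (b * b') l _ sl nl)) => [||p].
  - exact: genM.
  - by rewrite lev_cons mulrA.
  - by rewrite /= mulrA.
apply: (nspan_ext (nspan_lin c bl IH)) => [|p].
  by rewrite mulrDr -scalerAr.
by rewrite !add0r.
Qed.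

Lemma SDpair1 : SDpair 1 (fun _ _ => 0).
Proof. by have := SDpair_gen (@gen1 R A x0). Qed.

(** [D s = 1 (x) 1]. Before a word not starting in [s], the factor [s = U_1] is a new letter; before
    [U_(k+1)] the three-term recursion rewrites the product, and [dU_rec] is the corresponding
    identity for [D]. *)
Lemma SDpair_s : SDpair s (fun p z => tau p * tau z).
Proof.
move=> z f; elim=> [|c l w g nl _ IH].
  by apply: (nspan_ext nspan0) => [|p]; rewrite ?mulr0 ?addr0 // tau0 mulr0.
have sl : nspan (s * lev l) (fun p => tau p * tau (lev l) + dlev l (p * s)).
  have [sl|] := boolP (starts false l); last first.
    move=> sl; have ns : normal (inr 0%N :: l) by [].
    apply: (nspan_ext (nspan_normal ns)) => [|p].
      by rewrite lev_cons /= chebA1.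
    by rewrite /= /dU big_ord_recl big_ord0 /= chebA0 mulr1 mul1r addr0 chebA1.
  case: l nl sl => [//|[//|k] l] nl _; case: (nl) => _ sl nl'.
  have n2 : normal (inr k.+1 :: l) by [].
  have nk : nspan (U k * lev l) (fun p => dU k p (lev l) + dlev l (p * U k)).
    (* For [k = 0], [U_0 = 1] is not a letter and the word loses its first letter. *)
    case: k nl {n2} sl => [|k] nl sl.
      apply: (nspan_ext (nspan_normal nl')) => [|p].
        by rewrite chebA0 mul1r.
      by rewrite chebA0 mulr1 /dU big_ord0 add0r.
    have nk' : normal (inr k :: l) by [].
    by apply: (nspan_ext (nspan_normal nk')) => [|p] //; rewrite lev_cons.
  apply: (nspan_ext (nspan_lin v%:C nk (nspan_normal n2))) => [|p].
    by rewrite !lev_cons mulrA [s * _]mul_cheb mulrDl -scalerAl addrC.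
  rewrite lev_cons [RHS]/= [RHS]addrA dU_rec -(mulrA p s) mul_cheb.
  have -> : p * (U k.+2 + v%:C *: U k) = v%:C *: (p * U k) + p * U k.+2.
    by rewrite mulrDr -scalerAr addrC.
  by rewrite dlev_linear /=; ring.
apply: (nspan_ext (nspan_lin c sl IH)) => [|p].
  by rewrite mulrDr -scalerAr.
by rewrite tauD tauZ !mulrDr; ring.
Qed.

End SchwingerDyson.

(** * Moments of the semicircle law *)

Section ChebyshevODE.
Context {R : realType}.
Variable v : R.

Local Notation U := (cheb v).
Local Notation W := ('X ^+ 2 - (4 * v)%:P : {poly R}).

Lemma deriv_chebSS n : (U n.+2)^`() = U n.+1 + 'X * (U n.+1)^`() - v%:P * (U n)^`().
Proof. by rewrite chebSS derivB derivM derivX derivZ mul1r mul_polyC. Qed.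

Lemma chebSS_polyC n : U n.+2 = 'X * U n.+1 - v%:P * U n.
Proof. by rewrite chebSS mul_polyC. Qed.

Lemma cheb_deriv_rec n :
  W * (U n)^`() = 2 * n.+1%:R * U n.+1 - n.+2%:R * 'X * U n /\
  W * (U n.+1)^`() = n.+1%:R * 'X * U n.+1 - 2 * n.+2%:R * v%:P * U n.
Proof.
have E4 : (4 * v)%:P = 4 * v%:P :> {poly R} by rewrite polyCM polyC_natr.
elim: n => [|n [IH1 IH2]].
  rewrite /= derivX (_ : (1 : {poly R}) = 1%:P) // derivC mulr0 !mulr1.
  by split; rewrite ?E4; ring.
split.
  rewrite IH2 chebSS_polyC -!natr1; ring.
rewrite deriv_chebSS mulrBr mulrDr [W * ('X * _)]mulrCA [W * (v%:P * _)]mulrCA IH1 IH2.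
by rewrite chebSS_polyC E4 -!natr1; ring.
Qed.

(** The Chebyshev differential equation. With [w = 4 v - x^2] it says that [w^(3/2) U_n'] has
    derivative [- n (n + 2) w^(1/2) U_n], which is the form used for integration. *)
Lemma cheb_ode n :
  W * (U n)^`()^`() + 3 * 'X * (U n)^`() = (n * n.+2)%:R * U n.
Proof.
suff: W * (U n)^`()^`() + 3 * 'X * (U n)^`() = (n * n.+2)%:R * U n /\
  W * (U n.+1)^`()^`() + 3 * 'X * (U n.+1)^`() = (n.+1 * n.+3)%:R * U n.+1 by case.
elim: n => [|n [IH1 IH2]].
  rewrite /= derivX (_ : (1 : {poly R}) = 1%:P) // !derivC.
  by split; ring.
split=> //; have [_ P] := cheb_deriv_rec n.
have dd : (U n.+2)^`()^`() = 2 * (U n.+1)^`() + 'X * (U n.+1)^`()^`() - v%:P * (U n)^`()^`().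
  rewrite deriv_chebSS derivB derivD !derivM derivX derivC; ring.
rewrite dd deriv_chebSS chebSS_polyC.
have -> : W * (2 * (U n.+1)^`() + 'X * (U n.+1)^`()^`() - v%:P * (U n)^`()^`()) +
   3 * 'X * (U n.+1 + 'X * (U n.+1)^`() - v%:P * (U n)^`()) =
   2 * (W * (U n.+1)^`()) + 'X * (W * (U n.+1)^`()^`() + 3 * 'X * (U n.+1)^`())
   - v%:P * (W * (U n)^`()^`() + 3 * 'X * (U n)^`()) + 3 * 'X * U n.+1 by ring.
by rewrite P IH1 IH2 !natrM -!natr1; ring.
Qed.

Lemma cheb_ode_horner n (x : R) :
  (x ^+ 2 - 4 * v) * (U n)^`()^`().[x] + 3 * x * (U n)^`().[x] = (n * n.+2)%:R * (U n).[x].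
Proof.
have := congr1 (fun p : {poly R} => p.[x]) (cheb_ode n).
move: (U n) => p; move: (n * n.+2)%N => m.
rewrite -(polyC_natr _ 3) -(polyC_natr _ m) hornerD !hornerM hornerD hornerN hornerXn.
by rewrite !hornerC hornerX.
Qed.

End ChebyshevODE.

Section SemicircleMoments.
Context {R : realType}.
Local Notation leb := (@lebesgue_measure R).

(** The density is known only through the values of [mu] on measurable sets, so the integral is
    transported by the Radon-Nikodym derivative, which agrees with [f] almost everywhere.
    Restriction to a segment makes continuous functions integrable. *)
Lemma density_integral (mu : probability (measurableTypeR R) R) (f g : R -> R) (a b : R) :
  continuous f -> continuous g ->
  (forall E : set (measurableTypeR R), measurable E ->
     mu E = (\int[leb]_(x in E) (f x)%:E)%E) ->
  mu (~` `[a, b]%classic) = 0%E ->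
  (\int[mu]_x g x)%R = (\int[leb]_(x in `[a, b]) (g x * f x))%R.
Proof.
move=> cf cg muE mu0.
have mf : measurable_fun (setT : set (measurableTypeR R)) f by exact: continuous_measurable_fun.
have mg : measurable_fun (setT : set (measurableTypeR R)) g by exact: continuous_measurable_fun.
have mI : measurable (`[a, b]%classic : set (measurableTypeR R)) by exact: measurable_itv.
have mCI := measurableC mI.
have intI h : continuous h -> leb.-integrable `[a, b] (EFin \o h).
  move=> ch; apply: continuous_compact_integrable; first exact: segment_compact.
  exact: continuous_subspaceT.
have gI : mu.-integrable `[a, b] (EFin \o g).
  apply: measurable_bounded_integrable => //.
  - by apply: le_lt_trans (probability_le1 _ _) _; rewrite ?ltry.
  - exact: measurable_funTS.
  - have cgI : {within `[a, b], continuous g} by exact: continuous_subspaceT.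
    have /compact_bounded[M [_ mrt]] := continuous_compact cgI (@segment_compact R a b).
    by exists M; split; rewrite ?num_real // => ? ? ? ?; exact: mrt.
have dom : mu `<< leb.
  apply/null_content_dominatesP => A mA A0; rewrite muE //.
  by apply: null_set_integral => //; apply/measurable_EFinP; exact: measurable_funTS.
rewrite /Rintegral; congr fine.
have giT : mu.-integrable setT (EFin \o g).
  have mgE : measurable_fun setT (EFin \o g) by exact/measurable_EFinP.
  apply/(negligible_integrable mCI measurableT mgE mu0).
  by rewrite setTD setCK.
rewrite (negligible_integral mCI measurableT giT mu0) setTD setCK.
rewrite -(Radon_Nikodym_change_of_variables dom mI gI).
apply: ae_eq_integral => //.
- apply: emeasurable_funM => //.
    by apply/measurable_EFinP; exact: measurable_funTS.
  exact: measurable_funTS.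
- by apply/measurable_EFinP; apply: measurable_funM; exact: measurable_funTS.
- have dfE : ae_eq leb `[a, b]%classic (Radon_Nikodym (charge_of_finite_measure mu) leb) (EFin \o f).
    apply: integral_ae_eq => //.
    + apply: integrableS (Radon_Nikodym_integrable _) => //.
    + by apply/measurable_EFinP; exact: measurable_funTS.
    + by move=> E EI mE; rewrite -Radon_Nikodym_integral //= muE.
  apply: filterS dfE => x /= dfE xI; rewrite dfE // EFinM.
Qed.

Variable v : R.
Hypothesis v0 : 0 < v.

Local Notation c := (2 * Num.sqrt v).
Local Notation pdf := (semicircle_pdf v).

Let c0 : 0 < c. Proof. by rewrite mulr_gt0 // sqrtr_gt0. Qed.

Let cc : c ^+ 2 = 4 * v.
Proof. by rewrite exprMn sqr_sqrtr ?ltW // expr2 -natrM. Qed.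

Lemma continuous_semicircle_pdf : continuous pdf.
Proof.
move=> x; rewrite /semicircle_pdf; apply: cvgMl.
apply: (@continuous_comp _ _ _ (fun r : R => 4 * v - r ^+ 2) Num.sqrt).
  apply: cvgB; first exact: cvg_cst.
  by rewrite expr2; under eq_fun do rewrite expr2; apply: cvgM; exact: cvg_id.
exact: sqrt_continuous.
Qed.

Definition semicircle_moment (q : {poly R}) : R :=
  (\int[leb]_(x in `[(- c), c]) (q.[x] * pdf x))%R.

Lemma semicircle_integrable (q : {poly R}) :
  leb.-integrable `[(- c), c]%classic (EFin \o (fun x => q.[x] * pdf x)).
Proof.
apply: continuous_compact_integrable; first exact: segment_compact.
apply: continuous_subspaceT => x; apply: cvgM; first exact: continuous_horner.
exact: continuous_semicircle_pdf.
Qed.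

Lemma semicircle_momentD p q :
  semicircle_moment (p + q) = semicircle_moment p + semicircle_moment q.
Proof.
rewrite /semicircle_moment -RintegralD //; last 2 first.
- exact: semicircle_integrable.
- exact: semicircle_integrable.
apply: eq_Rintegral => x _. by rewrite hornerD mulrDl.
Qed.

Lemma semicircle_momentZ k p : semicircle_moment (k *: p) = k * semicircle_moment p.
Proof.
rewrite /semicircle_moment -RintegralZl //; last exact: semicircle_integrable.
by apply: eq_Rintegral => x _; rewrite hornerZ -mulrA.
Qed.

(** By the differential equation, the integrand is up to a nonzero constant the derivative of
    [w^(3/2) U'], where [w = 4 v - x^2] vanishes at both ends. *)
Lemma semicircle_moment_cheb n : semicircle_moment (cheb v n.+1) = 0.
Proof.
pose q := (cheb v n.+1)^`().
pose w (x : R) : R := 4 * v - x ^+ 2.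
pose F (x : R) : R := w x * Num.sqrt (w x) * q.[x].
(* The eigenvalue of the differential equation at degree [n + 1], times the normalization of the
   density. *)
pose k : R := - (n.+1 * n.+3)%:R * (2 * pi * v).
have k0 : k != 0.
  by rewrite mulf_neq0 // ?oppr_eq0 ?pnatr_eq0 // !mulf_neq0 ?gt_eqF ?pi_gt0.
have dw (x : R) : is_derive x 1 w (- (2 * x)).
  have -> : w = horner ((4 * v)%:P - 'X^2).
    by apply/funext => r; rewrite hornerD hornerN hornerC hornerXn.
  apply: (is_derive_eq (is_derive_poly _ x)).
  by rewrite derivB derivC derivXn sub0r hornerN hornerMn hornerX -mulr_natl.
have wF x : x \in `](- c), c[ -> 0 < w x.
  rewrite in_itv /= -ltr_norml => xc; rewrite /w -cc subr_gt0.
  by rewrite -[x ^+ 2]real_normK ?num_real // ltr_sqr ?nnegrE ?(ltW c0).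
have dF x : x \in `](- c), c[ ->
    is_derive x 1 F (k * ((cheb v n.+1).[x] * pdf x)).
  move=> /wF wx.
  have d1 : is_derive x 1 (fun x => Num.sqrt (w x)) ((2 * Num.sqrt (w x))^-1 * - (2 * x)).
    by apply: (@is_derive1_comp _ Num.sqrt w); exact: is_derive1_sqrt.
  have d3 := is_deriveM (is_deriveM (dw x) d1) (is_derive_poly q x).
  apply: (is_derive_eq d3).
  have := cheb_ode_horner v n.+1 x; rewrite -/q.
  have -> : x ^+ 2 - 4 * v = - Num.sqrt (w x) ^+ 2.
    by rewrite sqr_sqrtr ?(ltW wx) // opprB.
  rewrite /k /semicircle_pdf -/(w x) /= => ode.
  have s0 : Num.sqrt (w x) != 0 by rewrite gt_eqF // sqrtr_gt0.
  have pv0 : 2 * pi * v != 0 by rewrite !mulf_neq0 ?gt_eqF ?pi_gt0.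
  move: (cheb v n.+1).[x] ode => u ode.
  have wE : w x = Num.sqrt (w x) ^+ 2 by rewrite sqr_sqrtr // ltW.
  rewrite -[LHS]/(w x * Num.sqrt (w x) * q^`().[x] +
    q.[x] * (w x * ((2 * Num.sqrt (w x))^-1 * - (2 * x)) + Num.sqrt (w x) * - (2 * x))).
  rewrite {1 3}wE; move: (2 * pi * v) pv0 (Num.sqrt (w x)) s0 ode => P P0 r r0 ode.
  have -> : - (n.+1 * n.+3)%:R * P * (u * (r / P)) = - ((n.+1 * n.+3)%:R * u) * r.
    by field.
  by rewrite -ode; field.
have : (\int[leb]_(x in `[(- c), c]) (k * ((cheb v n.+1).[x] * pdf x)))%R = 0.
  rewrite /Rintegral (@continuous_FTC2 _ _ F).
  - rewrite /F /w cc sqrrN cc subrr !mul0r.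
    by rewrite subee.
  - by rewrite gtrN.
  - apply: continuous_subspaceT => x; apply: cvgMr.
    apply: cvgM; first exact: continuous_horner.
    exact: continuous_semicircle_pdf.
  (* The square root is differentiated in the open interval only; at the ends continuity is
     enough. *)
  - have cF : continuous F.
      have cw : continuous w.
        by move=> x; have [/derivable1_diffP/differentiable_continuous] := dw x.
      move=> x; apply: cvgM; last exact: continuous_horner.
      apply: cvgM; first exact: cw.
      by apply: continuous_comp; [exact: cw|exact: sqrt_continuous].
    split; [|exact/cvg_at_right_filter/cF|exact/cvg_at_left_filter/cF].
    by move=> x xI; have [] := dF x xI.
  - by move=> x xI; rewrite derive1E; have [_ ->] := dF x xI.
rewrite RintegralZl //; last exact: semicircle_integrable.
by move=> /eqP; rewrite mulf_eq0 (negbTE k0) => /eqP.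
Qed.

End SemicircleMoments.

Section SemicircularElement.
Context {R : realType} {A : tracialVNA R}.

Lemma tau_semicircular (v : R) (s : A) (q : {poly R}) : 0 < v -> semicircular v s ->
  tau (rhorner s q) = (semicircle_moment v q)%:C.
Proof.
move=> v0 [mu [ss _ mom] muE].
have mu0 : mu (~` `[- (2 * Num.sqrt v), 2 * Num.sqrt v]%classic) = 0%E.
  rewrite muE; last by apply: measurableC; exact: measurable_itv.
  rewrite (eq_integral (fun=> 0%E)) ?integral0 // => x.
  rewrite inE /= in_itv /= -ler_norml => /negP; rewrite -ltNge => cx.
  (* Outside the segment the density is 0 because the square root of a negative real is 0. *)
  rewrite /semicircle_pdf ler0_sqrtr ?mul0r // subr_le0.
  rewrite -[x ^+ 2]real_normK ?num_real // -[v]sqr_sqrtr ?(ltW v0) //.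
  rewrite (_ : 4 * _ = (2 * Num.sqrt v) ^+ 2); last by ring.
  by rewrite ler_sqr ?nnegrE ?mulr_ge0 ?sqrtr_ge0 // ltW.
have H n : tau (s ^+ n) = (semicircle_moment v 'X^n)%:C.
  rewrite mom (density_integral (@continuous_semicircle_pdf R v) _ muE mu0).
    by congr (_%:C); apply: eq_Rintegral => x _; rewrite hornerXn.
  by move=> x; apply: exprn_continuous.
have m0 : semicircle_moment v 0 = 0.
  by rewrite -(scale0r 0) semicircle_momentZ // mul0r.
rewrite -[q]coefK poly_def rhorner_sum.
rewrite (big_morph _ (semicircle_momentD v) m0) (big_morph _ (@tauD R A) (@tau0 R A)).
rewrite rmorph_sum; apply: eq_bigr => k _.
by rewrite rhornerZ rhornerXn rhornerX tauZ H -rmorphM semicircle_momentZ.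
Qed.

Lemma tau_cheb_eval (v : R) (s : A) n : 0 < v -> semicircular v s ->
  tau (cheb_eval v s n.+1) = 0.
Proof.
by move=> v0 sv; rewrite /cheb_eval (tau_semicircular _ v0 sv) semicircle_moment_cheb.
Qed.

End SemicircularElement.

(** * Joint moments *)

Section Words.
Context {R : realType} {A : tracialVNA R}.
Variable x0 : A.

Definition word (u : A) (l : seq bool) : A := \prod_(b <- l) (if b then u else x0).

Lemma word_cons u b l : word u (b :: l) = (if b then u else x0) * word u l.
Proof. exact: big_cons. Qed.

Lemma word_cat u l m : word u (l ++ m) = word u l * word u m.
Proof. exact: big_cat. Qed.

Lemma word1 u b : word u [:: b] = if b then u else x0.
Proof. exact: big_seq1. Qed.

(** The free difference quotient of a word in [u], both tensor factors being traced: one term per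
    occurrence of [u], with [p] collecting the letters to its left. *)
Fixpoint dword (u : A) (l : seq bool) (p z : A) : R[i] :=
  match l with
  | [::] => 0
  | b :: l' => (if b then tau p * tau (word u l' * z) else 0) +
               dword u l' (p * (if b then u else x0)) z
  end.

Definition word_SD (u : A) (T : R) : Prop :=
  forall l, tau (word u (true :: l)) = T%:C * dword u l 1 1.

(* The Schwinger-Dyson equations determine all joint moments, by recursion on
   the number of occurrences of [u]. *)
Lemma word_SD_moments (u u' : A) (T : R) l :
  word_SD u T -> word_SD u' T -> tau (word u l) = tau (word u' l).
Proof.
move=> su su'.
have dE m : (forall k, (count id k <= m)%N -> tau (word u k) = tau (word u' k)) ->
    forall k pre, (count id (pre ++ k) <= m)%N ->
    dword u k (word u pre) 1 = dword u' k (word u' pre) 1.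
  move=> mE; elim=> [//|b k IH] pre /=; rewrite count_cat /= => km.
  congr (_ + _); last first.
    have := IH (pre ++ [:: b]); rewrite !word_cat !word1; apply.
    by rewrite -catA count_cat.
  case: b km => // km; rewrite !mulr1 !mE //.
    by apply: leq_trans km; rewrite addnA leq_addl.
  by apply: leq_trans km; rewrite leq_addr.
suff H m k : (count id k <= m)%N -> tau (word u k) = tau (word u' k) by exact: (H _ _ (leqnn _)).
elim: m k => [|m IH] k km.
  congr (tau _); apply: eq_big_seq => b bk; case: b bk => // bk.
  move: km; rewrite leqn0 -leqn0 leqNgt -has_count; move/negP; case.
  by apply/hasP; exists true.
have [tk|tk] := boolP (true \in k); last first.
  by apply: IH; rewrite leqNgt -leqNgt (_ : count id k = 0%N) //; apply/eqP;
     rewrite -leqn0 leqNgt -has_count; apply/hasPn => -[] // /(negP tk).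
(* Traciality rotates an occurrence of [u] to the front; the equation then leaves only words with
   fewer occurrences. *)
case/splitPr: tk km => k1 k2 km.
have rot w : tau (word w (k1 ++ true :: k2)) = tau (word w (true :: (k2 ++ k1))).
  by rewrite -cat_cons !word_cat tau_tracial.
rewrite !rot su su'; congr (_ * _); have := dE m IH (k2 ++ k1) [::].
rewrite /word !big_nil; apply; move: km; rewrite /= !count_cat /=.
by rewrite add1n addnS ltnS addnC.
Qed.

Section Transfer.
Variables (u u' : A).
Hypothesis uu' : forall l, tau (word u l) = tau (word u' l).

(** The values of one noncommutative polynomial at [(x0, u)] and [(x0, u')]. This is a relation
    because a polynomial cannot be read off from its value. *)
Inductive word_span : A -> A -> Prop :=
  | word_span0 : word_span 0 0
  | word_spanS c l w w' : word_span w w' ->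
      word_span (c *: word u l + w) (c *: word u' l + w').

Lemma word_span_tau w w' : word_span w w' -> tau w = tau w'.
Proof. by elim=> // c l z z' _ IH; rewrite !tauD !tauZ IH uu'. Qed.

Lemma word_span_lin c w w' z z' : word_span w w' -> word_span z z' ->
  word_span (c *: w + z) (c *: w' + z').
Proof.
move=> ws zs; elim: ws => [|d l a a' _ IH]; first by rewrite !scaler0 !add0r.
rewrite !scalerDr !scalerA -!addrA; exact: word_spanS.
Qed.

(** Stated as an action by left multiplication, so that closure under products is immediate. *)
Definition word_rel (w w' : A) : Prop :=
  forall z z', word_span z z' -> word_span (w * z) (w' * z').

Lemma word_rel_letter b : word_rel (if b then u else x0) (if b then u' else x0).
Proof.
move=> z z'; elim=> [|c l a a' _ IH]; first by rewrite !mulr0; exact: word_span0.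
rewrite !mulrDr -!scalerAr; have := word_spanS c (b :: l) IH.
by rewrite !word_cons.
Qed.

Lemma word_rel_lin c w w' z z' : word_rel w w' -> word_rel z z' ->
  word_rel (c *: w + z) (c *: w' + z').
Proof.
move=> ww zz a a' aa; rewrite !mulrDl -!scalerAl.
by apply: word_span_lin; [exact: ww|exact: zz].
Qed.

Lemma word_rel1 : word_rel 1 1.
Proof. by move=> z z' zz; rewrite !mul1r. Qed.

Lemma word_relM w w' z z' : word_rel w w' -> word_rel z z' -> word_rel (w * z) (w' * z').
Proof. by move=> ww zz a a' aa; rewrite -!mulrA; apply/ww/zz. Qed.

Lemma word_relX w w' n : word_rel w w' -> word_rel (w ^+ n) (w' ^+ n).
Proof.
move=> ww; elim: n => [|n IH]; first by rewrite !expr0; exact: word_rel1.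
by rewrite !exprS; exact: word_relM.
Qed.

Lemma word_rel_tau w w' : word_rel w w' -> tau w = tau w'.
Proof.
move=> ww; apply: word_span_tau; rewrite -[w]mulr1 -[w']mulr1; apply: ww.
have := word_spanS 1 [::] word_span0.
by rewrite /word !big_nil !scale1r !addr0.
Qed.

End Transfer.

Definition shifted (u : A) (lambda : R[i]) : A := x0 + (0 +i* 1) *: u - lambda%:A.

(** The trace of the logarithm depends only on the moments of a contraction, which is a polynomial
    in [x0] and [u]: self-adjointness makes the adjoint of the shifted element one too. *)
Lemma rtau_log_transfer (u u' : A) (lambda : R[i]) (e : R) :
  selfadjoint x0 -> selfadjoint u -> selfadjoint u' -> 0 < e ->
  (forall l, tau (word u l) = tau (word u' l)) ->
  rtau (op_log (shifted_sq (shifted u lambda) e)) =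
  rtau (op_log (shifted_sq (shifted u' lambda) e)).
Proof.
move=> sx su su' e0 uu.
have starE w : selfadjoint w ->
    star (shifted w lambda) = (0 +i* 1)^*%C *: w + ((- lambda^*%C) *: 1 + x0).
  move=> sw; rewrite /shifted starB starD !starZ star1 (sx : star x0 = x0) (sw : star w = w).
  by rewrite scaleNr; ncring.
have shE w : shifted w lambda = (0 +i* 1) *: w + ((- lambda) *: 1 + x0).
  by rewrite /shifted scaleNr; ncring.
have rx : word_rel u u' x0 x0 := @word_rel_letter u u' false.
have ru : word_rel u u' u u' := @word_rel_letter u u' true.
have ry : word_rel u u' (shifted u lambda) (shifted u' lambda).
  by rewrite !shE; do 2!apply: word_rel_lin => //; exact: word_rel1.
have rys : word_rel u u' (star (shifted u lambda)) (star (shifted u' lambda)).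
  by rewrite !starE //; do 2!apply: word_rel_lin => //; exact: word_rel1.
set y := shifted u lambda in ry rys *; set y' := shifted u' lambda in ry rys *.
pose c := opnorm y ^+ 2 + opnorm y' ^+ 2 + e.
have c0 : 0 < c by rewrite ltr_wpDl // addr_ge0 ?sqr_ge0.
apply: (rtau_op_log_eq (c := c) (rho := Num.sqrt (1 - e / c))) => //.
- exact: star_shifted_sq.
- exact: star_shifted_sq.
- exact: sqrt_contraction_lt1.
- by apply: opnorm_contraction => //; rewrite /c lerD2r lerDl sqr_ge0.
- by apply: opnorm_contraction => //; rewrite /c lerD2r lerDr sqr_ge0.
move=> k; apply: (word_rel_tau uu); apply: word_relX.
rewrite /contraction addrC [in X in word_rel _ _ _ X]addrC -!scaleNr.
apply: word_rel_lin; last exact: word_rel1.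
rewrite !shifted_sqE addrC [in X in word_rel _ _ _ X]addrC.
by apply: word_rel_lin; [exact: word_rel1|exact: word_relM].
Qed.

End Words.

(** * The Schwinger-Dyson equation for resolvents *)

Section WordSchwingerDyson.
Context {R : realType} {A : tracialVNA R}.

(** Each letter [u = k s] has difference quotient [k (1 (x) 1)] in [s], and the leading letter
    contributes the second factor [k]. *)
Lemma semicircular_word_SD (x0 s : A) (v k : R) : 0 < v -> semicircular v s ->
  freely_independent x0 s -> word_SD x0 (k%:C *: s) (k ^+ 2 * v).
Proof.
move=> v0 sv fr; have tU n := tau_cheb_eval n v0 sv.
set u := k%:C *: s.
have ru : SDpair x0 s v u (fun p z => k%:C * (tau p * tau z)).
  have S1 := @SDpair1 R A x0 s v.
  have := SDpair_lin k%:C (@SDpair_s R A x0 s v) (SDpair_lin (-1) S1 S1).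
  by move/SDpair_ext; apply=> [|p z]; rewrite ?scaleN1r ?addNr ?mulr0 ?addr0.
have rx : SDpair x0 s v x0 (fun _ _ => 0) by have := @SDpair_gen R A x0 s v _ (@gen_id R A x0).
have rw l : SDpair x0 s v (word x0 u l) (fun p z => k%:C * dword x0 u l p z).
  elim: l => [|b l IH].
    have := @SDpair1 R A x0 s v; move/SDpair_ext; apply; first by rewrite /word big_nil.
    by move=> p z; rewrite mulr0.
  rewrite word_cons; case: b.
    by apply: (SDpair_ext (SDpairM ru IH)) => // p z; rewrite /= mulrDr.
  by apply: (SDpair_ext (SDpairM rx IH)) => // p z; rewrite /= !add0r.
move=> l; rewrite word_cons /u -scalerAl tauZ -/u (SDpair_tau fr tU (rw l)).
by rewrite rmorphM rmorphXn; ring.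
Qed.

End WordSchwingerDyson.

Section ResolventSchwingerDyson.
Context {R : realType} {A : tracialVNA R}.
Local Notation nrm := (@Normc.normc R).

Lemma normc_small_eq (z w : R[i]) (mu C : R) : 0 <= mu -> mu < 1 ->
  (forall n, nrm (z - w) <= mu ^+ n * C) -> z = w.
Proof.
move=> m0 m1 zw; apply/eqP; rewrite -subr_eq0; apply/eqP/Normc.eq0_normc/eqP.
rewrite eq_le normc_ge0 andbT; apply: (cvg0_le _ zw).
by have := cvg_geometric0 1 m0 m1; under eq_fun do rewrite mulr1.
Qed.

Lemma normc_tauM_le (p q : A) : nrm (tau p * tau q) <= 4 * (opnorm p * opnorm q).
Proof.
rewrite Normc.normcM (_ : 4 * _ = (2 * opnorm p) * (2 * opnorm q)); last by ring.
by apply: ler_pM; rewrite ?normc_ge0 ?normc_tau_le.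
Qed.

Variables (x0 s : A) (v : R).
Hypotheses (free : freely_independent x0 s) (tauU : forall n, tau (cheb_eval v s n.+1) = 0).
Variables (y : A) (r e : R).
Hypothesis e0 : 0 < e.

Local Notation ir := (0 +i* r : R[i]).
Local Notation SD := (SDpair x0 s v).

(** The intended [y] is affine in [s] with linear coefficient [i r]; its adjoint has coefficient
    [- i r]. *)
Hypothesis SDy : SD y (fun p z => ir * (tau p * tau z)).
Hypothesis SDys : SD (star y) (fun p z => - ir * (tau p * tau z)).

Let c := opnorm y ^+ 2 + e.
Let c0 : 0 < c. Proof. by rewrite ltr_wpDl ?sqr_ge0. Qed.
Let X := shifted_sq y e.
Let Z := contraction X c.
Let G := resolvent y e.
Let rho := Num.sqrt (1 - e / c).
Let mu := (1 + rho) / 2.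
Let r0 : 0 <= rho. Proof. exact: sqrtr_ge0. Qed.
Let r1 : rho < 1. Proof. exact: sqrt_contraction_lt1. Qed.
Let Zr : opnorm Z <= rho. Proof. exact: opnorm_contraction. Qed.
Let m0 : 0 <= mu. Proof. by rewrite /mu; move: r0; lra. Qed.
Let m1 : mu < 1. Proof. by rewrite /mu; move: r1; lra. Qed.
Let rm : rho < mu. Proof. by rewrite /mu; move: r1; lra. Qed.

(* [dX] is the difference quotient of [X = star y * y + e]. *)
Definition dX (p z : A) : R[i] := ir * (tau (p * star y) * tau z - tau p * tau (y * z)).

Let M := nrm ir * (8 * opnorm y).

Let M0 : 0 <= M. Proof. by rewrite !mulr_ge0 ?normc_ge0 ?opnorm_ge0. Qed.

Lemma dX_le p z : nrm (dX p z) <= M * (opnorm p * opnorm z).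
Proof.
rewrite /dX Normc.normcM /M -mulrA ler_wpM2l ?normc_ge0 //.
apply: le_trans (le_normcD _ _) _; rewrite normcN.
have h1 : opnorm (p * star y) * opnorm z <= opnorm p * opnorm y * opnorm z.
  by rewrite ler_wpM2r ?opnorm_ge0 // -[in X in _ <= X](opnorm_star y) opnormM.
have h2 : opnorm p * opnorm (y * z) <= opnorm p * (opnorm y * opnorm z).
  by rewrite ler_wpM2l ?opnorm_ge0 // opnormM.
have := normc_tauM_le (p * star y) z; have := normc_tauM_le p (y * z).
by move: h1 h2; nra.
Qed.

Lemma dXBl p q z : dX (p - q) z = dX p z - dX q z.
Proof. by rewrite /dX [(p - q) * _]mulrBl !tauB; ring. Qed.

Lemma dXBr p w z : dX p (w - z) = dX p w - dX p z.
Proof. by rewrite /dX [y * _]mulrBr !tauB; ring. Qed.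

Let ci := (c^-1)%:C : R[i].

Lemma SD_contraction : SD Z (fun p z => - ci * dX p z).
Proof.
have S1 := @SDpair1 R A x0 s v.
have S0 := SDpair_lin (-1) S1 S1.
have SX := SDpair_lin 1 (SDpairM SDys SDy) (SDpair_lin e%:C S1 S0).
have := SDpair_lin (- ci) SX S1; move/SDpair_ext; apply.
  rewrite /Z /contraction /X shifted_sqE scale1r scaleN1r addNr addr0 scaleNr.
  by rewrite addrC.
by move=> p z; rewrite /dX; ring.
Qed.

(* The difference quotients of [Z ^+ n] and of the partial sums [Gn n] of the
   Neumann series of [G]; the latter tend to [- G (D X) G]. *)
Fixpoint dZn (n : nat) (p z : A) : R[i] :=
  if n is n'.+1 then - ci * dX p (Z ^+ n' * z) + dZn n' (p * Z) z else 0.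

Lemma SD_powers n : SD (Z ^+ n) (dZn n).
Proof.
elim: n => [|n IH]; first by rewrite expr0; exact: (@SDpair1 R A x0 s v).
by rewrite exprS; exact: SDpairM SD_contraction IH.
Qed.

(** The recursion peeled from the right instead of the left, as the telescoping of [dG] requires. *)
Lemma dZn_recr n p z : dZn n.+1 p z = dZn n p (Z * z) - ci * dX (p * Z ^+ n) z.
Proof.
elim: n p => [|n IH] p; first by rewrite /= !expr0 mulr1 mul1r addr0 add0r mulNr.
have -> : dZn n.+2 p z = - ci * dX p (Z ^+ n.+1 * z) + dZn n.+1 (p * Z) z by [].
rewrite IH [dZn n.+1 p _]/= mulrA -exprSr addrA; congr (_ - _ * _).
by rewrite -mulrA -exprS.
Qed.

Lemma dZnBr n p w z : dZn n p (w - z) = dZn n p w - dZn n p z.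
Proof.
elim: n p => [|n IH] p /=; first by rewrite subrr.
by rewrite IH mulrBr dXBr; ring.
Qed.

Let K := c^-1 * M / (mu - rho).

(** There are [n] terms with [n - 1] factors [Z] each; the ratio [mu > rho] absorbs the factor
    [n]. *)
Lemma dZn_le n p z : nrm (dZn n p z) <= K * mu ^+ n * (opnorm p * opnorm z).
Proof.
have mr : 0 < mu - rho by rewrite subr_gt0.
have K0 : 0 <= K by rewrite divr_ge0 ?(ltW mr) // mulr_ge0 // invr_ge0 ltW.
elim: n p => [|n IH] p.
  by rewrite -[dZn 0 p z]/0 Normc.normc0 expr0 mulr1 mulr_ge0 // mulr_ge0 ?opnorm_ge0.
rewrite [dZn _ _ _]/=; apply: le_trans (le_normcD _ _) _.
have pz0 : 0 <= opnorm p * opnorm z by rewrite mulr_ge0 ?opnorm_ge0.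
have h1 : nrm (- ci * dX p (Z ^+ n * z)) <= c^-1 * M * mu ^+ n * (opnorm p * opnorm z).
  rewrite Normc.normcM normcN /ci.
  have -> : nrm (c^-1)%:C = c^-1.
    by rewrite /= expr0n addr0 sqrtr_sqr ger0_norm // invr_ge0 ltW.
  rewrite (_ : _ * _ * _ * _ = c^-1 * (M * (mu ^+ n * (opnorm p * opnorm z)))); last by ring.
  rewrite ler_wpM2l ?invr_ge0 ?(ltW c0) //; apply: le_trans (dX_le _ _) _.
  rewrite ler_wpM2l // [X in _ <= X]mulrCA ler_wpM2l ?opnorm_ge0 //.
  apply: le_trans (opnormM _ _) _; rewrite ler_wpM2r ?opnorm_ge0 //.
  apply: le_trans (opnormX _ _) _.
  by rewrite lerXn2r ?nnegrE ?opnorm_ge0 // (le_trans Zr) // ltW.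
have h2 : nrm (dZn n (p * Z) z) <= K * mu ^+ n * (rho * (opnorm p * opnorm z)).
  apply: le_trans (IH _) _; apply: ler_wpM2l; first by rewrite mulr_ge0 ?exprn_ge0.
  rewrite [X in _ <= X]mulrA ler_wpM2r ?opnorm_ge0 //; apply: le_trans (opnormM _ _) _.
  by rewrite mulrC ler_wpM2r ?opnorm_ge0.
apply: le_trans (lerD h1 h2) _; rewrite le_eqVlt; apply/orP; left; apply/eqP.
by rewrite exprS /K; field; rewrite gt_eqF //= gt_eqF.
Qed.

Let Gn n : A := ci *: \sum_(k < n) Z ^+ k.

Definition dG n (p z : A) : R[i] := ci * \sum_(k < n) dZn k p z.

Lemma SD_Gn n : SD (Gn n) (dG n).
Proof.
have S1 := @SDpair1 R A x0 s v.
have S0 := SDpair_lin (-1) S1 S1.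
have H : SD (\sum_(k < n) Z ^+ k) (fun p z => \sum_(k < n) dZn k p z).
  elim: n => [|n IH].
    apply: (SDpair_ext S0) => [|p z]; first by rewrite big_ord0 scaleN1r addNr.
    by rewrite big_ord0 mulr0 addr0.
  apply: (SDpair_ext (SDpair_lin 1 IH (SD_powers n))) => [|p z].
    by rewrite big_ord_recr /= scale1r.
  by rewrite big_ord_recr /= mul1r.
apply: (SDpair_ext (SDpair_lin ci H S0)) => [|p z].
  by rewrite scaleN1r addNr addr0.
by rewrite mulr0 !addr0.
Qed.

(** The derivation [D] applied to [Gn X = 1 - Z^n]. *)
Lemma dG_telescope n p z : dG n p (X * z) = - dZn n p z - dX (p * Gn n) z.
Proof.
have XZ : X = c%:C *: (1 - Z) by rewrite contractionK // gt_eqF.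
have cci : ci * c%:C = 1 by rewrite /ci -rmorphM /= mulVf // gt_eqF.
have dZnZr k q w : dZn k q (c%:C *: w) = c%:C * dZn k q w.
  elim: k q => [|k IH] q /=; first by rewrite mulr0.
  by rewrite IH -scalerAr /dX -scalerAr !tauZ; ring.
rewrite /dG mulr_sumr.
have stepE k : ci * dZn k p (X * z) = dZn k p z - dZn k.+1 p z - ci * dX (p * Z ^+ k) z.
  by rewrite XZ -scalerAl dZnZr mulrA cci mul1r mulrBl mul1r dZnBr dZn_recr; ring.
elim: n => [|n IH].
  by rewrite big_ord0 /Gn big_ord0 scaler0 mulr0 /= /dX mul0r !tau0; ring.
have -> : Gn n.+1 = Gn n + ci *: Z ^+ n by rewrite /Gn big_ord_recr scalerDr.
have -> : dX (p * (Gn n + ci *: Z ^+ n)) z = dX (p * Gn n) z + ci * dX (p * Z ^+ n) z.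
  rewrite /dX [p * _]mulrDr -[p * (ci *: _)]scalerAr [(_ + _) * star y]mulrDl.
  by rewrite -scalerAl !tauD !tauZ; ring.
by rewrite big_ord_recr /= -/(dZn n.+1 p z) IH stepE; ring.
Qed.

Let D := c^-1 / (1 - rho).

Lemma Gn_le n : opnorm (Gn n - G) <= mu ^+ n * D.
Proof.
have D0 : 0 <= D by rewrite divr_ge0 ?invr_ge0 ?subr_ge0 ?(ltW c0) ?(ltW r1).
apply: le_trans (resolvent_partial_sums e0 n (lexx _)) _.
by rewrite ler_wpM2r // lerXn2r ?nnegrE ?(ltW rm).
Qed.

(** Writing [z = X (G z)] brings the telescoped identity into play, where [dZn n] decays
    geometrically and [Gn n] tends to [G]. *)
Lemma dG_cvg p z : exists C, forall n, nrm (dG n p z + dX (p * G) (G * z)) <= mu ^+ n * C.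
Proof.
exists (K * (opnorm p * opnorm (G * z)) + M * (opnorm p * D * opnorm (G * z))) => n.
have -> : dG n p z = dG n p (X * (G * z)) by rewrite mulrA mul_shifted_resolvent // mul1r.
have -> : dG n p (X * (G * z)) + dX (p * G) (G * z) =
    - dZn n p (G * z) - dX (p * (Gn n - G)) (G * z).
  by rewrite dG_telescope mulrBr dXBl; ring.
apply: le_trans (le_normcD _ _) _; rewrite !normcN [X in _ <= X]mulrDr; apply: lerD.
  by rewrite mulrCA mulrA dZn_le.
apply: le_trans (dX_le _ _) _.
rewrite [X in _ <= X]mulrCA ler_wpM2l // [X in _ <= X]mulrA ler_wpM2r ?opnorm_ge0 //.
apply: le_trans (opnormM _ _) _; rewrite [X in _ <= X]mulrCA ler_wpM2l ?opnorm_ge0 //.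
exact: Gn_le.
Qed.

Lemma tau_Gn_cvg p q : exists C, forall n, nrm (tau (p * Gn n * q) - tau (p * G * q)) <= mu ^+ n * C.
Proof.
exists (2 * (opnorm p * D * opnorm q)) => n; rewrite -tauB -mulrBl -mulrBr.
apply: le_trans (normc_tau_le _) _; rewrite [X in _ <= X]mulrCA ler_wpM2l //.
apply: le_trans (opnormM _ _) _; rewrite [X in _ <= X]mulrA ler_wpM2r ?opnorm_ge0 //.
apply: le_trans (opnormM _ _) _; rewrite [X in _ <= X]mulrCA ler_wpM2l ?opnorm_ge0 //.
exact: Gn_le.
Qed.

(** The equation is available for the polynomials [Gn n], and each of its terms converges
    geometrically. *)
Lemma SD_resolvent_star : tau (s * (G * star y)) =
  v%:C * (- dX G (G * star y) - ir * tau G).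
Proof.
have [C1 H1] := dG_cvg 1 (star y).
have [C2 H2] := tau_Gn_cvg s (star y).
have [C3 H3] := tau_Gn_cvg 1 1.
apply: (@normc_small_eq _ _ mu (C2 + nrm v%:C * (C1 + nrm ir * C3))) => // n.
have E := SDpair_tau free tauU (SDpairM (SD_Gn n) SDys).
have {}H2 := H2 n; have {}H1 := H1 n; have {}H3 := H3 n.
rewrite -!mulrA E in H2; rewrite mul1r in H1; rewrite !mul1r !mulr1 in H3 E *.
rewrite !mulr1 in H2.
rewrite tau1 mulr1 in H2.
set a := tau (s * (G * star y)) in H2 *.
have -> : a - v%:C * (- dX G (G * star y) - ir * tau G) =
   - (v%:C * (dG n 1 (star y) + - ir * tau (1 * Gn n)) - a) +
   v%:C * ((dG n 1 (star y) + dX G (G * star y)) + - ir * (tau (Gn n) - tau G)).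
  by rewrite mul1r; ring.
apply: le_trans (le_normcD _ _) _; rewrite normcN [X in _ <= X]mulrDr; apply: lerD => //.
rewrite Normc.normcM [X in _ <= X]mulrCA ler_wpM2l ?normc_ge0 //.
apply: le_trans (le_normcD _ _) _; rewrite [X in _ <= X]mulrDr; apply: lerD => //.
by rewrite Normc.normcM normcN [X in _ <= X]mulrCA ler_wpM2l ?normc_ge0.
Qed.

Lemma SD_resolvent : tau (s * (y * G)) = v%:C * (ir * tau G - dX (y * G) G).
Proof.
have [C1 H1] := dG_cvg y 1.
have [C2 H2] := tau_Gn_cvg (s * y) 1.
have [C3 H3] := tau_Gn_cvg 1 1.
apply: (@normc_small_eq _ _ mu (C2 + nrm v%:C * (C1 + nrm ir * C3))) => // n.
have E := SDpair_tau free tauU (SDpairM SDy (SD_Gn n)).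
have {}H2 := H2 n; have {}H1 := H1 n; have {}H3 := H3 n.
rewrite !mulr1 -!mulrA E in H2; rewrite mulr1 in H1; rewrite !mul1r !mulr1 in H3 *.
rewrite !mulr1 !mul1r tau1 mul1r in H2.
set a := tau (s * (y * G)) in H2 *.
have -> : a - v%:C * (ir * tau G - dX (y * G) G) =
   - (v%:C * (ir * tau (Gn n) + dG n y 1) - a) +
   v%:C * ((dG n y 1 + dX (y * G) G) + ir * (tau (Gn n) - tau G)).
  by ring.
apply: le_trans (le_normcD _ _) _; rewrite normcN [X in _ <= X]mulrDr; apply: lerD => //.
rewrite Normc.normcM [X in _ <= X]mulrCA ler_wpM2l ?normc_ge0 //.
apply: le_trans (le_normcD _ _) _; rewrite [X in _ <= X]mulrDr; apply: lerD => //.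
by rewrite Normc.normcM [X in _ <= X]mulrCA ler_wpM2l ?normc_ge0.
Qed.

End ResolventSchwingerDyson.

(** * The Hamilton-Jacobi equation *)

Section HolderSqrt.
Context {R : realType}.

Lemma dist_sqrt_le (a b : R) : 0 <= a -> 0 <= b ->
  `|Num.sqrt a - Num.sqrt b| <= Num.sqrt `|a - b|.
Proof.
move=> a0 b0; rewrite -ler_sqr ?nnegrE ?sqrtr_ge0 // sqr_sqrtr //.
have [pa pb] := (sqrtr_ge0 a, sqrtr_ge0 b).
rewrite real_normK ?num_real // -{2}(sqr_sqrtr a0) -{2}(sqr_sqrtr b0).
move: (Num.sqrt a) (Num.sqrt b) pa pb => u v u0 v0.
have [uv|/ltW vu] := leP v u.
  by rewrite ger0_norm ?subr_ge0 ?ler_sqr ?nnegrE //; nra.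
by rewrite ler0_norm ?subr_le0 ?ler_sqr ?nnegrE //; nra.
Qed.

(* If [phi'(r) = 2 r F r] with [F] Lipschitz at [sqrt t], then the derivative
   of [phi (sqrt t)] in [t] is [F (sqrt t)], including at [t = 0]. *)
Lemma is_derive_nonneg_sqrt (f phi F : R -> R) (t L : R) : 0 <= t ->
  (forall t', 0 <= t' -> f t' = phi (Num.sqrt t')) ->
  (forall r : R, is_derive r 1 phi (2 * r * F r)) ->
  (forall k, `|k| <= 1 -> `|F (Num.sqrt t + k) - F (Num.sqrt t)| <= L * `|k|) ->
  is_derive_nonneg f t (F (Num.sqrt t)).
Proof.
move=> t0 fphi dphi FL; set r := Num.sqrt t in FL *.
have L0 : 0 <= L by have := FL 1; rewrite normr1 mulr1 => /(_ (lexx _)); apply: le_trans.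
rewrite /is_derive_nonneg; apply/cvgrPdist_le => e e0.
(* With [q = sqrt (t + h)], [|q - r| <= sqrt |h|]; so [|q - r| <= 1], where the Lipschitz bound
   holds, and [4 L |q - r| <= e]. *)
pose d := Num.min 1 ((e / (4 * L + 1)) ^+ 2).
have L1 : 0 < 4 * L + 1 by rewrite ltr_wpDl // mulr_ge0.
have d0 : 0 < d by rewrite lt_min ltr01 exprn_gt0 // divr_gt0.
suff : \forall h \near 0^', 0 <= t + h -> `|F r - h^-1 * (f (t + h) - f t)| <= e.
  by move=> H; apply: filterS H => h H /=; exact: H.
near=> h => th.
have h0 : h != 0 by near: h; exact: nbhs_dnbhs_neq.
have hd : `|h| <= d by near: h; apply: dnbhs0_le.
move: hd; rewrite le_min => /andP[h1 he].
rewrite !fphi //; set q := Num.sqrt (t + h).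
have q0 : 0 <= q := sqrtr_ge0 _; have r0 : 0 <= r := sqrtr_ge0 _.
have hqr : h = q ^+ 2 - r ^+ 2 by rewrite !sqr_sqrtr // addrC addKr.
have qr : `|q - r| <= Num.sqrt `|h|.
  by have := dist_sqrt_le th t0; rewrite [t + h - t]addrC addKr.
have qr1 : `|q - r| <= 1.
  by apply: le_trans qr _; rewrite -[leRHS]sqrtr1 ler_wsqrtr.
have qre : 4 * L * `|q - r| <= e.
  have : `|q - r| <= e / (4 * L + 1).
    apply: le_trans qr _; rewrite -[leRHS]ger0_norm ?divr_ge0 ?(ltW e0) ?(ltW L1) //.
    by rewrite -(sqrtr_sqr (e / _)) ler_wsqrtr.
  rewrite ler_pdivlMr // mulrC; apply: le_trans.
  by rewrite ler_wpM2r // lerDl.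
(* Its derivative [2 x (F x - F r)] is of order [(r + q) |q - r|] between [r] and [q]. As
   [|h| = (r + q) |q - r|], the increment of [psi] divided by [h] is at most [4 L |q - r|], even for
   [r = 0]. *)
pose psi (x : R) := phi x - F r * x ^+ 2.
pose dpsi (x : R) := 2 * x * (F x - F r).
have dpsiE (x : R) : is_derive x 1 psi (dpsi x).
  have d2 : is_derive x 1 (fun x : R => F r * x ^+ 2) (F r * (2 * x)).
    have -> : (fun x : R => F r * x ^+ 2) = horner (F r *: 'X^2).
      by apply/funext => z; rewrite hornerZ hornerXn.
    apply: (is_derive_eq (is_derive_poly _ x)).
    by rewrite derivZ derivXn hornerZ hornerMn hornerX -[x *+ 2]mulr_natl.
  by apply: (is_derive_eq (is_deriveB (dphi x) d2)); rewrite /dpsi; ring.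
have mvt := @is_derive_dist_le R psi dpsi r q (2 * (2 * (r + q)) * (L * `|q - r|)).
have {}mvt : `|psi q - psi r| <= 2 * (2 * (r + q)) * (L * `|q - r|) * `|q - r|.
  apply: mvt => // x xr; rewrite /dpsi normrM; apply: ler_pM => //.
    rewrite normrM ger0_norm // ler_wpM2l //.
    have := ler_normD (x - r) r; rewrite subrK (ger0_norm r0).
    by have := ler_normB q r; rewrite (ger0_norm q0) (ger0_norm r0); move: xr; lra.
  have := FL (x - r); rewrite [r + _]addrC subrK => /(_ (le_trans xr qr1)) /le_trans; apply.
  by rewrite ler_wpM2l.
have -> : F r - h^-1 * (phi q - phi r) = - (h^-1 * (psi q - psi r)).
  rewrite /psi; have -> : phi q - F r * q ^+ 2 - (phi r - F r * r ^+ 2) =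
    phi q - phi r - F r * h by rewrite hqr; ring.
  by field.
rewrite normrN normrM normfV ler_pdivrMl ?normr_gt0 //.
apply: le_trans mvt _.
have -> : `|h| = (r + q) * `|q - r|.
  by rewrite hqr subr_sqr normrM mulrC [q + r]addrC (@ger0_norm _ (r + q)) // addr_ge0.
have -> : 2 * (2 * (r + q)) * (L * `|q - r|) * `|q - r| = (r + q) * `|q - r| * (4 * L * `|q - r|) by ring.
by rewrite ler_wpM2l // mulr_ge0 ?addr_ge0.
Unshelve. all: by end_near. Qed.

End HolderSqrt.

(** * The affine path in the semicircular variable and its partial derivatives *)

Section HamiltonJacobi.
Context {R : realType} {A : tracialVNA R}.
Variables (x0 s : A).
Hypotheses (sx : selfadjoint x0) (ss : selfadjoint s).
Hypotheses (free : freely_independent x0 s) (sc : semicircular 1 s).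

Definition ypath (r : R) (lambda : R[i]) : A := shifted x0 (r%:C *: s) lambda.

Definition Phi (r : R) (lambda : R[i]) (e : R) : R :=
  rtau (op_log (shifted_sq (ypath r lambda) e)).

Definition itau (x : A) : R := complex.Im (tau x).

Lemma itau_le x : `|itau x| <= 2 * opnorm x.
Proof.
apply: le_trans (normc_tau_le x); rewrite /itau; case: (tau x) => a b /=.
by rewrite -sqrtr_sqr ler_wsqrtr // lerDr sqr_ge0.
Qed.

Lemma itauB x y : itau (x - y) = itau x - itau y.
Proof. by rewrite /itau tauB raddfB. Qed.

Lemma ypathE r lambda : ypath r lambda = (0 +i* r) *: s + ((- lambda) *: 1 + x0).
Proof.
rewrite /ypath /shifted scalerA (_ : (0 +i* 1) * r%:C = 0 +i* r); last first.
  by apply/eqP; rewrite eq_complex /= ?mul0r ?mul1r ?mulr0 ?subr0 ?addr0 ?add0r ?eqxx.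
by rewrite scaleNr; ncring.
Qed.

Lemma star_ypath r lambda :
  star (ypath r lambda) = (- (0 +i* r)) *: s + ((- lambda^*%C) *: 1 + x0).
Proof.
rewrite ypathE !starD !starZ star1 (sx : star x0 = x0) (ss : star s = s) rmorphN.
by congr (_ *: _ + _); apply/eqP; rewrite eq_complex /= oppr0 !eqxx.
Qed.

Section Point.
Variables (r : R) (lambda : R[i]) (e : R).
Hypothesis e0 : 0 < e.

Let y := ypath r lambda.
Let G := resolvent y e.
Let g := tau G.
Let p := tau (G * star y).
Let q := tau (y * G).

Let qp : q = p^*%C.
Proof. by rewrite /q /p -tau_star starM starK star_resolvent. Qed.

Let SD1 := @SDpair1 R A x0 s 1.

Let SDaff (k l : R[i]) : SDpair x0 s 1 (k *: s + (l *: 1 + x0)) (fun p z => k * (tau p * tau z)).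
Proof.
have := SDpair_lin k (@SDpair_s R A x0 s 1)
  (SDpair_lin l SD1 (@SDpair_gen R A x0 s 1 _ (@gen_id R A x0))).
by move/SDpair_ext; apply=> // a b; rewrite mulr0 !addr0.
Qed.

Let gE : g = (rtau G)%:C.
Proof. by rewrite /g tau_real // star_resolvent. Qed.

Lemma tau_yGy : tau (y * G * star y) = 1 - e%:C * g.
Proof.
rewrite tau_tracial mulrA -/y.
have -> : star y * y = shifted_sq y e - e%:C *: 1 by rewrite shifted_sqE addrK.
rewrite mulrBl mul_shifted_resolvent // -scalerAl mul1r.
by rewrite tauB tauZ tau1.
Qed.

Definition Fpath : R :=
  e * rtau G ^+ 2 + (rtau (G * star y) ^+ 2 - itau (G * star y) ^+ 2).

(* Integration by parts in the semicircular variable. *)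
Lemma rtau_path_derivative : let w := (0 +i* 1) *: s in
  rtau (G * (star w * y + star y * w + (0 : R)%:C *: 1)) = 2 * r * Fpath.
Proof.
move=> w.
have tU n := @tau_cheb_eval R A 1 s n ltr01 sc.
have SDy : SDpair x0 s 1 y (fun p z => (0 +i* r) * (tau p * tau z)).
  by rewrite /y ypathE; exact: SDaff.
have SDys : SDpair x0 s 1 (star y) (fun p z => - (0 +i* r) * (tau p * tau z)).
  by rewrite /y star_ypath; exact: SDaff.
have E1 := SD_resolvent_star free tU e0 SDy SDys.
have E2 := SD_resolvent free tU e0 SDy SDys.
have T : tau (G * (star w * y + star y * w + (0 : R)%:C *: 1)) =
    (0 +i* 1) * (tau (s * (G * star y)) - tau (s * (y * G))).
  have -> : star w = (- (0 +i* 1)) *: s.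
    rewrite /w starZ (ss : star s = s); congr (_ *: _).
    by apply/eqP; rewrite eq_complex /= oppr0 !eqxx.
  rewrite scale0r addr0 mulrDr tauD -!scalerAl -!scalerAr !tauZ.
  rewrite (tau_tracial G) (mulrA G) (tau_tracial _ s) -!mulrA; ring.
(* The value [1 - e g] of [tau (y G star y)] cancels the terms linear in [g]: the two traces become
   [- i r (p^2 + e g^2)] and [i r (q^2 + e g^2)], where [q] is the conjugate of [p]. *)
rewrite /dX -/G (mulrA y) tau_yGy -/g -/p in E1.
rewrite /dX -/G tau_yGy -/g -/q qp in E2.
rewrite /Fpath /rtau T E1 E2 -/(rtau G) /itau -/p gE.
case: p => a b /=; ring.
Qed.

End Point.

Lemma is_derive_Phi_r (r : R) (lambda : R[i]) (e : R) : 0 < e ->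
  is_derive r 1 (fun r => Phi r lambda e) (2 * r * Fpath r lambda e).
Proof.
move=> e0; rewrite -rtau_path_derivative //.
apply: (is_derive_log_path e0) => h; rewrite /Phi mulr0 addr0; congr (rtau (op_log (shifted_sq _ _))).
rewrite !ypathE scalerA addrAC -scalerDl; congr (_ *: _ + _).
by apply/eqP; rewrite eq_complex /= ?mul0r ?mulr1 ?mulr0 ?subr0 ?addr0 ?add0r ?eqxx.
Qed.

Lemma is_derive_Phi_a (r a b e : R) : 0 < e ->
  is_derive a 1 (fun a => Phi r (a +i* b) e)
    (- 2 * rtau (resolvent (ypath r (a +i* b)) e * star (ypath r (a +i* b)))).
Proof.
move=> e0; set y := ypath r (a +i* b); set G := resolvent y e.
have -> : - 2 * rtau (G * star y) = rtau (G * (star (- 1) * y + star y * (- 1) + (0 : R)%:C *: 1)).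
  rewrite scale0r addr0 starN star1 mulN1r mulrN1 mulrDr !mulrN rtauD !rtauN (rtauC G y).
  have -> : rtau (y * G) = rtau (G * star y).
    by rewrite /rtau -[y * G]starK tau_star starM star_resolvent //; case: (tau _).
  by ring.
apply: (is_derive_log_path e0) => h; rewrite /Phi mulr0 addr0; congr (rtau (op_log (shifted_sq _ _))).
rewrite /y !ypathE scalerN -scaleNr -addrA; congr (_ + _).
rewrite [in RHS]addrAC -scalerDl; congr (_ *: _ + _).
by apply/eqP; rewrite eq_complex /= ?oppr0 ?addr0 opprD ?eqxx.
Qed.

Lemma is_derive_Phi_b (r a b e : R) : 0 < e ->
  is_derive b 1 (fun b => Phi r (a +i* b) e)
    (2 * itau (resolvent (ypath r (a +i* b)) e * star (ypath r (a +i* b)))).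
Proof.
move=> e0; set y := ypath r (a +i* b); set G := resolvent y e.
pose w : A := (- (0 +i* 1)) *: 1.
have -> : 2 * itau (G * star y) = rtau (G * (star w * y + star y * w + (0 : R)%:C *: 1)).
  have -> : star w = (0 +i* 1) *: 1.
    rewrite /w starZ star1; congr (_ *: _).
    by apply/eqP; rewrite eq_complex /= opprK oppr0 !eqxx.
  rewrite scale0r addr0 mulrDr rtauD /w alg_mull alg_mulr -!scalerAr /rtau !tauZ tau_tracial.
  have -> : tau (y * G) = (tau (G * star y))^*%C.
    by rewrite -[y * G]starK tau_star starM star_resolvent.
  by rewrite /itau; case: (tau _) => u v /=; ring.
apply: (is_derive_log_path e0) => h; rewrite /Phi mulr0 addr0; congr (rtau (op_log (shifted_sq _ _))).
rewrite /y !ypathE /w scalerA -addrA; congr (_ + _).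
rewrite [in RHS]addrAC -scalerDl; congr (_ *: _ + _).
by apply/eqP; rewrite eq_complex /=; apply/andP; split; apply/eqP; ring.
Qed.

Lemma is_derive_Phi_e (r : R) (lambda : R[i]) (e : R) : 0 < e ->
  is_derive e 1 (fun e => Phi r lambda e) (rtau (resolvent (ypath r lambda) e)).
Proof.
move=> e0; set y := ypath r lambda; set G := resolvent y e.
have -> : rtau G = rtau (G * (star 0 * y + star y * 0 + (1 : R)%:C *: 1)).
  by rewrite star0 mul0r mulr0 !add0r scale1r mulr1.
by apply: (is_derive_log_path e0) => h; rewrite /Phi scaler0 addr0 mulr1.
Qed.

(** The resolvent identity [G' - G = G' (X - X') G] and the bound [e^-1] on resolvents give
    Lipschitz estimates for [G] and [G star y], hence for the squares of their traces. *)
Lemma Fpath_lipschitz (r : R) (lambda : R[i]) (e : R) : 0 < e -> exists L : R,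
  forall k, `|k| <= 1 -> `|Fpath (r + k) lambda e - Fpath r lambda e| <= L * `|k|.
Proof.
move=> e0; set y := ypath r lambda; set G := resolvent y e.
pose w : A := (0 +i* 1) *: s.
pose N := opnorm y + opnorm w.
have N0 : 0 <= N by rewrite addr_ge0 ?opnorm_ge0.
have ei0 : 0 <= e^-1 by rewrite invr_ge0 ltW.
pose K := opnorm (star w * y + star y * w) + opnorm (star w * w).
have K0 : 0 <= K by rewrite addr_ge0 ?opnorm_ge0.
(* Lipschitz constants of [G] and of [G star y] along the path; [N] bounds [y] for [|k| <= 1]. *)
pose LG := e^-1 * K * e^-1; pose Lp := LG * N + e^-1 * opnorm w.
have LG0 : 0 <= LG by rewrite !mulr_ge0.
have Lp0 : 0 <= Lp by rewrite addr_ge0 ?mulr_ge0 ?opnorm_ge0.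
have eN0 : 0 <= e^-1 * N by rewrite mulr_ge0.
exists (e * (LG * (2 * e^-1)) + (Lp * (2 * (e^-1 * N)) + (2 * Lp) * (4 * (e^-1 * N)))).
move=> k k1; rewrite /Fpath -/y -/G.
set y' := ypath (r + k) lambda; set G' := resolvent y' e.
have yE : y' = y + k%:C *: w.
  rewrite /y' /y !ypathE scalerA addrAC -scalerDl; congr (_ *: _ + _).
  by apply/eqP; rewrite eq_complex /= ?mul0r ?mulr1 ?mulr0 ?subr0 ?addr0 ?add0r ?eqxx.
have kw : opnorm (k%:C *: w) <= `|k| * opnorm w by exact: opnormZr_le.
have y'N : opnorm y' <= N.
  rewrite yE; apply: le_trans (opnormD _ _) _; rewrite lerD2l.
  by apply: le_trans kw _; rewrite ler_piMl ?opnorm_ge0.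
have yN : opnorm y <= N by rewrite lerDl opnorm_ge0.
have XK : opnorm (shifted_sq y e - shifted_sq y' e) <= `|k| * K.
  have := shifted_sq_path y w e 0 k; rewrite mulr0 addr0 scale0r addr0 -yE => ->.
  rewrite opprD addrA subrr add0r opnormN; apply: le_trans (opnormD _ _) _.
  rewrite /K [X in _ <= X]mulrDr lerD ?opnormZr_le //; apply: le_trans (opnormZr_le _ _) _.
  by rewrite normrX expr2 -mulrA ler_piMl ?mulr_ge0 ?opnorm_ge0.
have dG : opnorm (G' - G) <= LG * `|k|.
  have -> : G' - G = G' * (shifted_sq y e - shifted_sq y' e) * G.
    rewrite mulrBr mulrBl mul_resolvent_shifted // mul1r.
    by rewrite -mulrA mul_shifted_resolvent // mulr1.
  apply: le_trans (opnormM _ _) _.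
  rewrite /LG (_ : _ * `|k| = e^-1 * (`|k| * K) * e^-1); last by ring.
  apply: ler_pM; rewrite ?opnorm_ge0 ?opnorm_resolvent //.
  apply: le_trans (opnormM _ _) _; apply: ler_pM; rewrite ?opnorm_ge0 ?opnorm_resolvent //.
have dp : opnorm (G' * star y' - G * star y) <= Lp * `|k|.
  have -> : G' * star y' - G * star y = (G' - G) * star y' + G * star (k%:C *: w).
    by rewrite yE !starD; ncring.
  apply: le_trans (opnormD _ _) _; rewrite /Lp [X in _ <= X]mulrDl; apply: lerD.
    apply: le_trans (opnormM _ _) _; rewrite opnorm_star mulrAC.
    by apply: ler_pM; rewrite ?opnorm_ge0.
  apply: le_trans (opnormM _ _) _; rewrite opnorm_star -mulrA [_ * `|k|]mulrC.
  by apply: ler_pM; rewrite ?opnorm_ge0 ?opnorm_resolvent.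
have sqB (u v B D : R) : `|u - v| <= D -> `|u| <= B -> `|v| <= B -> `|u ^+ 2 - v ^+ 2| <= D * (2 * B).
  move=> uv uB vB; rewrite subr_sqr normrM; apply: ler_pM => //.
  by apply: le_trans (ler_normD _ _) _; lra.
have pB z : opnorm z <= N -> opnorm (resolvent z e * star z) <= e^-1 * N.
  move=> zN; apply: le_trans (opnormM _ _) _; rewrite opnorm_star.
  by apply: ler_pM; rewrite ?opnorm_ge0 ?opnorm_resolvent.
have h1 : `|rtau G' ^+ 2 - rtau G ^+ 2| <= LG * `|k| * (2 * e^-1).
  apply: sqB; rewrite -?rtauB; apply: le_trans (rtau_le _) _ => //; exact: opnorm_resolvent.
have h2 : `|rtau (G' * star y') ^+ 2 - rtau (G * star y) ^+ 2| <= Lp * `|k| * (2 * (e^-1 * N)).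
  by apply: sqB; rewrite -?rtauB; apply: le_trans (rtau_le _) _ => //; exact: pB.
have h3 : `|itau (G' * star y') ^+ 2 - itau (G * star y) ^+ 2| <= 2 * Lp * `|k| * (2 * (2 * (e^-1 * N))).
  apply: sqB; rewrite -?itauB; apply: le_trans (itau_le _) _; rewrite ?ler_wpM2l ?pB //.
  by rewrite -mulrA ler_wpM2l.
have -> : e * rtau G' ^+ 2 + (rtau (G' * star y') ^+ 2 - itau (G' * star y') ^+ 2) -
   (e * rtau G ^+ 2 + (rtau (G * star y) ^+ 2 - itau (G * star y) ^+ 2)) =
   e * (rtau G' ^+ 2 - rtau G ^+ 2) + ((rtau (G' * star y') ^+ 2 - rtau (G * star y) ^+ 2)
    - (itau (G' * star y') ^+ 2 - itau (G * star y) ^+ 2)) by ring.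
rewrite [X in _ <= X]mulrDl; apply: le_trans (ler_normD _ _) _; apply: lerD.
  rewrite normrM gtr0_norm // -!mulrA ler_wpM2l ?(ltW e0) //.
  by move: h1; rewrite -!mulrA [`|k| * _]mulrC -!mulrA.
rewrite [X in _ <= X]mulrDl; apply: le_trans (ler_normB _ _) _; apply: lerD.
  by move: h2; rewrite -!mulrA [`|k| * _]mulrC -!mulrA.
move: h3; move/le_trans; apply; rewrite le_eqVlt; apply/orP; left; apply/eqP; ring.
Qed.

End HamiltonJacobi.

(** * From the Brownian motion to a single semicircular element *)

Section Reduction.
Context {R : realType} {A : tracialVNA R}.
Variables (x0 : A) (sigma : R -> A).
Hypotheses (hsigma : free_semicircular_BM sigma) (hx0 : selfadjoint x0).
Hypothesis hfree : forall t : R, 0 < t -> freely_independent x0 (sigma t).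

Lemma semicircular_BM (t : R) : 0 < t -> semicircular t (sigma t).
Proof.
case: hsigma => s0 sc _ t0; have := sc 0 t (lexx _) t0.
by rewrite s0 !subr0.
Qed.

Lemma semicircular_selfadjoint (v : R) (s : A) : semicircular v s -> selfadjoint s.
Proof. by case=> mu []. Qed.

(* By the Schwinger-Dyson equations, [(x0, sigma t)] and
   [(x0, sqrt t *: sigma 1)] have the same joint moments. *)
Lemma S_fun_Phi (t : R) (lambda : R[i]) (e : R) : 0 <= t -> 0 < e ->
  S_fun x0 sigma t lambda e = Phi x0 (sigma 1) (Num.sqrt t) lambda e.
Proof.
move=> t0 e0.
change (rtau (op_log (shifted_sq (shifted x0 (sigma t) lambda) e)) =
  rtau (op_log (shifted_sq (shifted x0 ((Num.sqrt t)%:C *: sigma 1) lambda) e))).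
have [<-|tn0] := eqVneq 0 t.
  by case: hsigma => -> _ _; rewrite sqrtr0 scale0r.
have tp : 0 < t by rewrite lt_neqAle tn0.
have s1 := semicircular_BM ltr01; have st := semicircular_BM tp.
have sa1 := semicircular_selfadjoint s1; have sat := semicircular_selfadjoint st.
apply: rtau_log_transfer => //.
  by rewrite /selfadjoint /= starZr (sa1 : star _ = _).
move=> l; apply: (@word_SD_moments _ _ _ _ _ t).
  (* Variance [t] with scaling 1 here, variance 1 with scaling [sqrt t] below: both give the
     equation with constant [t]. *)
  by have := semicircular_word_SD 1 tp st (hfree tp); rewrite scale1r expr1n mul1r.
have := semicircular_word_SD (Num.sqrt t) ltr01 s1 (hfree ltr01).
by rewrite mulr1 sqr_sqrtr.
Qed.

End Reduction.

Theorem theorem3p1 (R : realType) (A : tracialVNA R) (x0 : A) (sigma : R -> A)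
    (hsigma : free_semicircular_BM sigma)
    (hx0 : selfadjoint x0)
    (hfree : forall t : R, 0 < t -> freely_independent x0 (sigma t))
    (hlaw : ~ law_supported_at_point x0) :
  let S := S_fun x0 sigma in
  (forall t a b eps : R, 0 <= t -> 0 < eps ->
     exists St Sa Sb Seps : R,
       [/\ is_derive_nonneg (fun t' => S t' (a +i* b) eps) t St,
           is_derive a 1 (fun a' => S t (a' +i* b) eps) Sa,
           is_derive b 1 (fun b' => S t (a +i* b') eps) Sb,
           is_derive eps 1 (fun eps' => S t (a +i* b) eps') Seps &
           St = 4^-1 * (Sa ^+ 2 - Sb ^+ 2) + eps * Seps ^+ 2]) /\
  (forall (lambda : R[i]) (eps : R), 0 < eps ->
     (S 0 lambda eps)%:C =
       tau (op_log (abs_sq (x0 - lambda%:A) + (eps%:C)%:A))).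
Proof.
move=> S; have s1 := semicircular_BM hsigma ltr01.
have sa1 := semicircular_selfadjoint s1; have fr1 := hfree 1 ltr01.
have SPhi t lambda e := @S_fun_Phi R A x0 sigma hsigma hx0 hfree t lambda e.
split=> [t a b e t0 e0|lambda e e0]; last first.
  rewrite /S /S_fun; case: hsigma => -> _ _; rewrite scaler0 addr0.
  (* The logarithm is self-adjoint, so the real part taken in [S_fun] loses nothing. *)
  rewrite -tau_real //.
  have c0 : 0 < opnorm (x0 - lambda%:A) ^+ 2 + e by rewrite ltr_wpDl ?sqr_ge0.
  apply: (star_op_log (star_shifted_sq (x0 - lambda%:A) e) c0).
    exact: sqrt_contraction_lt1 e0 c0.
  exact: opnorm_contraction.
set r := Num.sqrt t; set y := ypath x0 (sigma 1) r (a +i* b).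
set p := resolvent y e * star y.
have [L FL] := Fpath_lipschitz x0 (sigma 1) r (a +i* b) e0.
exists (Fpath x0 (sigma 1) r (a +i* b) e), (- 2 * rtau p), (2 * itau p), (rtau (resolvent y e)).
split.
- apply: (is_derive_nonneg_sqrt (phi := fun r => Phi x0 (sigma 1) r (a +i* b) e)
    (F := fun r => Fpath x0 (sigma 1) r (a +i* b) e) t0 _ _ FL).
    by move=> t' t'0; exact: SPhi.
  by move=> q; exact: is_derive_Phi_r.
- have -> : (fun a' => S t (a' +i* b) e) = (fun a' => Phi x0 (sigma 1) r (a' +i* b) e).
    by apply/funext => a'; exact: SPhi.
  exact: is_derive_Phi_a.
- have -> : (fun b' => S t (a +i* b') e) = (fun b' => Phi x0 (sigma 1) r (a +i* b') e).
    by apply/funext => b'; exact: SPhi.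
  exact: is_derive_Phi_b.
(* [S] is identified with [Phi] for positive shifts only, hence on a neighbourhood of [e]. *)
- apply: near_eq_is_derive (is_derive_Phi_e x0 (sigma 1) r (a +i* b) e0).
  have e_oy : e \in `]0, +oo[ by rewrite in_itv /= e0.
  apply: filterS (near_in_itvoy e_oy) => e'; rewrite in_itv /= andbT => e'0.
  by rewrite [RHS]SPhi.
- by rewrite /Fpath -/y -/p; field.
Qed.
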